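(* Let $n\ge1$, $p\in(1,\infty)$, $s\in(0,1)$ and define $\gamma_\circ(s)=\min\{1,\frac{sp}{p-1}\}$. Let $C\ge 0$ and let $u\in C(\bar B_2)\cap L^{p-1}_{sp}(\mathbb{R}^n)$ be a viscosity solution to $$-C\le\mathscr{L}u\le C\quad\text{in }B_2.$$ Then $u\in C^{0,\gamma}(B_1)$ for every $\gamma\in(0,\gamma_\circ(s))$, and for such $\gamma$ $$\|u\|_{C^{0,\gamma}(B_1)}\le C_1\Bigl(\sup_{B_2}|u|+\mathrm{Tail}(u;0,2)+C^{\frac1{p-1}}\Bigr)$$ for some constant $C_1$ dependent only on $\gamma,\lambda,\Lambda,n,p$ and $s$. Furthermore, if $\frac{sp}{p-1}\ne1$, then $u\in C^{0,\gamma_\circ(s)}(B_1)$ and $$\|u\|_{C^{0,\gamma_\circ(s)}(B_1)}\le C_2\Bigl(\sup_{B_2}|u|+\mathrm{Tail}(u;0,2)+C^{\frac1{p-1}}\Bigr)$$ for some constant $C_2$ dependent only on $\lambda,\Lambda,n,s$ and $p$.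
   Context: $B_r(x_0)$ is the open ball of radius $r$ centred at $x_0$ and $B_r=B_r(0)$. $K:\mathbb{R}^n\setminus\{0\}\to(0,\infty)$ is a continuous function, symmetric ($K(z)=K(-z)$), with $\frac{\lambda}{|z|^{n+ps}}\le K(z)\le\frac{\Lambda}{|z|^{n+ps}}$ for $z\neq0$, where $0<\lambda\le\Lambda$. The operator is $\mathscr{L}u(x)=\mathrm{PV}\int_{\mathbb{R}^n}|u(x)-u(y)|^{p-2}(u(x)-u(y))K(x-y)\,dy$. $L^{p-1}_{sp}(\mathbb{R}^n)=\{v\in L^{p-1}_{\rm loc}(\mathbb{R}^n):\int_{\mathbb{R}^n}\frac{|v(z)|^{p-1}}{(1+|z|)^{n+sp}}dz<\infty\}$ and $\mathrm{Tail}(v;x,r)=\bigl(r^{sp}\int_{|z-x|\ge r}\frac{|v(z)|^{p-1}}{|z-x|^{n+sp}}dz\bigr)^{\frac1{p-1}}$. $\|\cdot\|_{C^{0,\gamma}(A)}$ is the sup norm plus the $\gamma$-Hölder seminorm $\sup_{x\ne y\in A}|u(x)-u(y)|/|x-y|^\gamma$. Viscosity solutions. For an open set $D$ and $\eta\in C^2(D)$ let $N_\eta=\{x\in D:\nabla\eta(x)=0\}$, $d_\eta(x)=\mathrm{dist}(x,N_\eta)$, and let $C^2_\beta(D)$ be the set of $\eta\in C^2(D)$ with $\sup_{x\in D\setminus N_\eta}\bigl[\frac{\min\{d_\eta(x),1\}^{\beta-1}}{|\nabla\eta(x)|}+\frac{|D^2\eta(x)|}{d_\eta(x)^{\beta-2}}\bigr]<\infty$.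 A function $u:\mathbb{R}^n\to\mathbb{R}$ is a viscosity subsolution to $\mathscr{L}u=g$ in an open set $\Omega$ if: (i) $u$ is upper semicontinuous in $\bar\Omega$; (ii) whenever $\eta\in C^2(B_r(x_0))$ with $B_r(x_0)\subset\Omega$, $\eta(x_0)=u(x_0)$, $\eta\ge u$ in $B_r(x_0)$, and either (a) $p>\frac2{2-s}$ or $\nabla\eta(x_0)\neq0$, or (b) $1<p\le\frac{2}{2-s}$, $\nabla\eta(x_0)=0$, $x_0$ is an isolated critical point of $\eta$, and $\eta\in C^2_\beta(B_r(x_0))$ for some $\beta>\frac{sp}{p-1}$, then $\mathscr{L}\eta_r(x_0)\le g(x_0)$, where $\eta_r=\eta$ in $B_r(x_0)$ and $\eta_r=u$ otherwise; (iii) $u_+\in L^{p-1}_{sp}(\mathbb{R}^n)$. $u$ is a viscosity supersolution to $\mathscr{L}u=g$ if $-u$ is a viscosity subsolution to $\mathscr{L}v=-g$. Being a viscosity solution to $-C\le\mathscr{L}u\le C$ means being a viscosity subsolution to $\mathscr{L}u=C$ and a viscosity supersolution to $\mathscr{L}u=-C$. *)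

(* Defs.v *)
From HB Require Import structures.
From mathcomp Require Import all_boot all_order all_algebra.
From mathcomp Require Import all_classical all_reals all_analysis.

Set Implicit Arguments.
Unset Strict Implicit.
Unset Printing Implicit Defensive.

Import Order.TTheory GRing.Theory Num.Theory.
Import numFieldNormedType.Exports.

Local Open Scope classical_set_scope.
Local Open Scope ring_scope.

(** * Lebesgue measure on R^n *)

(* The coordinate sigma-algebra, set up as the library does for n.-tuple T. *)
Definition rV_display : measure_display -> measure_display.
Proof. exact. Qed.

Section measurable_rV.
Variables (R : realType) (n : nat).

Let coord (i : 'I_n) (x : 'rV[R]_n) : measurableTypeR R := x ord0 i.

Let rV_set0 : g_sigma_preimage coord set0.
Proof. exact: sigma_algebra0. Qed.

Let rV_setC A : g_sigma_preimage coord A -> g_sigma_preimage coord (~` A).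
Proof. exact: sigma_algebraC. Qed.

Let rV_bigcup (F : _^nat) : (forall i, g_sigma_preimage coord (F i)) ->
  g_sigma_preimage coord (\bigcup_i (F i)).
Proof. exact: sigma_algebra_bigcup. Qed.

HB.instance Definition _ := @isMeasurable.Build
  (rV_display (measure_tuple_display default_measure_display))
  'rV[R]_n (g_sigma_preimage coord) rV_set0 rV_setC rV_bigcup.

Lemma measurable_coord (i : 'I_n) :
  measurable_fun [set: 'rV[R]_n] (coord i).
Proof.
move=> _ Y mY; rewrite setTI; apply: sub_sigma_algebra => /=.
rewrite -bigcup_seq/=; exists i => /=; first by rewrite mem_index_enum.
by exists Y => //; rewrite setTI.
Qed.

Lemma measurable_fun_coordP d (T : measurableType d) (f : T -> 'rV[R]_n) :
  (forall i, measurable_fun [set: T] (coord i \o f)) ->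
  measurable_fun [set: T] f.
Proof.
move=> mf _ A mA; rewrite setTI.
suff : g_sigma_preimage (fun i => coord i \o f) `<=` measurable.
  apply; rewrite g_sigma_preimage_comp; exists A => //.
  by rewrite setTI.
apply: smallest_sub; first exact: sigma_algebra_measurable.
rewrite -bigcup_seq; apply: bigcup_sub => i _ _ [B mB <-].
exact: mf.
Qed.

End measurable_rV.

Section lebesgue_rV.
Variable R : realType.

Definition rV_cons n (x : measurableTypeR R * 'rV[R]_n) : 'rV[R]_n.+1 :=
  row_mx (const_mx x.1 : 'rV_1) x.2.

Lemma rV_cons0 n (x : R * 'rV[R]_n) : rV_cons x ord0 ord0 = x.1.
Proof.
rewrite (_ : ord0 = lshift n (@ord0 0)); last exact/val_inj.
by apply: (etrans (row_mxEl _ _ _ _)); rewrite mxE.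
Qed.

Lemma rV_consS n (x : R * 'rV[R]_n) i :
  rV_cons x ord0 (lift ord0 i) = x.2 ord0 i.
Proof.
rewrite (_ : lift ord0 i = rshift 1 i); last exact/val_inj.
exact: row_mxEr.
Qed.

Lemma measurable_rV_cons n :
  measurable_fun [set: measurableTypeR R * 'rV[R]_n] (@rV_cons n).
Proof.
apply: measurable_fun_coordP => i.
case: (unliftP ord0 i) => [j|] ->.
  apply: (eq_measurable_fun
    ((fun y : 'rV[R]_n => y ord0 j : measurableTypeR R) \o snd)) => [x _|].
    exact/esym/rV_consS.
  exact: measurableT_comp (@measurable_coord R n j) measurable_snd.
apply: (eq_measurable_fun fst) => [x _|]; last exact: measurable_fst.
exact/esym/rV_cons0.
Qed.

Definition rV_measure_cons n (mu : {measure set 'rV[R]_n -> \bar R}) :=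
  pushforward (@lebesgue_measure R \x^ mu)%E (@rV_cons n).

HB.instance Definition _ n (mu : {measure set 'rV[R]_n -> \bar R}) :=
  Measure.copy (rV_measure_cons mu)
    (measure_function_pushforward__canonical__measure_function_Measure
      (@lebesgue_measure R \x^ mu)%E (@measurable_rV_cons n)).

Fixpoint lebesgue_rV_prod n : {measure set 'rV[R]_n -> \bar R} :=
  match n with
  | 0 => \d_ (0 : 'rV[R]_0)
  | m.+1 => rV_measure_cons (lebesgue_rV_prod m)
  end.

Lemma measurable_rV_box n (A : 'I_n -> set R) :
  (forall i, measurable (A i)) ->
  measurable [set x : 'rV[R]_n | forall i, A i (x ord0 i)].
Proof.
move=> mA.
have -> : [set x : 'rV[R]_n | forall i, A i (x ord0 i)] =
    \bigcap_(i in [set: 'I_n]) [set x : 'rV[R]_n | A i (x ord0 i)].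
  by apply/seteqP; split => x /= H i; [move=> _; exact: H|exact: H].
apply: fin_bigcap_measurable => [|i _]; first exact: finite_finset.
have := @measurable_coord R n i measurableT (A i) (mA i).
by rewrite setTI.
Qed.

Lemma lebesgue_rV_prodE n (A : 'I_n -> set R) :
  (forall i, measurable (A i)) ->
  lebesgue_rV_prod n [set x | forall i, A i (x ord0 i)] =
  (\prod_(i < n) lebesgue_measure (A i))%E.
Proof.
elim: n A => [|n IH] A mA.
  by rewrite big_ord0 /= diracE mem_set//= => -[].
rewrite big_ord_recl -IH //.
have mA' := @measurable_rV_box n (fun i => A (lift ord0 i)) (fun i => mA _).
rewrite -(product_measure2E (@lebesgue_measure R) (lebesgue_rV_prod n)
  (mA ord0) mA').
rewrite /= /rV_measure_cons /pushforward; congr (_ _).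
apply/seteqP; split => -[a x] /=.
  move=> H; split => [|i]; first by move: (H ord0); rewrite rV_cons0.
  by move: (H (lift ord0 i)); rewrite rV_consS.
case=> a0 H i; case: (unliftP ord0 i) => [j|] ->; rewrite ?rV_cons0 ?rV_consS//.
Qed.

(* R^n with the sigma-algebra of Lebesgue measurable sets *)
Definition lebesgue_rV_type n :=
  caratheodory_type (@mu_ext _ 'rV[R]_n R (lebesgue_rV_prod n)).

Definition lebesgue_rV n : {measure set (lebesgue_rV_type n) -> \bar R} :=
  @completed_measure_extension _ _ R (lebesgue_rV_prod n).

End lebesgue_rV.

Notation lebesgue_measurable u :=
  (measurable_fun [set: lebesgue_rV_type _ _] u) (only parsing).

(** * Euclidean geometry and C^2 functions *)

(* The library's norm and ball on 'rV_n are those of the sup norm. *)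
Definition enorm (R : realType) m n (A : 'M[R]_(m, n)) : R :=
  Num.sqrt (\sum_i \sum_j A i j ^+ 2).

Definition eball (R : realType) n (x : 'rV[R]_n) (r : R) : set 'rV[R]_n :=
  [set y | enorm (y - x) < r].

Section C2.
Variables (R : realType) (n : nat).
Implicit Types (D : set 'rV[R]_n) (f : 'rV[R]_n -> R) (x : 'rV[R]_n).

Definition partial (i : 'I_n) f : 'rV[R]_n -> R := 'D_(delta_mx 0 i) f.

Definition grad f x : 'rV[R]_n := \row_i partial i f x.

Definition hessian f x : 'M[R]_n := \matrix_(i, j) partial j (partial i f) x.

(* meant for D open *)
Definition C2 D f := forall x, D x ->
  [/\ {for x, continuous f},
      forall i, derivable f x (delta_mx 0 i) /\ {for x, continuous (partial i f)} &
      forall i j, derivable (partial i f) x (delta_mx 0 j) /\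
                  {for x, continuous (partial j (partial i f))}].

Definition critical D f : set 'rV[R]_n := [set x | D x /\ grad f x = 0].

(* This is 0 when [critical D f] is empty (instead of +oo); where C2beta is
   used below the centre of the ball D is a critical point. *)
Definition dist_critical D f x : R := inf [set enorm (x - z) | z in critical D f].

Definition C2beta (beta : R) D f := C2 D f /\
  has_ubound [set Num.min (dist_critical D f x) 1 `^ (beta - 1) / enorm (grad f x) +
                  enorm (hessian f x) / dist_critical D f x `^ (beta - 2)
             | x in D `\` critical D f].

End C2.

(** * The nonlocal operator *)

Section nonlocal.
Variables (R : realType) (n : nat) (p s : R).
Implicit Types (K u g eta : 'rV[R]_n -> R) (Omega : set 'rV[R]_n).

Local Notation mu := (@lebesgue_rV R n).

(* K is only evaluated away from 0. *)
Definition admissible_kernel (lam Lam : R) K :=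
  [/\ forall z, z != 0 -> {for z, continuous K},
      forall z, z != 0 -> 0 < K z,
      forall z, z != 0 -> K (- z) = K z &
      forall z, z != 0 ->
        lam / enorm z `^ (n%:R + p * s) <= K z <= Lam / enorm z `^ (n%:R + p * s)].

(* The principal value, with values in \bar R: the truncated integrals may be
   infinite. *)
Definition nonlocal_op K u (x : 'rV[R]_n) : \bar R :=
  lim ((fun e : R => \int[mu]_(y in ~` eball x e)
    (`|u x - u y| `^ (p - 2) * (u x - u y) * K (x - y))%:E)%E @ 0^'+).

Definition Lsp u :=
  [/\ lebesgue_measurable u,
      forall A, compact A -> (\int[mu]_(z in A) (`|u z| `^ (p - 1))%:E < +oo)%E &
      (\int[mu]_z (`|u z| `^ (p - 1) / (1 + enorm z) `^ (n%:R + s * p))%:E < +oo)%E].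

Definition Tail u (x : 'rV[R]_n) (r : R) : \bar R :=
  (((r `^ (s * p))%:E * \int[mu]_(z in ~` eball x r)
      (`|u z| `^ (p - 1) / enorm (z - x) `^ (n%:R + s * p))%:E) `^ (p - 1)^-1)%E.

Definition usc_on (A : set 'rV[R]_n) u := forall x, A x -> forall a, u x < a ->
  \forall y \near within A (nbhs x), u y < a.

(* The test functions eta for which the operator is defined at x0. *)
Definition admissible_test eta (x0 : 'rV[R]_n) (r : R) :=
  (2 / (2 - s) < p \/ grad eta x0 != 0) \/
  [/\ 1 < p <= 2 / (2 - s), grad eta x0 = 0,
      \forall y \near x0^', grad eta y != 0 &
      exists2 beta, s * p / (p - 1) < beta & C2beta beta (eball x0 r) eta].

Definition glued eta u (x0 : 'rV[R]_n) (r : R) (y : 'rV[R]_n) : R :=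
  if enorm (y - x0) < r then eta y else u y.

Definition viscosity_sub K g Omega u :=
  [/\ usc_on (closure Omega) u,
      forall (x0 : 'rV[R]_n) r eta, 0 < r -> eball x0 r `<=` Omega ->
        C2 (eball x0 r) eta -> eta x0 = u x0 ->
        (forall y, eball x0 r y -> u y <= eta y) ->
        admissible_test eta x0 r ->
        (nonlocal_op K (glued eta u x0 r) x0 <= (g x0)%:E)%E &
      Lsp u^\+].

Definition viscosity_super K g Omega u :=
  viscosity_sub K (fun x => - g x) Omega (fun x => - u x).

End nonlocal.

(** * Hoelder norms *)

Section holder.
Variables (R : realType) (n : nat).
Implicit Types (A : set 'rV[R]_n) (u : 'rV[R]_n -> R).

Definition sup_norm A u : \bar R := ereal_sup [set `|u x|%:E | x in A].

Definition holder_seminorm (gam : R) A u : \bar R :=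
  ereal_sup [set (`|u z.1 - u z.2| / enorm (z.1 - z.2) `^ gam)%:E
            | z in [set z | [/\ A z.1, A z.2 & z.1 != z.2]]].

(* Neither supremum is over the empty set if A has two points. *)
Definition holder_norm gam A u : \bar R :=
  (sup_norm A u + holder_seminorm gam A u)%E.

Definition holder gam A u := (holder_norm gam A u < +oo)%E.

End holder.

(* Main.v *)
From HB Require Import structures.
Require Import Defs.
From mathcomp Require Import all_boot all_order all_algebra.
From mathcomp Require Import all_classical all_reals all_analysis.
From mathcomp Require Import measurable_realfun.
From mathcomp Require Import ring lra.

Set Implicit Arguments.
Unset Strict Implicit.
Unset Printing Implicit Defensive.

Import Order.TTheory GRing.Theory Num.Theory.
Import numFieldNormedType.Exports.

Local Open Scope classical_set_scope.
Local Open Scope ring_scope.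

(** The proof is the Ishii-Lions method of doubling variables, iterated.

    By homogeneity one may divide u by sup |u| + Tail u + C^(1/(p-1)): it is
    enough to bound the oscillation of functions v with |v| <= 1 in B_2, tail at
    most 1 and right-hand side at most 1 ([normalized]).  Write J(t) for
    |t|^(p-2) t.

    The equation is used only through [viscosity_paraboloid].  If v is touched
    from above at x, in the ball of radius r, by a paraboloid with slope g and
    opening H, and 2 H r <= |g|, then the integral of J(v(x) - v(x+z)) K(z) over
    |z| >= r is at most 1 + C0 |g|^(p-2) H r^(p-ps).  As g is not 0, paraboloids
    are admissible test functions for every p.  The truncated integrals of the
    paraboloid over |z| < r are monotone once z and -z are averaged, so the
    principal value exists; and it is estimated, also for p < 2, where J is not
    Lipschitz, by summing translates along g, which telescope
    ([integral_J_increment_le]).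

    If v(x) - v(y) <= L |x-y|^gam fails in a smaller ball for a large L, then
    v(x) - v(y) - L phi(|x-y|) - m |x-x0|^2, with phi concave and comparable to
    t^gam ([profile]), has a positive maximum at an interior pair (xb, yb) whose
    distance t is positive and small.  At xb and yb paraboloids of slope about
    L t^(gam-1) touch v from above and from below.  Subtracting the two integral
    inequalities bounds the integral of (J(T1) - J(T2)) K, where
    T1 = v(xb) - v(xb+z) and T2 = v(yb) - v(yb+z).  For z close to a = xb - yb,
    comparison with the pairs (xb+z, yb) and (xb, yb+z), at distances about 2t
    and 0, and the concavity of phi give a gain of order L^(p-1) t^E with
    E = gam (p-1) - ps, up to a correction when gam = 1 ([phi_gap]).  Comparison
    with (xb+z, yb+z) gives T1 >= T2 up to the penalisation for the other z, at
    a loss that does not grow with L ([penalty_loss]), and the part |z| < r costs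
    a small multiple of L^(p-1) t^E when r is a small multiple of the right power
    of t.  As E <= 0, this is absurd for L large ([maximum_inequality],
    [doubling_step]).

    The loss from the penalisation is integrable near z = 0 only if v is already
    Hoelder continuous with an exponent kappa not far below gam.  Starting from
    kappa = 0, which is the bound |v| <= 1, the exponent is raised by fixed
    amounts up to every gam < min(1, sp/(p-1)) ([holder_bound_lt]).  One more
    step reaches sp/(p-1) if it is less than 1 ([holder_bound_critical]), where
    E = 0 is allowed, and the exponent 1 if sp > p-1 ([holder_bound_lipschitz]),
    where E < 0 leaves room for the weaker concavity of t - t^(1+th)/8. *)

(** * Euclidean geometry of row vectors *)

Lemma eq_ler d (T : porderType d) (x y : T) : x = y -> (x <= y)%O.
Proof. by move=> ->. Qed.

Section euclid.
Variables (R : realType) (n : nat).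
Implicit Types (x y z g : 'rV[R]_n) (r t : R).

Definition dot x y : R := \sum_j x 0 j * y 0 j.

Lemma enormE x : enorm x = Num.sqrt (dot x x).
Proof. by rewrite /enorm big_ord1; congr Num.sqrt; apply: eq_bigr => j _; rewrite expr2. Qed.

Lemma dotC x y : dot x y = dot y x.
Proof. by apply: eq_bigr => j _; rewrite mulrC. Qed.

Lemma dotDl x y z : dot (x + y) z = dot x z + dot y z.
Proof. by rewrite -big_split; apply: eq_bigr => j _; rewrite mxE mulrDl. Qed.

Lemma dotZl t x y : dot (t *: x) y = t * dot x y.
Proof. by rewrite mulr_sumr; apply: eq_bigr => j _; rewrite mxE mulrA. Qed.

Lemma dotNl x y : dot (- x) y = - dot x y.
Proof. by rewrite -scaleN1r dotZl mulN1r. Qed.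

Lemma dotDr x y z : dot z (x + y) = dot z x + dot z y.
Proof. by rewrite dotC dotDl !(dotC z). Qed.

Lemma dotNr x y : dot x (- y) = - dot x y.
Proof. by rewrite dotC dotNl dotC. Qed.

Lemma dotZr t x y : dot x (t *: y) = t * dot x y.
Proof. by rewrite dotC dotZl dotC. Qed.

Lemma dot_ge0 x : 0 <= dot x x.
Proof. by apply: sumr_ge0 => j _; rewrite -expr2 sqr_ge0. Qed.

Lemma sqr_enorm x : enorm x ^+ 2 = dot x x.
Proof. by rewrite enormE sqr_sqrtr ?dot_ge0. Qed.

Lemma enorm_ge0 x : 0 <= enorm x.
Proof. exact: sqrtr_ge0. Qed.

Lemma coord_le_enorm x j : `|x 0 j| <= enorm x.
Proof.
rewrite -(@ler_pXn2r _ 2)// ?nnegrE ?enorm_ge0// sqr_enorm real_normK ?num_real//.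
rewrite /dot (bigD1 j)//= -expr2 lerDl.
by apply: sumr_ge0 => i _; rewrite -expr2 sqr_ge0.
Qed.

Lemma enorm0 : enorm (0 : 'rV[R]_n) = 0.
Proof. by rewrite enormE /dot big1 ?sqrtr0// => j _; rewrite mxE mul0r. Qed.

Lemma enorm_eq0 x : (enorm x == 0) = (x == 0).
Proof.
apply/eqP/eqP => [x0|->]; last exact: enorm0.
apply/rowP => j; rewrite mxE; apply/eqP; rewrite -normr_eq0 -(@le_anti _ _ `|x 0 j| 0)//.
by rewrite -{1}x0 coord_le_enorm normr_ge0.
Qed.

Lemma enorm_gt0 x : (0 < enorm x) = (x != 0).
Proof. by rewrite lt_def enorm_ge0 andbT enorm_eq0. Qed.

Lemma enormZ t x : enorm (t *: x) = `|t| * enorm x.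
Proof. by rewrite !enormE dotZl dotZr mulrA -expr2 sqrtrM ?sqr_ge0// sqrtr_sqr. Qed.

Lemma enormN x : enorm (- x) = enorm x.
Proof. by rewrite -scaleN1r enormZ normrN1 mul1r. Qed.

Lemma enormBC x y : enorm (x - y) = enorm (y - x).
Proof. by rewrite -enormN opprB. Qed.

Lemma cauchy_schwarz x y : dot x y <= enorm x * enorm y.
Proof.
have [->|x0] := eqVneq x 0.
  by rewrite enorm0 mul0r -(scale0r x) dotZl mul0r.
have nx : 0 < enorm x ^+ 2 by rewrite exprn_gt0// enorm_gt0.
have := dot_ge0 (enorm x ^+ 2 *: y - dot x y *: x).
rewrite !(dotDl, dotDr, dotNl, dotNr, dotZl, dotZr) (dotC y x) -!sqr_enorm => h.
have h2 : 0 <= enorm x ^+ 2 * (enorm x ^+ 2 * enorm y ^+ 2 - dot x y ^+ 2).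
  by apply: le_trans h _; apply: eq_ler; ring.
rewrite pmulr_rge0// subr_ge0 -exprMn in h2.
apply: le_trans (ler_norm _) _.
rewrite -(@ler_pXn2r _ 2)// ?nnegrE ?mulr_ge0 ?enorm_ge0//.
by rewrite real_normK// num_real.
Qed.

Lemma norm_dot_le x y : `|dot x y| <= enorm x * enorm y.
Proof.
by rewrite ler_norml cauchy_schwarz andbT lerNl -dotNl -(enormN x) cauchy_schwarz.
Qed.

Lemma sqr_enormD x y : enorm (x + y) ^+ 2 = enorm x ^+ 2 + 2 * dot x y + enorm y ^+ 2.
Proof. by rewrite !sqr_enorm dotDl !dotDr (dotC y x); ring. Qed.

Lemma enormD x y : enorm (x + y) <= enorm x + enorm y.
Proof.
rewrite -(@ler_pXn2r _ 2)// ?nnegrE ?addr_ge0 ?enorm_ge0//.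
by rewrite sqr_enormD; have := cauchy_schwarz x y; lra.
Qed.

Lemma enormB x y : enorm (x - y) <= enorm x + enorm y.
Proof. by rewrite -(enormN y) enormD. Qed.

Lemma enorm_triB x y : enorm x - enorm y <= enorm (x - y).
Proof. by rewrite lerBlDr -{1}(subrK y x) enormD. Qed.

Lemma enorm_triD x y : enorm x - enorm y <= enorm (x + y).
Proof. by rewrite -{1}(enormN y) -{2}(opprK y) enorm_triB. Qed.

(** The square root is concave: sqrt (A + B) <= sqrt A + B / (2 sqrt A). *)
Lemma enorm_taylor x z : x != 0 ->
  enorm (x + z) <= enorm x + dot x z / enorm x + enorm z ^+ 2 / (2 * enorm x).
Proof.
move=> x0; have nx : 0 < enorm x by rewrite enorm_gt0.
have := sqr_ge0 (enorm (x + z) - enorm x).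
have e := sqr_enormD x z.
rewrite sqrrB e mulr2n => h.
have : 2 * enorm x * enorm (x + z) <=
   2 * enorm x * (enorm x + dot x z / enorm x + enorm z ^+ 2 / (2 * enorm x)).
  have -> : 2 * enorm x * (enorm x + dot x z / enorm x + enorm z ^+ 2 / (2 * enorm x))
    = 2 * enorm x ^+ 2 + 2 * dot x z + enorm z ^+ 2.
    by field; rewrite gt_eqF.
  lra.
have nx2 : 0 < 2 * enorm x by lra.
by move=> h2; rewrite -(ler_pM2l nx2).
Qed.

Lemma enorm_le_sum x : enorm x <= \sum_j `|x 0 j|.
Proof.
rewrite -(@ler_pXn2r _ 2)// ?nnegrE ?sumr_ge0 ?enorm_ge0// sqr_enorm expr2 mulr_suml.
apply: ler_sum => j _; apply: le_trans (ler_norm _) _; rewrite normrM ler_wpM2l//.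
by rewrite (bigD1 j)//= lerDl sumr_ge0.
Qed.

Lemma coord_le_norm x j : `|x 0 j| <= `|x|.
Proof.
have /mapP[i Hi ->] : `|x 0 j| \in [seq `|x v.1 v.2| | v : 'I_1 * 'I_n].
  by apply/mapP; exists (0, j) => //=; rewrite mem_enum.
by rewrite [leRHS]/Num.norm /= mx_normrE; apply/bigmax_geP; right => /=; exists i.
Qed.

Lemma enorm_le_norm x : enorm x <= n%:R * `|x|.
Proof.
apply: le_trans (enorm_le_sum x) _.
rewrite mulr_natl -[X in _ *+ X](card_ord n) -sumr_const.
by apply: ler_sum => j _; exact: coord_le_norm.
Qed.

Lemma norm_le_enorm x : `|x| <= enorm x.
Proof.
rewrite [leLHS]/Num.norm /= mx_normrE; apply/bigmax_leP; split; first exact: enorm_ge0.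
by move=> [i j] _ /=; rewrite (ord1 i) coord_le_enorm.
Qed.

(** Turns Euclidean estimates into continuity for the sup norm of the row
    vectors. *)
Lemma lipschitz_continuous (k : R) (f : 'rV[R]_n -> R) :
  (forall x y, `|f x - f y| <= k * enorm (x - y)) -> continuous f.
Proof.
move=> fk x; apply/(@cvgrPdist_le R R^o _ _ (nbhs_filter x)) => /= e e0.
have c0 : 0 < (`|k| + 1) * n.+1%:R by rewrite mulr_gt0// ltr_wpDl.
apply/(@nbhs_normP _ 'rV[R]_n).
exists (((`|k| + 1) * n.+1%:R)^-1 * e) => [|y /= yx].
  by rewrite /= mulr_gt0// invr_gt0.
apply: (le_trans (fk _ _)).
apply: (@le_trans _ _ ((`|k| + 1) * enorm (x - y))).
  by rewrite ler_wpM2r ?enorm_ge0// (le_trans (ler_norm k))// lerDl.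
apply: (@le_trans _ _ ((`|k| + 1) * (n.+1%:R * `|x - y|))).
  rewrite ler_wpM2l ?addr_ge0//; apply: (le_trans (enorm_le_norm _)).
  by rewrite ler_wpM2r// ler_nat.
by rewrite mulrA -ler_pdivlMl// ltW.
Qed.

Lemma continuous_enorm : continuous (@enorm R 1 n).
Proof.
apply: (@lipschitz_continuous 1) => x y; rewrite mul1r.
by rewrite ler_norml enorm_triB lerNl opprB enormBC enorm_triB.
Qed.

Lemma continuous_dot g : continuous (dot g).
Proof.
apply: (@lipschitz_continuous (enorm g)) => x y.
by rewrite -dotNr -dotDr norm_dot_le.
Qed.

Lemma continuous_enormB y : continuous (fun x => enorm (x - y)).
Proof.
move=> x; apply: (continuous_comp (f := fun x => x - y) (g := @enorm R 1 n)).
  by apply: continuousB; [exact: cvg_id|exact: cst_continuous].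
exact: continuous_enorm.
Qed.

Lemma open_eball x r : open (eball x r).
Proof. by move/continuousP : (@continuous_enormB x) => /(_ _ (@open_lt R r)). Qed.

Definition cball x r : set 'rV[R]_n := [set y | enorm (y - x) <= r].

Lemma closed_cball x r : closed (cball x r).
Proof. by apply: (closed_comp _ (@closed_le R r)) => z _; exact: continuous_enormB. Qed.

Lemma compact_cball x r : compact (cball x r).
Proof.
apply: bounded_closed_compact; last exact: closed_cball.
exists (r + enorm x); split; first exact: num_real.
move=> t rt y /= yx; apply: le_trans (norm_le_enorm _) _.
by apply: ltW; apply: le_lt_trans rt; rewrite -lerBlDr; apply: le_trans (enorm_triB _ _) yx.
Qed.

End euclid.

(** * Lebesgue measure under translations and reflections *)

Section line.
Variable R : realType.
Implicit Types (b : bool) (h : R).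

(** The sign is a boolean so that translations (b = false) and point reflections
    (b = true) are handled together. *)
Definition flip1 b h (t : measurableTypeR R) : measurableTypeR R :=
  h + (-1) ^+ b * t.

Lemma measurable_flip1 b h : measurable_fun setT (flip1 b h).
Proof.
apply: measurable_funD; first exact: measurable_cst.
by apply: measurable_funM; [exact: measurable_cst|exact: measurable_id].
Qed.

Lemma lebesgue_flip1 b h (A : set (measurableTypeR R)) : measurable A ->
  lebesgue_measure (flip1 b h @^-1` A) = lebesgue_measure A.
Proof.
move=> mA.
pose m : {measure set (measurableTypeR R) -> \bar R} :=
  measure_function_pushforward__canonical__measure_function_Measure
    (@lebesgue_measure R) (measurable_flip1 b h).
apply/esym; rewrite -[RHS]/(m A); apply: lebesgue_measure_unique => // _ [[x y]] /= _ <-.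
rewrite /m /= /pushforward.
case: b m => m; rewrite /flip1 /=.
- have -> : (fun t : R => h + (-1) ^+ true * t) @^-1` `]x, y] = `[h - y, h - x[%classic.
    by apply/seteqP; split => t /=; rewrite !in_itv/= expr1 mulN1r => /andP[? ?]; apply/andP; split; lra.
  rewrite !lebesgue_measure_itv /= !lte_fin.
  by rewrite ltrD2l ltrN2; case: ifP => // _; rewrite -!EFinB; congr (_%:E); lra.
- have -> : (fun t : R => h + (-1) ^+ false * t) @^-1` `]x, y] = `]x - h, y - h]%classic.
    by apply/seteqP; split => t /=; rewrite !in_itv/= expr0 mul1r => /andP[? ?]; apply/andP; split; lra.
  rewrite !lebesgue_measure_itv /= !lte_fin.
  by rewrite ltrD2r; case: ifP => // _; rewrite -!EFinB; congr (_%:E); lra.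
Qed.

End line.

Section flip.
Variables (R : realType) (n : nat).
Implicit Types (b : bool) (h z : 'rV[R]_n).

Definition flip b h z : 'rV[R]_n := h + (-1) ^+ b *: z.

Lemma flipK b h : cancel (flip b h) (flip b (- ((-1) ^+ b *: h))).
Proof.
move=> z; rewrite /flip scalerDr scalerA -signr_addb addbb expr0 scale1r.
by rewrite addrA addNr add0r.
Qed.

Lemma flipKV b h : cancel (flip b (- ((-1) ^+ b *: h))) (flip b h).
Proof.
move=> z; rewrite /flip scalerDr scalerN !scalerA -signr_addb addbb expr0 !scale1r.
by rewrite addrA subrr add0r.
Qed.

Lemma measurable_flip b h : measurable_fun setT (flip b h).
Proof.
apply: measurable_fun_coordP => i.
apply: (eq_measurable_fun
  ((flip1 b (h ord0 i)) \o (fun z : 'rV[R]_n => z ord0 i : measurableTypeR R))).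
  by move=> z _; rewrite /= /flip /flip1 !mxE.
by apply: measurableT_comp; [exact: measurable_flip1|exact: measurable_coord].
Qed.

(* Boxes with measurable sides generate the sigma-algebra, and on a box the
   measure is a product of one-dimensional ones. *)
Let box (A : 'I_n -> set (measurableTypeR R)) : set 'rV[R]_n :=
  [set x | forall i, A i (x ord0 i)].

Let boxes : set (set 'rV[R]_n) :=
  [set B | exists2 A, (forall i, measurable (A i)) & B = box A].

Let boxesI : setI_closed boxes.
Proof.
move=> _ _ [A mA ->] [B mB ->]; exists (fun i => A i `&` B i).
  by move=> i; exact: measurableI.
by apply/seteqP; split => x /= => [[? ?] i|H]; split => // i; case: (H i).
Qed.

Let boxesE : @measurable _ 'rV[R]_n = <<s boxes >>.
Proof.
apply/seteqP; split.
  apply: smallest_sub; first exact: smallest_sigma_algebra.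
  rewrite -bigcup_seq => B [i _ [Y mY <-]]; apply: sub_sigma_algebra.
  exists (fun j => if j == i then Y else setT); first by move=> j; case: ifP.
  rewrite setTI; apply/seteqP; split => x /=.
    by move=> Yx j; case: ifPn => // /eqP ->.
  by move=> /(_ i); rewrite eqxx.
apply: smallest_sub; first exact: sigma_algebra_measurable.
by move=> _ [A mA ->]; exact: measurable_rV_box.
Qed.

Let cube (k : nat) : set 'rV[R]_n := box (fun=> `[- k%:R, k%:R]%classic).

Lemma lebesgue_rV_prod_flip b h (A : set 'rV[R]_n) : measurable A ->
  lebesgue_rV_prod R n (flip b h @^-1` A) = lebesgue_rV_prod R n A.
Proof.
move=> mA; apply/esym.
pose m : {measure set 'rV[R]_n -> \bar R} :=
  measure_function_pushforward__canonical__measure_function_Measure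
    (lebesgue_rV_prod R n) (measurable_flip b h).
rewrite -[RHS]/(m A).
apply: (@measure_unique _ R _ boxes cube) => //.
- by move=> k; exists (fun=> `[- k%:R, k%:R]%classic) => // i; exact: measurable_itv.
- rewrite -subTset => x _; exists (Num.bound `|x|) => // i.
  rewrite /= in_itv/= -ler_norml; apply: le_trans (coord_le_norm x i) _.
  by apply/ltW; exact: archi_boundP.
- move=> _ [B mB ->]; rewrite lebesgue_rV_prodE// /m /= /pushforward.
  have -> : flip b h @^-1` box B = box (fun i => flip1 b (h ord0 i) @^-1` B i).
    by apply/seteqP; split => x /= H i; move: (H i); rewrite /flip /flip1 !mxE.
  rewrite lebesgue_rV_prodE; last first.
    by move=> i; rewrite -[X in measurable X]setTI; exact: measurable_flip1.
  by apply: eq_bigr => i _; rewrite lebesgue_flip1.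
- move=> k; rewrite lebesgue_rV_prodE//.
  set P := (X in (X < _)%E); suff : P \is a fin_num.
    by rewrite fin_numElt; case/andP.
  rewrite /P; elim/big_ind : _ => // [x y|i _]; first exact: fin_numM.
  by rewrite lebesgue_measure_itv/=; case: ifP.
Qed.

End flip.

Section lebesgue_completed.
Variables (R : realType) (n : nat).
Implicit Types (b : bool) (h z : 'rV[R]_n) (A : set 'rV[R]_n).

Local Notation mu := (@lebesgue_rV R n).
Local Notation T := (lebesgue_rV_type R n).

Lemma lebesgue_rV_measurable A : measurable A -> measurable (A : set T).
Proof. by move=> mA; apply: sub_caratheodory; exact: sub_sigma_algebra. Qed.

Lemma lebesgue_rVE A : measurable A -> mu A = lebesgue_rV_prod R n A.
Proof. exact: measurable_mu_extE. Qed.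

(** The image of a cover is a cover by sets of the same measure; invariance of
    the outer measure is what passes to all Lebesgue measurable sets. *)
Lemma mu_ext_flip_le b h A :
  (mu_ext (lebesgue_rV_prod R n) (flip b h @^-1` A) <=
   mu_ext (lebesgue_rV_prod R n) A)%E.
Proof.
apply: le_ereal_inf_tmp => _ [F [mF AF] <-].
apply: ereal_inf_lbound; exists (fun k => flip b h @^-1` F k).
  split => [k|z /AF[k _ Fk]]; last by exists k.
  by rewrite -[X in measurable X]setTI; exact: measurable_flip.
by apply: eq_eseriesr => k _; rewrite lebesgue_rV_prod_flip.
Qed.

Lemma mu_ext_flip b h A :
  mu_ext (lebesgue_rV_prod R n) (flip b h @^-1` A) =
  mu_ext (lebesgue_rV_prod R n) A.
Proof.
apply/eqP; rewrite eq_le mu_ext_flip_le/=.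
have := @mu_ext_flip_le b (- ((-1) ^+ b *: h)) (flip b h @^-1` A).
rewrite (_ : flip b (- ((-1) ^+ b *: h)) @^-1` (flip b h @^-1` A) = A)//.
by apply/seteqP; split => z /=; rewrite flipKV.
Qed.

Lemma lebesgue_measurable_flip b h :
  measurable_fun [set: T] (flip b h : T -> T).
Proof.
move=> _ A mA; rewrite setTI.
change (caratheodory_measurable (mu_ext (lebesgue_rV_prod R n)) (flip b h @^-1` A)) => X.
pose g := flip b (- ((-1) ^+ b *: h)).
have gK Y : flip b h @^-1` (g @^-1` Y) = Y.
  by apply/seteqP; split => z /=; rewrite /g flipK.
have -> : mu_ext (lebesgue_rV_prod R n) X =
    mu_ext (lebesgue_rV_prod R n) (g @^-1` X) by rewrite mu_ext_flip.
rewrite (mA (g @^-1` X)).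
have e Y : mu_ext (lebesgue_rV_prod R n) (g @^-1` X `&` Y) =
    mu_ext (lebesgue_rV_prod R n) (X `&` flip b h @^-1` Y).
  by rewrite -(mu_ext_flip b h) preimage_setI gK.
by congr (_ + _)%E; exact: e.
Qed.

Lemma lebesgue_rV_flip b h (A : set T) : measurable A ->
  mu (flip b h @^-1` A) = mu A.
Proof. by move=> _; exact: mu_ext_flip. Qed.

Lemma ge0_integral_flip b h (D : set T) (f : T -> \bar R) :
  measurable D -> measurable_fun D f -> (forall x, D x -> (0 <= f x)%E) ->
  (\int[mu]_(x in D) f x = \int[mu]_(x in flip b h @^-1` D) f (flip b h x))%E.
Proof.
move=> mD mf f0.
rewrite -(@ge0_integral_pushforward _ _ _ _ R (flip b h : T -> T)
  (@lebesgue_measurable_flip b h) mu _ f mD mf); last first.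
  by move=> x; rewrite inE; exact: f0.
apply: (@eq_measure_integral _ T R D
  (measure_function_pushforward__canonical__measure_function_Measure
    mu (@lebesgue_measurable_flip b h)) mu f) => A mA _.
by rewrite -[LHS](lebesgue_rV_flip b h mA).
Qed.

Lemma integral_flip b h (D : set T) (f : T -> \bar R) :
  measurable D -> measurable_fun D f ->
  (\int[mu]_(x in D) f x = \int[mu]_(x in flip b h @^-1` D) f (flip b h x))%E.
Proof.
move=> mD mf; rewrite integralE [RHS]integralE.
congr (_ - _)%E.
  rewrite (ge0_integral_flip b h mD (measurable_funepos mf)).
    by apply: eq_integral => x _; rewrite !funeposE.
  by move=> x _; exact: funepos_ge0.
rewrite (ge0_integral_flip b h mD (measurable_funeneg mf)).
  by apply: eq_integral => x _; rewrite !funenegE.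
by move=> x _; exact: funeneg_ge0.
Qed.

End lebesgue_completed.

Section open_measurable_rV.
Variables (R : realType) (n : nat).

(** An open set is the countable union of the rational boxes that it contains. *)
Lemma open_measurable_rV (U : set 'rV[R]_n) : open U -> measurable U.
Proof.
move=> oU.
have aux (e k q x y : R) : k < e / 2 -> x - k < q -> q < x + k ->
    q - k < y -> y < q + k -> `|x - y| < e.
  by move=> *; rewrite ltr_norml; apply/andP; split; lra.
pose box (q : 'rV[rat]_n * nat) : set 'rV[R]_n :=
  [set x | forall i, `]ratr (q.1 0 i) - q.2.+1%:R^-1, ratr (q.1 0 i) + q.2.+1%:R^-1[%classic (x ord0 i)].
have -> : U = \bigcup_(q in [set q | box q `<=` U]) box q.
  apply/seteqP; split => [x Ux|x [q qU]]; last exact: qU.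
  have [e e0 eU] : exists2 e : R, 0 < e & ball x e `<=` U.
    by move: (oU) => /(_ _ Ux)/(@nbhs_ballP _ 'rV[R]_n)[e /= e0 eU]; exists e.
  have [k ke] : exists k : nat, k.+1%:R^-1 < e / 2.
    exists (Num.bound (e / 2)^-1).
    rewrite invf_plt ?posrE ?divr_gt0//.
    apply: (lt_le_trans (archi_boundP _)); last by rewrite ler_nat.
    by rewrite invr_ge0 divr_ge0// ltW.
  have /choice[q qP] : forall i, exists q : rat, ratr q \in `]x ord0 i - k.+1%:R^-1, x ord0 i + k.+1%:R^-1[.
    by move=> i; apply: rat_in_itvoo; rewrite ltrD2l gtrN// invr_gt0.
  have k0 : 0 < k.+1%:R^-1 :> R by rewrite invr_gt0.
  exists (\row_i q i, k).
    move=> y /= yb; apply: eU; rewrite -ball_normE/=.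
    change (`|x - y| < e); rewrite [X in X < _]/Num.norm /= mx_normrE; apply/bigmax_ltP; split => // -[i j] _ /=.
    rewrite (ord1 i : i = ord0) !mxE; move: (qP j); rewrite in_itv/= => /andP[? ?].
    move: (yb j); rewrite /box /= in_itv/= !mxE => /andP[? ?].
    exact: (@aux e (k.+1%:R^-1) (ratr (q j))).
  move=> i; move: (qP i); rewrite /= in_itv/= => /andP[? ?]; rewrite in_itv/= !mxE.
  by apply/andP; split; [rewrite ltrBlDr|rewrite -ltrBlDr].
rewrite bigcup_mkcond; apply: countable_bigcupT_measurable => [|q]; first exact: countableP.
case: ifP => _; last exact: measurable0.
apply: (@measurable_rV_box R n (fun i =>
  `]ratr (q.1 0 i) - q.2.+1%:R^-1, ratr (q.1 0 i) + q.2.+1%:R^-1[%classic)) => i.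
exact: measurable_itv.
Qed.

End open_measurable_rV.

(** * Power functions and the signed power *)

Section powers.
Variable R : realType.
Implicit Types a b x y t S : R.

Lemma powR_le_pos a x y : 0 <= a -> 0 <= x -> x <= y -> x `^ a <= y `^ a.
Proof. by move=> a0 x0 xy; apply: ge0_ler_powR; rewrite ?nnegrE// (le_trans x0). Qed.

Lemma powR_le_neg a x y : a <= 0 -> 0 < x -> x <= y -> y `^ a <= x `^ a.
Proof.
move=> a0 x0 xy; rewrite -(opprK a) !(powRN _ (- a)).
have y0 : 0 < y by exact: lt_le_trans x0 xy.
rewrite lef_pV2 ?posrE ?powR_gt0//; apply: powR_le_pos => //; last exact: ltW.
by rewrite oppr_ge0.
Qed.

Lemma powR_ge1 a x : 0 <= a -> 1 <= x -> 1 <= x `^ a.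
Proof. by move=> a0 x1; apply: le_trans (ler_powR x1 a0); rewrite powRr0. Qed.

Lemma powR_le1 a x : 0 <= a -> 0 <= x <= 1 -> x `^ a <= 1.
Proof.
move=> a0 /andP[x0 x1].
by apply: le_trans (powR_le_pos a0 x0 x1) _; rewrite powR1.
Qed.

Lemma powRD_pos x a b : 0 < x -> x `^ (a + b) = x `^ a * x `^ b.
Proof. by move=> x0; rewrite powRD// (gt_eqF x0) implybT. Qed.

Lemma powRV x a : 0 <= x -> x^-1 `^ a = (x `^ a)^-1.
Proof. by move=> x0; rewrite -powR_inv1// -powRrM mulN1r powRN. Qed.

Lemma powR_div x y a : 0 <= x -> 0 <= y -> (x / y) `^ a = x `^ a / y `^ a.
Proof. by move=> x0 y0; rewrite powRM ?invr_ge0// powRV. Qed.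

Lemma powR_dyadic a r t : 0 < r -> r / 2 <= t -> t <= r ->
  t `^ a <= 2 `^ `|a| * r `^ a.
Proof.
move=> r0 rt tr; have t0 : 0 < t by apply: lt_le_trans rt; rewrite divr_gt0.
have [a0|/ltW a0] := leP 0 a.
  apply: le_trans (powR_le_pos a0 (ltW t0) tr) _.
  rewrite ler_peMl ?powR_ge0//.
  by rewrite powR_ge1// ler1n.
apply: le_trans (powR_le_neg a0 _ rt) _; first by rewrite divr_gt0.
rewrite ler0_norm// powR_div ?(ltW r0)// powRN mulrC.
by rewrite lexx.
Qed.

Lemma dyadic_ratio_gt0 a : 0 < a -> 0 < 1 - 2 `^ (- a) :> R.
Proof.
move=> a0; rewrite subr_gt0 powRN invf_lt1 ?powR_gt0//.
by have := @gt0_ltr_powR R a a0 1 2; rewrite !nnegrE powR1; apply => //; exact: ltr1n.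
Qed.

(** Young's inequality with exponents 1/a and 1/(1-a), applied to y^a and 1. *)
Lemma bernoulli_le a y : 0 <= a <= 1 -> 0 <= y -> y `^ a <= 1 + a * (y - 1).
Proof.
move=> /andP[a0 a1] y0.
have [->|an0] := eqVneq a 0; first by rewrite powRr0 mul0r addr0.
have [->|an1] := eqVneq a 1; first by rewrite powRr1// mul1r addrC subrK.
have a0' : 0 < a by rewrite lt_def an0.
have a1' : 0 < 1 - a by rewrite subr_gt0 lt_def eq_sym an1.
have := @conjugate_powR R (y `^ a) 1 a^-1 (1 - a)^-1 (powR_ge0 _ _) ler01.
rewrite !invr_gt0 !invrK => /(_ a0' a1'); rewrite addrCA subrr addr0 => /(_ erefl).
rewrite mulr1 -powRrM mulfV// powRr1// powR1; lra.
Qed.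

Lemma bernoulli_ge a y : 1 <= a -> 0 <= y -> 1 + a * (y - 1) <= y `^ a.
Proof.
move=> a1 y0; have a0 : 0 < a by lra.
have := @bernoulli_le a^-1 (y `^ a); rewrite invr_ge0 ltW//= invf_le1// a1 => /(_ erefl (powR_ge0 _ _)).
rewrite -powRrM mulfV ?gt_eqF// powRr1// => h.
have : a * y <= a * (1 + a^-1 * (y `^ a - 1)) by rewrite ler_pM2l.
by rewrite mulrDr mulrA mulfV ?gt_eqF//; lra.
Qed.

Lemma powR_tangent_le a x y : 0 <= a <= 1 -> 0 < x -> 0 <= y ->
  y `^ a <= x `^ a + a * x `^ (a - 1) * (y - x).
Proof.
move=> a01 x0 y0; have := @bernoulli_le a (y / x) a01.
rewrite divr_ge0 ?(ltW x0)// => /(_ erefl).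
rewrite -(@ler_pM2l _ (x `^ a)) ?powR_gt0// powR_div ?(ltW x0)// mulrCA mulfV ?gt_eqF ?powR_gt0//.
rewrite mulr1 => /le_trans; apply; apply: eq_ler.
rewrite powRD_pos// powR_inv1 ?ltW//; field; exact: lt0r_neq0.
Qed.

Lemma powR_tangent_ge a x y : 1 <= a -> 0 < x -> 0 <= y ->
  x `^ a + a * x `^ (a - 1) * (y - x) <= y `^ a.
Proof.
move=> a1 x0 y0; have := @bernoulli_ge a (y / x) a1.
rewrite divr_ge0 ?(ltW x0)// => /(_ erefl).
rewrite -(@ler_pM2l _ (x `^ a)) ?powR_gt0// powR_div ?(ltW x0)// [X in _ <= X]mulrCA mulfV ?gt_eqF ?powR_gt0//.
rewrite mulr1; apply: le_trans; apply: eq_ler.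
rewrite powRD_pos// powR_inv1 ?ltW//; field; exact: lt0r_neq0.
Qed.

Lemma powR_subadd a x y : 0 < a <= 1 -> 0 <= x -> 0 <= y ->
  (x + y) `^ a <= x `^ a + y `^ a.
Proof.
move=> /andP[a0 a1] x0 y0.
have xy0 : 0 <= x + y by rewrite addr_ge0.
have key z : 0 <= z -> z <= x + y -> z * (x + y) `^ (a - 1) <= z `^ a.
  move=> z0 zxy; rewrite -[leRHS]mulr_powRB1//.
  move: z0; rewrite le_eqVlt => /predU1P[<-|z0]; first by rewrite !mul0r.
  by rewrite ler_pM2l// powR_le_neg// subr_le0.
rewrite -[leLHS]mulr_powRB1// mulrDl lerD//; apply: key => //.
  by rewrite lerDl.
by rewrite lerDr.
Qed.

Lemma powR_superadd a x y : 1 <= a -> 0 <= x -> 0 <= y ->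
  x `^ a + y `^ a <= (x + y) `^ a.
Proof.
move=> a1 x0 y0; have a0 : 0 < a by lra.
have xy0 : 0 <= x + y by rewrite addr_ge0.
rewrite -[leRHS]mulr_powRB1// mulrDl -(mulr_powRB1 x0 a0) -(mulr_powRB1 y0 a0).
have a10 : 0 <= a - 1 by rewrite subr_ge0.
by rewrite lerD// ler_wpM2l// powR_le_pos// ?lerDl ?lerDr.
Qed.

End powers.

Section signed_power.
Variables (R : realType) (p : R).
Hypothesis p1 : 1 < p.
Implicit Types t b S : R.

Definition J t : R := `|t| `^ (p - 2) * t.

Let p0 : 0 < p - 1. Proof. by rewrite subr_gt0. Qed.

Lemma J_ge0E t : 0 <= t -> J t = t `^ (p - 1).
Proof.
move=> t0; rewrite /J ger0_norm// mulrC -[RHS]mulr_powRB1//.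
by congr (_ * _ `^ _); ring.
Qed.

Lemma JN t : J (- t) = - J t.
Proof. by rewrite /J normrN mulrN. Qed.

Lemma J_le0E t : t <= 0 -> J t = - (- t) `^ (p - 1).
Proof. by move=> t0; rewrite -J_ge0E ?oppr_ge0// JN opprK. Qed.

Lemma norm_J t : `|J t| = `|t| `^ (p - 1).
Proof. by rewrite /J normrM (ger0_norm (powR_ge0 _ _)) -J_ge0E// /J normr_id. Qed.

Lemma J_homo : {homo J : s t / s <= t}.
Proof.
move=> s t st; have [s0|/ltW s0] := leP 0 s.
  rewrite !J_ge0E// ?(le_trans s0)//; apply: powR_le_pos => //; exact: ltW.
have [t0|/ltW t0] := leP 0 t.
  rewrite J_le0E// J_ge0E//; apply: (@le_trans _ _ 0); last exact: powR_ge0.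
  by rewrite oppr_le0 powR_ge0.
rewrite !J_le0E// lerN2; apply: powR_le_pos; [exact: ltW| |]; by rewrite ?oppr_ge0 ?lerN2.
Qed.

Lemma JZ M t : 0 <= M -> J (M * t) = M `^ (p - 1) * J t.
Proof.
move=> M0; rewrite /J normrM (ger0_norm M0) powRM// mulrACA; congr (_ * _).
by rewrite -J_ge0E// /J ger0_norm.
Qed.

Let q := Num.min 1 (p - 1).

(** The increment is controlled by the Lipschitz constant of the power for
    p >= 2 and by its Hoelder continuity for p < 2; q interpolates. *)
Lemma J_sub_le : exists2 C, 0 < C & forall t b, 0 <= b ->
  J t - J (t - b) <= C * (b `^ q * (`|t| + b) `^ (p - 1 - q)).
Proof.
have [p2|p2] := leP p 2.
  have qE : q = p - 1 by apply/min_idPr; lra.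
  exists 2 => // t b b0; rewrite qE subrr powRr0 mulr1.
  have a01 : 0 < p - 1 <= 1 by rewrite p0/=; lra.
  have [t0|t0] := leP t 0.
    rewrite !J_le0E//; last lra.
    have := @powR_subadd _ (p - 1) (- t) b a01; rewrite oppr_ge0 => /(_ t0 b0).
    have -> : - (t - b) = - t + b by ring.
    by have := powR_ge0 b (p - 1); lra.
  have [tb|tb] := leP 0 (t - b).
    rewrite !J_ge0E//; last exact: ltW.
    have := @powR_subadd _ (p - 1) (t - b) b a01 tb b0.
    by rewrite subrK; have := powR_ge0 b (p - 1); lra.
  rewrite J_ge0E ?(ltW t0)// J_le0E ?(ltW tb)//.
  have := @powR_le_pos _ (p - 1) t b; have := @powR_le_pos _ (p - 1) (- (t - b)) b.
  move=> h1 h2; have := h1 (ltW p0); have := h2 (ltW p0) (ltW t0).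
  by move=> h3 h4; have := h3 ltac:(lra); have := h4 ltac:(lra) ltac:(lra); lra.
have qE : q = 1 by apply/min_idPl; lra.
exists (2 * (p - 1)) => [|t b b0]; first lra.
rewrite qE powRr1//.
have a1 : 1 <= p - 1 by lra.
have p20 : 0 <= p - 1 - 1 by lra.
have mono x : 0 <= x -> x <= `|t| + b -> (p - 1) * x `^ (p - 1 - 1) * b <=
    2 * (p - 1) * (b * (`|t| + b) `^ (p - 1 - 1)).
  move=> x0 xle; have := powR_le_pos p20 x0 xle => hx.
  have : 0 <= (p - 1) * b * ((`|t| + b) `^ (p - 1 - 1) - x `^ (p - 1 - 1)).
    by rewrite !mulr_ge0 ?subr_ge0//; lra.
  have : 0 <= (p - 1) * b * (`|t| + b) `^ (p - 1 - 1).
    by rewrite !mulr_ge0 ?powR_ge0//; lra.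
  lra.
move: b0; rewrite le_eqVlt => /predU1P[<-|b0].
  by rewrite subr0 subrr mul0r mulr0.
have [t0|t0] := leP t 0.
  rewrite !J_le0E//; last lra.
  have := @powR_tangent_ge _ (p - 1) (- t + b) (- t) a1 ltac:(lra) ltac:(lra).
  have := mono (- t + b) ltac:(lra); rewrite ler0_norm// => /(_ (lexx _)).
  have -> : - (t - b) = - t + b by ring.
  have -> : - t - (- t + b) = - b by ring.
  lra.
have [tb|tb] := leP 0 (t - b).
  rewrite !J_ge0E//; last exact: ltW.
  have := @powR_tangent_ge _ (p - 1) t (t - b) a1 t0 tb.
  have := mono t (ltW t0); rewrite gtr0_norm// => /(_ ltac:(lra)).
  have -> : t - b - t = - b by ring.
  lra.
rewrite J_ge0E ?(ltW t0)// J_le0E ?(ltW tb)//.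
have h1 := @powR_le_pos _ (p - 1) t b (ltW p0) (ltW t0) ltac:(lra).
have h2 := @powR_le_pos _ (p - 1) (- (t - b)) b (ltW p0) ltac:(lra) ltac:(lra).
have h3 := mono b (ltW b0) ltac:(by rewrite lerDr).
have h4 : b `^ (p - 1) <= (p - 1) * b `^ (p - 1 - 1) * b.
  rewrite -[X in X <= _](mulr_powRB1 (ltW b0) p0) -mulrA [X in X <= _]mulrC.
  by rewrite ler_peMl// mulr_ge0 ?powR_ge0 ?(ltW b0).
have h5 : b * b `^ (p - 1 - 1) <= b * (`|t| + b) `^ (p - 1 - 1).
  by rewrite ler_pM2l// powR_le_pos ?lerDr// ltW.
have h6 := mulr_powRB1 (ltW b0) p0.
have : 0 <= (p - 1 - 1) * (b * (`|t| + b) `^ (p - 1 - 1)).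
  by rewrite !mulr_ge0 ?powR_ge0 ?(ltW b0).
lra.
Qed.

Let Q := Num.max 1 (p - 1).

(** The dual of [J_sub_le]: for p >= 2 the worst case is an interval centred at
    0, for p < 2 it is one at an end of the range [-S, S]. *)
Lemma J_add_ge : exists2 c, 0 < c & forall t b S, 0 <= b <= S -> `|t| <= S ->
  0 < S -> c * (b `^ Q * S `^ (p - 1 - Q)) <= J (t + b) - J t.
Proof.
have [p2|p2] := leP 2 p.
  have QE : Q = p - 1 by apply/max_idPr; lra.
  have a1 : 1 <= p - 1 by lra.
  exists (2^-1 `^ (p - 1)); first by rewrite powR_gt0.
  move=> t b S /andP[b0 bS] tS S0; rewrite QE subrr powRr0 mulr1.
  have c1 : 2^-1 `^ (p - 1) * b `^ (p - 1) <= b `^ (p - 1).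
    by rewrite ler_piMl ?powR_ge0// powR_le1//; [lra|apply/andP; split; lra].
  have [t0|t0] := leP 0 t.
    rewrite !J_ge0E// ?addr_ge0//.
    by have := powR_superadd a1 t0 b0; lra.
  have [tb|tb] := leP (t + b) 0.
    rewrite !J_le0E// ?(ltW t0)//.
    have := @powR_superadd _ (p - 1) (- (t + b)) b a1 ltac:(lra) b0.
    have -> : - (t + b) + b = - t by ring.
    lra.
  rewrite J_ge0E ?(ltW tb)// J_le0E ?(ltW t0)// -powRM ?invr_ge0//.
  have := powR_ge0 (t + b) (p - 1); have := powR_ge0 (- t) (p - 1).
  have [h|h] := leP (2^-1 * b) (t + b).
    by have := @powR_le_pos _ (p - 1) (2^-1 * b) (t + b) (ltW p0) ltac:(lra) h; lra.
  by have := @powR_le_pos _ (p - 1) (2^-1 * b) (- t) (ltW p0) ltac:(lra) ltac:(lra); lra.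
have QE : Q = 1 by apply/max_idPl; lra.
have a1 : p - 1 - 1 <= 0 by lra.
have a01 : 0 <= p - 1 <= 1 by rewrite (ltW p0)/=; lra.
exists ((p - 1) * 2 `^ (p - 1 - 1)); first by rewrite mulr_gt0// powR_gt0.
move=> t b S /andP[b0 bS] tS S0; rewrite QE powRr1//.
move: b0; rewrite le_eqVlt => /predU1P[<-|b0].
  by rewrite addr0 subrr mul0r mulr0.
have key x : 0 < x -> x <= 2 * S ->
    (p - 1) * 2 `^ (p - 1 - 1) * (b * S `^ (p - 1 - 1)) <= (p - 1) * x `^ (p - 1 - 1) * b.
  move=> x0 xS; have := powR_le_neg a1 x0 xS; rewrite (powRM _ (ler0n _ 2) (ltW S0)) => h.
  have : 0 <= (p - 1) * b * (x `^ (p - 1 - 1) - 2 `^ (p - 1 - 1) * S `^ (p - 1 - 1)).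
    by rewrite !mulr_ge0 ?subr_ge0// ltW.
  lra.
have [t0|t0] := leP 0 t.
  rewrite !J_ge0E// ?addr_ge0// ?(ltW b0)//.
  have := @powR_tangent_le _ (p - 1) (t + b) t a01 ltac:(lra) t0.
  move: tS; rewrite ger0_norm// => tS.
  have := key (t + b) ltac:(lra) ltac:(lra).
  have -> : t - (t + b) = - b by ring.
  lra.
move: tS; rewrite ltr0_norm// => tS.
have [tb|tb] := leP (t + b) 0.
  rewrite !J_le0E// ?(ltW t0)//.
  have := @powR_tangent_le _ (p - 1) (- t) (- (t + b)) a01 ltac:(lra) ltac:(lra).
  have := key (- t) ltac:(lra) ltac:(lra).
  have -> : - (t + b) - - t = - b by ring.
  lra.
rewrite J_ge0E ?(ltW tb)// J_le0E ?(ltW t0)//.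
have kk y : 0 < y -> y <= S -> y * S `^ (p - 1 - 1) <= y `^ (p - 1).
  move=> y0 yS; rewrite -(mulr_powRB1 (ltW y0) p0).
  by rewrite ler_pM2l// powR_le_neg.
have k1 := kk (t + b) tb ltac:(lra).
have k2 := kk (- t) ltac:(lra) tS.
have k3 : (p - 1) * 2 `^ (p - 1 - 1) <= 1.
  rewrite mulr_ile1 ?powR_ge0//; try lra.
  by apply: le_trans (@ler_powR _ 2 _ _ 0 a1) _; rewrite ?powRr0// ler1n.
have : 0 <= (1 - (p - 1) * 2 `^ (p - 1 - 1)) * (b * S `^ (p - 1 - 1)).
  by rewrite !mulr_ge0 ?subr_ge0 ?powR_ge0 ?(ltW b0).
lra.
Qed.

End signed_power.

(** * Integrals of powers of |z| over balls, annuli and exteriors *)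

Section lebesgue_tools.
Variables (R : realType) (n : nat).
Implicit Types (x z : 'rV[R]_n) (r : R).

Local Notation mu := (@lebesgue_rV R n).
Local Notation T := (lebesgue_rV_type R n).

Lemma measurable_open (U : set 'rV[R]_n) : open U -> measurable (U : set T).
Proof. by move=> oU; apply: lebesgue_rV_measurable; exact: open_measurable_rV. Qed.

Lemma continuous_lebesgue_measurable (U : set 'rV[R]_n) (f : 'rV[R]_n -> R) :
  open U -> (forall x, U x -> {for x, continuous f}) ->
  measurable_fun (U : set T) (f : T -> R).
Proof.
move=> oU cf mU; apply: (measurability _ (RGenOInfty.measurableE R)) => //.
move=> /= _ [_ [a ->] <-]; apply: measurable_open.
rewrite openE => x [Ux fx].
have := cf x Ux; rewrite /prop_for /continuous_at.
move=> /(_ `]a, +oo[%classic) H.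
have /H {}H : nbhs (f x) `]a, +oo[%classic by apply: open_nbhs_nbhs; split=> //; exact: open_itv.
rewrite /interior; apply: filterI; last exact: H.
exact: open_nbhs_nbhs.
Qed.

Lemma measurable_enorm : measurable_fun setT (@enorm R 1 n : T -> R).
Proof.
by apply: (continuous_lebesgue_measurable openT) => x _; exact: continuous_enorm.
Qed.

Lemma measurable_eball x r : measurable (eball x r : set T).
Proof. by apply: measurable_open; exact: open_eball. Qed.

Lemma measurable_eballC x r : measurable (~` eball x r : set T).
Proof. by apply: measurableC; exact: measurable_eball. Qed.

Definition annulus r1 r2 : set T := [set z : 'rV[R]_n | r1 <= enorm z < r2].

Lemma annulusE r1 r2 : annulus r1 r2 = ~` eball 0 r1 `&` eball 0 r2.
Proof.
apply/seteqP; split => z; rewrite /annulus /eball /= !subr0.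
  by move=> /andP[h ->]; split => //; apply/negP; rewrite -leNgt.
by move=> [/negP]; rewrite -leNgt => -> ->.
Qed.

Lemma measurable_annulus r1 r2 : measurable (annulus r1 r2).
Proof.
by rewrite annulusE; apply: measurableI; [exact: measurable_eballC|exact: measurable_eball].
Qed.

Lemma eball0P r z : eball 0 r z <-> enorm z < r.
Proof. by rewrite /eball /= subr0. Qed.

Lemma eballC0P r z : (~` eball 0 r) z <-> r <= enorm z.
Proof. by rewrite /eball /= subr0 leNgt; split => [/negP|/negP]. Qed.

Let cube x r : set 'rV[R]_n :=
  [set y | forall i, `]x ord0 i - r, x ord0 i + r[%classic (y ord0 i)].

Let lebesgue_cube x r : 0 <= r -> mu (cube x r) = ((2 * r) ^+ n)%:E.
Proof.
move=> r0; rewrite lebesgue_rVE; last first.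
  by apply: (@measurable_rV_box R n (fun i => `]x ord0 i - r, x ord0 i + r[%classic)) => i; exact: measurable_itv.
rewrite (@lebesgue_rV_prodE R n (fun i => `]x ord0 i - r, x ord0 i + r[%classic)); last first.
  by move=> i; exact: measurable_itv.
rewrite (eq_bigr (fun=> (2 * r)%:E)) => [|i _]; last first.
  rewrite lebesgue_measure_itv/= lte_fin ltrD2l.
  move: r0; rewrite le_eqVlt => /predU1P[<-|r0]; first by rewrite oppr0 ltxx mulr0.
  by rewrite (lt_trans _ r0) ?oppr_lt0// -EFinB; congr (_%:E); ring.
by rewrite prodEFin prodr_const card_ord.
Qed.

Let measurable_cube x r : measurable (cube x r : set T).
Proof.
apply: lebesgue_rV_measurable.
by apply: (@measurable_rV_box R n (fun i => `]x ord0 i - r, x ord0 i + r[%classic)) => i; exact: measurable_itv.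
Qed.

Lemma lebesgue_eball_le x r : 0 <= r -> (mu (eball x r) <= ((2 * r) ^+ n)%:E)%E.
Proof.
move=> r0; rewrite -(lebesgue_cube x r0); apply: le_measure; rewrite ?inE.
- exact: measurable_eball.
- exact: measurable_cube.
move=> y; rewrite /eball /= => yx i; rewrite /= in_itv/=.
have := le_lt_trans (coord_le_enorm (y - x) i) yx.
by rewrite !mxE ltr_norml => /andP[? ?]; apply/andP; split; lra.
Qed.

Lemma lebesgue_eball_ge : (0 < n)%N -> exists2 c : R, 0 < c &
  forall x r, 0 <= r -> ((c * r ^+ n)%:E <= mu (eball x r))%E.
Proof.
move=> n0; have n0' : 0 < n%:R :> R by rewrite ltr0n.
exists ((2 / n%:R) ^+ n) => [|x r]; first by rewrite exprn_gt0// divr_gt0.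
rewrite le_eqVlt => /predU1P[<-|r0].
  by rewrite expr0n gtn_eqF//= mulr0 measure_ge0.
have rn0 : 0 <= r / n%:R by rewrite divr_ge0// ltW.
have -> : (2 / n%:R) ^+ n * r ^+ n = (2 * (r / n%:R)) ^+ n.
  by rewrite -exprMn mulrAC -mulrA.
rewrite -(lebesgue_cube x rn0); apply: le_measure; rewrite ?inE.
- exact: measurable_cube.
- exact: measurable_eball.
move=> y yx; rewrite /eball /=; apply: le_lt_trans (enorm_le_sum _) _.
have : \sum_(i < n) `|(y - x) 0 i| < \sum_(i < n) (r / n%:R).
  apply: ltr_sum => [|i _]; first by apply/hasP; exists (Ordinal n0) => //; rewrite mem_index_enum.
  have := yx i; rewrite /= in_itv/= !mxE => /andP[? ?].
  by rewrite ltr_norml; apply/andP; split; lra.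
by rewrite sumr_const card_ord -[X in _ < X -> _]mulr_natr divfK// gt_eqF.
Qed.

Lemma lebesgue_eball_fin x r : (mu (eball x r) < +oo)%E.
Proof.
have [r0|r0] := leP 0 r; first by apply: le_lt_trans (lebesgue_eball_le x r0) _; rewrite ltry.
rewrite (_ : eball x r = set0) ?measure0//.
by apply/seteqP; split => y //; rewrite /eball /= => /(le_lt_trans (enorm_ge0 _))/(lt_trans r0); rewrite ltxx.
Qed.

(** The constant C = A / (1 - 2^(-sg)) solves C = A + C 2^(-sg), so that the bound
    passes from radius rho / 2 to radius rho by adding one dyadic annulus; the
    induction starts at the inner radius r, where the annulus is empty. *)
Lemma dyadic_inward (f : T -> \bar R) (A sg r R0 : R) : 0 < sg -> 0 <= A ->
  0 < r -> 0 < R0 ->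
  measurable_fun (annulus r R0) f -> (forall z, (0 <= f z)%E) ->
  (forall rho : R, 0 < rho <= R0 ->
     (\int[mu]_(z in annulus (Num.max r (rho / 2)%R) rho) f z <= (A * rho `^ sg)%R%:E)%E) ->
  (\int[mu]_(z in annulus r R0) f z <= (A / (1 - 2 `^ (- sg)) * R0 `^ sg)%R%:E)%E.
Proof.
move=> sg0 A0 r0 R00 mf f0 hA.
have q1 := dyadic_ratio_gt0 sg0.
pose C := A / (1 - 2 `^ (- sg)).
have CE : C = A + C * 2 `^ (- sg).
  rewrite /C; set w := 2 `^ (- sg) in q1 *; field; exact: lt0r_neq0.
have C0 : 0 <= C by rewrite divr_ge0// ltW.
have H : forall N (rho : R), 0 < rho <= R0 -> rho <= r * 2 ^+ N ->
    (\int[mu]_(z in annulus r rho) f z <= (C * rho `^ sg)%R%:E)%E.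
  elim=> [|N IH] rho /andP[rho0 rhoR].
    rewrite expr0 mulr1 => rr; rewrite (_ : annulus r rho = set0) ?integral_set0.
      by rewrite lee_fin mulr_ge0 ?powR_ge0.
    apply/seteqP; split => z //= /andP[h1 h2].
    by have := lt_le_trans h2 rr; rewrite ltNge h1.
  move=> rN.
  have sub : annulus r rho `<=` annulus r (rho / 2)%R `|` annulus (Num.max r (rho / 2)%R) rho.
    move=> z /= /andP[h1 h2]; have [h3|h3] := ltP (enorm z) (rho / 2).
      by left; rewrite /annulus /= h1.
    by right; rewrite /annulus /= ge_max h1 h3.
  have sub2 : annulus r (rho / 2)%R `|` annulus (Num.max r (rho / 2)%R) rho `<=` annulus r R0.
    move=> z [] /= /andP[h1 h2].
      by rewrite /annulus /= h1/=; apply: lt_le_trans h2 _; lra.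
    by move: h1; rewrite /annulus /= ge_max => /andP[-> _]; exact: lt_le_trans h2 rhoR.
  apply: (@le_trans _ _ (\int[mu]_(z in annulus r (rho / 2)%R `|` annulus (Num.max r (rho / 2)%R) rho) f z)%E).
    apply: ge0_subset_integral => //.
    - exact: measurable_annulus.
    - by apply: measurableU; exact: measurable_annulus.
    - by apply: measurable_funS mf => //; exact: measurable_annulus.
  rewrite ge0_integral_setU//=; last 4 first.
  - exact: measurable_annulus.
  - exact: measurable_annulus.
  - by apply: measurable_funS mf => //; exact: measurable_annulus.
  - rewrite disj_set2E; apply/eqP/seteqP; split => z //= [/andP[_ h1] /andP[h2 _]].
    by move: h2; rewrite ge_max => /andP[_ h2]; have := lt_le_trans h1 h2; rewrite ltxx.
  have -> : (C * rho `^ sg)%:E = ((C * (rho / 2) `^ sg)%R%:E + (A * rho `^ sg)%R%:E)%E.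
    rewrite -EFinD powR_div ?(ltW rho0)// {1}CE powRN; congr (_%:E).
    by ring.
  apply: leeD; last by apply: hA; rewrite rho0.
  apply: IH; first by apply/andP; split; lra.
  by move: rN; rewrite exprS; lra.
have [N hN] : exists N, R0 <= r * 2 ^+ N.
  exists (Num.bound (R0 / r)).
  rewrite mulrC -ler_pdivrMr//; apply/ltW/(lt_le_trans (archi_boundP _)).
    by rewrite divr_ge0// ltW.
  by rewrite -natrX ler_nat ltnW// ltn_expl.
by apply: (H N) => //; rewrite R00 lexx.
Qed.


(** The same induction, on the number of annuli, followed by monotone
    convergence. *)
Lemma dyadic_outward (f : T -> \bar R) (A sg r : R) : 0 < sg -> 0 <= A ->
  0 < r ->
  measurable_fun (~` eball 0 r : set T) f -> (forall z, (0 <= f z)%E) ->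
  (forall rho : R, r <= rho ->
     (\int[mu]_(z in annulus rho (2 * rho)%R) f z <= (A * rho `^ (- sg))%R%:E)%E) ->
  (\int[mu]_(z in ~` eball 0 r) f z <= (A / (1 - 2 `^ (- sg)) * r `^ (- sg))%R%:E)%E.
Proof.
move=> sg0 A0 r0 mf f0 hA.
have q1 := dyadic_ratio_gt0 sg0.
pose C := A / (1 - 2 `^ (- sg)).
have CE : C = A + C * 2 `^ (- sg).
  rewrite /C; set w := 2 `^ (- sg) in q1 *; field; exact: lt0r_neq0.
have C0 : 0 <= C by rewrite divr_ge0// ltW.
have sub1 rho t : r <= rho -> annulus rho t `<=` ~` eball 0 r.
  by move=> rr z /= /andP[h _]; apply/eballC0P; exact: le_trans h.
have H : forall N (rho : R), r <= rho ->
    (\int[mu]_(z in annulus rho (2 ^+ N * rho)%R) f z <= (C * rho `^ (- sg))%R%:E)%E.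
  elim=> [|N IH] rho rr.
    rewrite expr0 mul1r (_ : annulus rho rho = set0) ?integral_set0.
      by rewrite lee_fin mulr_ge0 ?powR_ge0.
    apply/seteqP; split => z //= /andP[h1 h2].
    by have := le_lt_trans h1 h2; rewrite ltxx.
  have rr2 : r <= 2 * rho by lra.
  apply: (@le_trans _ _ (\int[mu]_(z in annulus rho (2 * rho)%R `|` annulus (2 * rho)%R (2 ^+ N * (2 * rho))%R) f z)%E).
    apply: ge0_subset_integral => //.
    - exact: measurable_annulus.
    - by apply: measurableU; exact: measurable_annulus.
    - apply: measurable_funS mf => //; first exact: measurable_eballC.
      by move=> z [] /sub1; apply.
    move=> z /= /andP[h1 h2]; have [h3|h3] := ltP (enorm z) (2 * rho).
      by left; rewrite /annulus /= h1.
    by right; rewrite /annulus /= h3/=; move: h2; rewrite exprS; lra.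
  rewrite ge0_integral_setU//=; last 4 first.
  - exact: measurable_annulus.
  - exact: measurable_annulus.
  - apply: measurable_funS mf => //; first exact: measurable_eballC.
    by move=> z [] /sub1; apply.
  - rewrite disj_set2E; apply/eqP/seteqP; split => z //= [/andP[_ h1] /andP[h2 _]].
    by have := lt_le_trans h1 h2; rewrite ltxx.
  have -> : (C * rho `^ (- sg))%:E = ((A * rho `^ (- sg))%R%:E + (C * (2 * rho) `^ (- sg))%R%:E)%E.
    rewrite -EFinD powRM ?(ltW r0)// ?(le_trans (ltW r0))// {1}CE; congr (_%:E).
    by ring.
  by apply: leeD; [exact: hA|exact: IH].
have -> : ~` eball 0 r = \bigcup_N annulus r (2 ^+ N * r).
  apply/seteqP; split => [z /eballC0P rz|z [N _]]; last exact: sub1.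
  exists (Num.bound (enorm z / r)) => //=; rewrite /annulus /= rz/= -ltr_pdivrMr//.
  apply: (lt_le_trans (archi_boundP _)); first by rewrite divr_ge0 ?enorm_ge0// ltW.
  by rewrite -natrX ler_nat ltnW// ltn_expl.
have cv := @ge0_nondecreasing_set_cvg_integral _ T R (fun N => annulus r (2 ^+ N * r)) f mu.
apply: (cvge_le _ (cv _ _ _ _)).
- by apply: nearW => N; exact: H.
- apply/nondecreasing_seqP => N; apply/subsetPset => z /= /andP[h1 h2].
  rewrite /annulus /= h1/=; apply: lt_le_trans h2 _.
  by rewrite exprS -mulrA ler_peMl ?mulr_ge0 ?exprn_ge0 ?(ltW r0)// ler1n.
- by move=> N; exact: measurable_annulus.
- move=> N; apply: measurable_funS mf => //; first exact: measurable_eballC.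
  exact: sub1.
- by [].
Qed.

Lemma ge0_integral_le_cst (D : set T) (f : T -> \bar R) (M V : R) :
  measurable D -> measurable_fun D f -> (forall z, D z -> (0 <= f z)%E) ->
  0 <= M -> (forall z, D z -> (f z <= M%:E)%E) -> (mu D <= V%:E)%E ->
  (\int[mu]_(z in D) f z <= (M * V)%:E)%E.
Proof.
move=> mD mf f0 M0 fM DV.
apply: (@le_trans _ _ (\int[mu]_(z in D) M%:E)%E).
  by apply: ge0_le_integral => //; exact: measurable_cst.
by rewrite integral_cst// EFinM lee_wpmul2l.
Qed.

Lemma measurable_enorm_powR (D : set T) a : measurable D ->
  measurable_fun D (fun z : T => (enorm (z : 'rV[R]_n) `^ a)%:E).
Proof.
move=> mD; apply/measurable_EFinP.
apply: (measurable_funTS (D := D)).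
by apply: (measurableT_comp (measurable_powR a)); exact: measurable_enorm.
Qed.

Lemma integral_annulus_le (a r1 r2 : R) : 0 < r2 -> r2 / 2 <= r1 ->
  (\int[mu]_(z in annulus r1 r2) (enorm (z : 'rV[R]_n) `^ a)%:E <=
   (2 `^ `|a| * r2 `^ a * (2 * r2) ^+ n)%:E)%E.
Proof.
move=> r20 r12; apply: ge0_integral_le_cst.
- exact: measurable_annulus.
- by apply: measurable_enorm_powR; exact: measurable_annulus.
- by move=> z _; rewrite lee_fin powR_ge0.
- by rewrite mulr_ge0 ?powR_ge0.
- move=> z /= /andP[h1 h2]; rewrite lee_fin; apply: powR_dyadic => //.
    exact: le_trans h1.
  exact: ltW.
- apply: le_trans (lebesgue_eball_le 0 (ltW r20)); apply: le_measure; rewrite ?inE.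
  + exact: measurable_annulus.
  + exact: measurable_eball.
  by move=> z /= /andP[_]; rewrite eball0P.
Qed.

Lemma powR_pown (t a : R) : 0 < t -> t `^ a * t ^+ n = t `^ (a + n%:R).
Proof. by move=> t0; rewrite powRD_pos// powR_mulrn// ltW. Qed.

Lemma integral_ball_powR (sg : R) : 0 < sg -> exists2 C, 0 < C &
  forall r R0 : R, 0 < r -> 0 < R0 ->
  (\int[mu]_(z in annulus r R0) (enorm (z : 'rV[R]_n) `^ (sg - n%:R))%:E <=
   (C * R0 `^ sg)%:E)%E.
Proof.
move=> sg0; set a := sg - n%:R.
have q1 := dyadic_ratio_gt0 sg0.
have A0 : 0 < 2 `^ `|a| * 2 ^+ n :> R by rewrite mulr_gt0 ?powR_gt0 ?exprn_gt0.
exists ((2 `^ `|a| * 2 ^+ n) / (1 - 2 `^ (- sg))); first by rewrite divr_gt0.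
move=> r R0 r0 R00; apply: (dyadic_inward sg0 (ltW A0) r0 R00).
- by apply: measurable_enorm_powR; exact: measurable_annulus.
- by move=> z; rewrite lee_fin powR_ge0.
- move=> rho /andP[rho0 _].
  apply: le_trans (integral_annulus_le _ rho0 _) _; first by rewrite le_max lexx orbT.
  rewrite lee_fin exprMn.
  have -> : rho `^ sg = rho `^ a * rho ^+ n by rewrite powR_pown// /a subrK.
  by apply: eq_ler; ring.
Qed.

Lemma integral_exterior_powR (sg : R) : 0 < sg -> exists2 C, 0 < C &
  forall r : R, 0 < r ->
  (\int[mu]_(z in ~` eball 0 r) (enorm (z : 'rV[R]_n) `^ (- sg - n%:R))%:E <=
   (C * r `^ (- sg))%:E)%E.
Proof.
move=> sg0; set a := - sg - n%:R.
have q1 := dyadic_ratio_gt0 sg0.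
pose A : R := 2 `^ `|a| * 2 `^ a * 4 ^+ n.
have A0 : 0 < A by rewrite !mulr_gt0 ?powR_gt0 ?exprn_gt0.
exists (A / (1 - 2 `^ (- sg))); first by rewrite divr_gt0.
move=> r r0; apply: (dyadic_outward sg0 (ltW A0) r0).
- by apply: measurable_enorm_powR; exact: measurable_eballC.
- by move=> z; rewrite lee_fin powR_ge0.
- move=> rho rr; have rho0 : 0 < rho by exact: lt_le_trans rr.
  apply: le_trans (integral_annulus_le _ _ _) _; [by rewrite mulr_gt0| |].
    by rewrite mulrAC mulfV// mul1r.
  rewrite lee_fin.
  have -> : rho `^ (- sg) = rho `^ a * rho ^+ n by rewrite powR_pown// /a subrK.
  rewrite powRM ?(ltW rho0)// !exprMn /A.
  have -> : 4 ^+ n = 2 ^+ n * 2 ^+ n :> R by rewrite -exprMn; congr (_ ^+ _); ring.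
  by apply: eq_ler; ring.
Qed.

End lebesgue_tools.

(** * The principal value of a paraboloid *)

Section near_field.
Variables (R : realType) (n : nat) (p : R).
Hypothesis p1 : 1 < p.
Implicit Types (x z g : 'rV[R]_n) (r rho H : R).

Local Notation mu := (@lebesgue_rV R n).
Local Notation T := (lebesgue_rV_type R n).
Local Notation J := (J p).

Lemma measurable_J : measurable_fun setT (J : R -> R).
Proof.
apply: measurable_funM; last exact: measurable_id.
by apply: (measurableT_comp (measurable_powR _)); exact: normr_measurable.
Qed.

Lemma measurable_dot g : measurable_fun setT (dot g : T -> R).
Proof.
by apply: (continuous_lebesgue_measurable openT) => x _; exact: continuous_dot.
Qed.

Let J_increment g (a b : R) : T -> R :=
  fun z => J (dot g z + a) - J (dot g z - b).

Let measurable_J_increment g a b : measurable_fun setT (J_increment g a b).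
Proof.
apply: measurable_funB; apply: (measurableT_comp measurable_J).
  by apply: measurable_funD; [exact: measurable_dot|exact: measurable_cst].
by apply: measurable_funB; [exact: measurable_dot|exact: measurable_cst].
Qed.

Let J_increment_ge0 g a b z : 0 <= a + b -> 0 <= J_increment g a b z.
Proof. by move=> ab; rewrite subr_ge0 J_homo//; lra. Qed.

Let p0 : 0 <= p - 1. Proof. by rewrite subr_ge0 ltW. Qed.

Let J_increment_le g a b rho z : enorm z <= 2 * rho -> `|a| <= enorm g * rho ->
  `|b| <= enorm g * rho -> J_increment g a b z <= 2 * (3 * (enorm g * rho)) `^ (p - 1).
Proof.
move=> zr ha hb; rewrite /J_increment.
have hd : `|dot g z| <= 2 * (enorm g * rho).
  by apply: le_trans (norm_dot_le _ _) _; rewrite mulrCA ler_wpM2l ?enorm_ge0.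
have key t : `|t| <= 3 * (enorm g * rho) -> `|J t| <= (3 * (enorm g * rho)) `^ (p - 1).
  by move=> ht; rewrite norm_J// powR_le_pos.
have k1 : `|J (dot g z + a)| <= (3 * (enorm g * rho)) `^ (p - 1).
  by apply: key; apply: le_trans (ler_normD _ _) _; lra.
have k2 : `|J (dot g z - b)| <= (3 * (enorm g * rho)) `^ (p - 1).
  by apply: key; apply: le_trans (ler_normB _ _) _; lra.
by apply: le_trans (ler_norm _) _; apply: le_trans (ler_normB _ _) _; lra.
Qed.

(** The integral of an increment of J along g over a ball is estimated without
    any pointwise bound on the increment, which would be singular on the
    hyperplane orthogonal to g when p < 2: the translates by multiples of
    2 h g / |g|^2 telescope, and about |g| rho / (4 h) of them stay in a ball of
    comparable size. *)
Lemma integral_J_increment_le : exists2 C, 0 < C & forall g H rho,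
  0 < H -> 0 < rho -> 2 * H * rho <= enorm g ->
  (\int[mu]_(z in eball 0 rho)
     (J (dot g z + H * rho ^+ 2) - J (dot g z - H * rho ^+ 2))%:E <=
   (C * (enorm g `^ (p - 2) * H * rho `^ (n%:R + p)))%:E)%E.
Proof.
exists (8 * 4 ^+ n * 3 `^ (p - 1)); first by rewrite !mulr_gt0 ?exprn_gt0 ?powR_gt0.
move=> g H rho H0 rho0 Hg.
have g0 : 0 < enorm g by apply: lt_le_trans Hg; rewrite !mulr_gt0.
pose h := H * rho ^+ 2; have h0 : 0 < h by rewrite mulr_gt0// exprn_gt0.
pose X := enorm g / (2 * H * rho).
have X1 : 1 <= X by rewrite ler_pdivlMr ?mul1r// !mulr_gt0.
have [N N1 NX] : exists2 N : nat, X / 2 <= N%:R & N%:R <= X.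
  have := truncn_itv (le_trans ler01 X1) => /andP[t1 t2].
  exists (Num.truncn X) => //.
  have : (1 <= (Num.truncn X)%:R :> R).
    rewrite ler1n lt0n; apply/eqP => t0; move: t2; rewrite t0.
    by rewrite ltNge X1.
  by move: t2; rewrite -natr1; lra.
have hg : h <= enorm g * rho.
  rewrite /h expr2 mulrA ler_pM2r//; have : 0 < H * rho by rewrite mulr_gt0.
  lra.
(* Translation by w raises g . z by 2h, the length of one increment. *)
pose w : 'rV[R]_n := (2 * h / enorm g ^+ 2) *: g.
have gw : dot g w = 2 * h by rewrite dotZr -sqr_enorm divfK// expf_neq0// gt_eqF.
have nw : enorm w = 2 * h / enorm g.
  rewrite enormZ ger0_norm ?divr_ge0 ?exprn_ge0 ?enorm_ge0 ?mulr_ge0 ?ltW//.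
  by field; rewrite gt_eqF.
pose f := J_increment g h h.
pose fk (k : nat) := J_increment g ((2 * k%:R + 1) * h) ((1 - 2 * k%:R) * h).
have mE (D : set T) (F : T -> R) : measurable_fun setT F -> measurable_fun D (EFin \o F).
  by move=> mF; apply/measurable_EFinP; exact: measurable_funTS.
have fk0 k z : 0 <= fk k z by apply: J_increment_ge0; rewrite -mulrDl mulr_ge0// ?ltW//; lra.
have shift k : (k < N)%N ->
    (\int[mu]_(z in eball 0 rho) (f z)%:E <= \int[mu]_(z in eball 0 (2 * rho)%R) (fk k z)%:E)%E.
  move=> kN.
  have := @ge0_integral_flip R n false (k%:R *: w) (eball 0 rho) (EFin \o f)
    (measurable_eball _ _) (mE _ _ (measurable_J_increment g h h)).
  rewrite /= => -> //; last by move=> z _; rewrite lee_fin J_increment_ge0// addr_ge0// ltW.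
  have fE z : f (flip false (k%:R *: w) z) = fk k z.
    rewrite /f /fk /J_increment /flip expr0 scale1r dotDr dotZr gw.
    by congr (J _ - J _); ring.
  rewrite (eq_integral (EFin \o fk k)) => [|z _]; last by rewrite /= fE.
  apply: ge0_subset_integral => //.
  - rewrite -[X in measurable X]setTI.
    exact: (@lebesgue_measurable_flip R n false (k%:R *: w) measurableT _ (measurable_eball _ _)).
  - exact: measurable_eball.
  - by apply: mE; exact: measurable_J_increment.
  - by move=> z _ /=; rewrite lee_fin.
  - move=> z; rewrite /= !eball0P /flip expr0 scale1r => hz.
    have -> : z = (k%:R *: w + z) - k%:R *: w by rewrite addrC addKr.
    apply: le_lt_trans (enormB _ _) _; rewrite enormZ ger0_norm// nw.
    have : k%:R * (2 * h / enorm g) <= rho.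
      apply: (@le_trans _ _ (X * (2 * h / enorm g))).
        have hg0 : 0 <= 2 * h / enorm g by rewrite divr_ge0 ?(ltW g0)//; lra.
        rewrite (ler_wpM2r hg0)//.
        by apply: (le_trans _ NX); rewrite ler_nat ltnW.
      apply: eq_ler; rewrite /X /h; field.
      by rewrite !gt_eqF.
    lra.
have tele z : \sum_(k < N) fk k z = J (dot g z + (2 * N%:R - 1) * h) - J (dot g z - h).
  rewrite -(big_mkord xpredT (fun k => fk k z)).
  rewrite (@telescope_sumr_eq _ 0 N (fun k => J (dot g z + (2 * k%:R - 1) * h))) => [||k _]//.
    by congr (_ - J _); ring.
  by rewrite /fk /J_increment -natr1; congr (J _ - J _); ring.
have bound : (\sum_(k < N) \int[mu]_(z in eball 0 (2 * rho)%R) (fk k z)%:E <=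
    (2 * (3 * (enorm g * rho)) `^ (p - 1) * (2 * (2 * rho)) ^+ n)%:E)%E.
  have mfk (k : 'I_N) : measurable_fun (eball 0 (2 * rho)%R : set T) (fun z : T => (fk k z)%:E).
    by apply: mE; exact: measurable_J_increment.
  rewrite -(ge0_integral_sum mu (measurable_eball _ _) mfk); last first.
    by move=> k z _; rewrite lee_fin.
  rewrite (eq_integral (EFin \o J_increment g ((2 * N%:R - 1) * h) h)); last first.
    by move=> z _; rewrite sumEFin /= tele.
  have N0 : 1 <= N%:R :> R by rewrite ler1n lt0n; apply/eqP => N0; move: N1; rewrite N0; lra.
  apply: ge0_integral_le_cst.
  - exact: measurable_eball.
  - by apply: mE; exact: measurable_J_increment.
  - move=> z _; rewrite lee_fin; apply: J_increment_ge0.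
    by rewrite -[X in _ + X]mul1r -mulrDl mulr_ge0// ?ltW//; lra.
  - by rewrite mulr_ge0 ?powR_ge0.
  - move=> z /eball0P hz; rewrite lee_fin; apply: J_increment_le.
    + exact: ltW.
    + rewrite ger0_norm; last by rewrite mulr_ge0// ?ltW//; lra.
      apply: (@le_trans _ _ (2 * X * h)).
        by rewrite ler_wpM2r ?(ltW h0)//; lra.
      apply: eq_ler; rewrite /X /h; field.
      by rewrite !gt_eqF.
    + by rewrite gtr0_norm.
  - by apply: lebesgue_eball_le; rewrite mulr_ge0// ltW.
have fin : (\int[mu]_(z in eball 0 rho) (f z)%:E)%E \is a fin_num.
  rewrite ge0_fin_numE; last by apply: integral_ge0 => z _; rewrite lee_fin J_increment_ge0// addr_ge0// ltW.
  apply: (@le_lt_trans _ _ (2 * (3 * (enorm g * rho)) `^ (p - 1) * (2 * rho) ^+ n)%:E); last by rewrite ltry.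
  apply: ge0_integral_le_cst.
  - exact: measurable_eball.
  - by apply: mE; exact: measurable_J_increment.
  - by move=> z _; rewrite lee_fin J_increment_ge0// addr_ge0// ltW.
  - by rewrite mulr_ge0 ?powR_ge0.
  - move=> z /eball0P hz; rewrite lee_fin; apply: J_increment_le; rewrite ?gtr0_norm//.
    by lra.
  - by apply: lebesgue_eball_le; rewrite ltW.
change (\int[mu]_(z in eball 0 rho) (f z)%:E <=
  (8 * 4 ^+ n * 3 `^ (p - 1) * (enorm g `^ (p - 2) * H * rho `^ (n%:R + p)))%R%:E)%E.
have main : (\sum_(k < N) \int[mu]_(z in eball 0 rho) (f z)%:E <=
    (2 * (3 * (enorm g * rho)) `^ (p - 1) * (2 * (2 * rho)) ^+ n)%:E)%E.
  by apply: le_trans bound; apply: lee_sum => k _; exact: shift.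
move: fin main; case: (\int[mu]_(z in eball 0 rho) (f z)%:E)%E => // I _.
rewrite sumEFin lee_fin sumr_const card_ord -[X in X <= _ -> _]mulr_natr lee_fin => main.
have XI : X / 2 * I <= 2 * (3 * (enorm g * rho)) `^ (p - 1) * (2 * (2 * rho)) ^+ n.
  have [I0|/ltW I0] := leP 0 I.
    by apply: le_trans main; rewrite mulrC ler_wpM2l.
  apply: (@le_trans _ _ 0); first by rewrite mulr_ge0_le0//; lra.
  by rewrite !mulr_ge0 ?powR_ge0 ?exprn_ge0 ?mulr_ge0 ?(ltW rho0).
have X20 : 0 < X / 2 by lra.
rewrite -(ler_pM2l X20); apply: le_trans XI _.
rewrite powRM ?mulr_ge0 ?(ltW g0) ?(ltW rho0)// powRM ?(ltW g0) ?(ltW rho0)//.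
have -> : enorm g `^ (p - 1) = enorm g * enorm g `^ (p - 2).
  rewrite (_ : p - 1 = 1 + (p - 2)); last by ring.
  by rewrite (powRD_pos 1 (p - 2) g0) powRr1// ltW.
have -> : rho `^ (n%:R + p) = rho * rho `^ (p - 1) * rho ^+ n.
  rewrite (mulr_powRB1 (ltW rho0) (lt_trans ltr01 p1)).
  by rewrite powR_pown// addrC.
rewrite !exprMn (_ : 4 ^+ n = 2 ^+ n * 2 ^+ n :> R); last by rewrite -exprMn; congr (_ ^+ _); ring.
apply: eq_ler; rewrite /X; field.
by rewrite !gt_eqF.
Qed.


Variable s : R.
Hypotheses (s0 : 0 < s) (s1 : s < 1).

Lemma kernel_gap_gt0 : 0 < p - p * s.
Proof. by rewrite -[X in X - _]mulr1 -mulrBr mulr_gt0 ?subr_gt0// (lt_trans ltr01). Qed.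

(** On a dyadic annulus the opening and the kernel are compared with their
    values at the outer radius; the pieces sum because p - ps > 0. *)
Lemma near_field_le : exists2 C, 0 < C & forall g H (e r : R),
  0 < H -> 0 < e -> 0 < r -> 2 * H * r <= enorm g ->
  (\int[mu]_(z in annulus e r)
     ((J (dot g z + H * enorm (z : 'rV[R]_n) ^+ 2) - J (dot g z - H * enorm (z : 'rV[R]_n) ^+ 2)) *
       enorm (z : 'rV[R]_n) `^ (- (n%:R + p * s)))%:E <=
   (C * (enorm g `^ (p - 2) * H * r `^ (p - p * s)))%:E)%E.
Proof.
have [C C0 HC] := integral_J_increment_le.
set a := - (n%:R + p * s).
have sg0 := kernel_gap_gt0; set sg := p - p * s in sg0 *.
have q1 := dyadic_ratio_gt0 sg0.
have c0 : 0 < 2 `^ `|a| :> R by rewrite powR_gt0.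
exists (2 `^ `|a| * C / (1 - 2 `^ (- sg))); first by rewrite !divr_gt0// mulr_gt0.
move=> g H e r H0 e0 r0 Hg.
have G0 : 0 <= enorm g `^ (p - 2) * H by rewrite mulr_ge0 ?powR_ge0 ?(ltW H0).
have -> : 2 `^ `|a| * C / (1 - 2 `^ (- sg)) * (enorm g `^ (p - 2) * H * r `^ sg) =
  (2 `^ `|a| * C * (enorm g `^ (p - 2) * H)) / (1 - 2 `^ (- sg)) * r `^ sg by ring.
have mH : measurable_fun setT (fun z : T => H * enorm (z : 'rV[R]_n) ^+ 2).
  apply: measurable_funM; first exact: measurable_cst.
  by apply: measurable_funX; exact: measurable_enorm.
have inc0 z : 0 <= J (dot g z + H * enorm z ^+ 2) - J (dot g z - H * enorm z ^+ 2).
  have : 0 <= H * enorm z ^+ 2 by rewrite mulr_ge0 ?exprn_ge0 ?enorm_ge0 ?(ltW H0).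
  by move=> h; rewrite subr_ge0 J_homo//; lra.
have mf (D : set T) : measurable D -> measurable_fun D (fun z : T =>
  ((J (dot g z + H * enorm (z : 'rV[R]_n) ^+ 2) - J (dot g z - H * enorm (z : 'rV[R]_n) ^+ 2)) *
       enorm (z : 'rV[R]_n) `^ a)%:E).
  move=> mD; apply/measurable_EFinP/measurable_funM; last first.
    by apply/measurable_EFinP; exact: measurable_enorm_powR.
  apply: measurable_funTS; apply: measurable_funB; apply: (measurableT_comp measurable_J).
    exact: measurable_funD (measurable_dot _) mH.
  exact: measurable_funB (measurable_dot _) mH.
apply: (dyadic_inward sg0 _ e0 r0).
- by rewrite mulr_ge0 // mulr_ge0 ?(ltW c0) ?(ltW C0).
- by apply: mf; exact: measurable_annulus.
- by move=> z; rewrite lee_fin mulr_ge0 ?powR_ge0.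
move=> rho /andP[rho0 rhor].
have Hg' : 2 * H * rho <= enorm g.
  by apply: le_trans Hg; rewrite ler_pM2l// mulr_gt0.
pose c : R := 2 `^ `|a| * rho `^ a.
have c00 : 0 <= c by rewrite mulr_ge0 ?powR_ge0.
have mI : measurable_fun setT (fun z : T => (J (dot g z + H * rho ^+ 2) - J (dot g z - H * rho ^+ 2))%:E).
  by apply/measurable_EFinP; exact: measurable_J_increment.
have I0 z : 0 <= J (dot g z + H * rho ^+ 2) - J (dot g z - H * rho ^+ 2).
  by rewrite J_increment_ge0// addr_ge0// mulr_ge0 ?exprn_ge0 ?(ltW H0) ?(ltW rho0).
apply: (@le_trans _ _ (\int[mu]_(z in eball 0 rho) (c%:E * (J (dot g z + H * rho ^+ 2) - J (dot g z - H * rho ^+ 2))%R%:E))%E).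
  apply: (@le_trans _ _ (\int[mu]_(z in annulus (Num.max e (rho / 2)%R) rho) (c%:E * (J (dot g z + H * rho ^+ 2) - J (dot g z - H * rho ^+ 2))%R%:E))%E).
    apply: ge0_le_integral.
    - exact: measurable_annulus.
    - by move=> z _; rewrite lee_fin mulr_ge0 ?powR_ge0.
    - by apply: mf; exact: measurable_annulus.
    - by apply: measurable_funTS; exact: measurable_funeM.
    move=> z /= /andP[]; rewrite ge_max => /andP[ez rz] zr.
    rewrite -EFinM lee_fin mulrC ler_pM ?powR_ge0//.
      by apply: powR_dyadic => //; exact: ltW.
    have h : H * enorm z ^+ 2 <= H * rho ^+ 2.
      by rewrite ler_wpM2l ?(ltW H0)// lerXn2r ?nnegrE ?enorm_ge0 ?(ltW rho0) ?(ltW zr).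
    by apply: lerB; apply: J_homo => //; lra.
  apply: ge0_subset_integral.
  - exact: measurable_annulus.
  - exact: measurable_eball.
  - by apply: measurable_funTS; exact: measurable_funeM.
  - by move=> z _; rewrite -EFinM lee_fin mulr_ge0.
  - by move=> z /= /andP[_ h]; apply/eball0P.
rewrite (ge0_integralZl_EFin mu (measurable_eball _ _)); last 3 first.
- by move=> z _; rewrite lee_fin.
- exact: measurable_funTS.
- exact: c00.
apply: (@le_trans _ _ (c%:E * (C * (enorm g `^ (p - 2) * H * rho `^ (n%:R + p)))%R%:E)%E).
  by rewrite lee_wpmul2l//; exact: HC.
rewrite -EFinM lee_fin /c.
have -> : rho `^ sg = rho `^ a * rho `^ (n%:R + p).
  by rewrite -powRD_pos//; congr (_ `^ _); rewrite /sg /a; ring.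
by apply: eq_ler; ring.
Qed.

End near_field.

(** * Paraboloids as test functions *)

Section paraboloid.
Variables (R : realType) (n : nat).
Implicit Types (x y z g : 'rV[R]_n).

Lemma derive_quadratic (f : 'rV[R]_n -> R) y v (a b : R) :
  (forall h, f (h *: v + y) = f y + h * a + h ^+ 2 * b) ->
  derivable f y v /\ 'D_v f y = a.
Proof.
move=> fE.
have cv : (fun h : R => h^-1 *: ((f \o shift y) (h *: v) - f y)) @ 0^' --> a.
  have lim0 : (fun h : R => a + h * b) @ 0^' --> a.
    rewrite -[X in _ --> X]addr0 -[X in _ + X](mul0r b).
    apply: cvgD; first exact: cvg_cst.
    apply: cvgM; last exact: cvg_cst.
    by apply: cvg_within_filter; exact: cvg_id.
  apply: cvg_trans lim0; apply: near_eq_cvg.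
  near=> h; rewrite /= fE.
  have h0 : h != 0 by near: h; exact: nbhs_dnbhs_neq.
  rewrite /GRing.scale /=; field; exact: h0.
split; first by apply/cvg_ex; exists a.
exact/cvg_lim.
Unshelve. all: by end_near. Qed.

Definition paraboloid x g (c H : R) y : R :=
  c + dot g (y - x) + H * enorm (y - x) ^+ 2.

Lemma delta_coord (j k : 'I_n) : (delta_mx 0 j : 'rV[R]_n) 0 k = (k == j)%:R.
Proof. by rewrite mxE eqxx. Qed.

Lemma dot_delta x (j : 'I_n) : dot x (delta_mx 0 j) = x 0 j.
Proof.
rewrite /dot (bigD1 j)//= delta_coord eqxx mulr1 big1 ?addr0// => k kj.
by rewrite delta_coord (negbTE kj) mulr0.
Qed.

Lemma derive_paraboloid x g c H y (i : 'I_n) :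
  derivable (paraboloid x g c H) y (delta_mx 0 i) /\
  partial i (paraboloid x g c H) y = g 0 i + 2 * H * (y - x) 0 i.
Proof.
apply: (@derive_quadratic _ _ _ _ H) => h.
rewrite /paraboloid -addrA !sqr_enorm !(dotDl, dotDr, dotZl, dotZr) dot_delta dot_delta.
rewrite (dotC (delta_mx 0 i)) dot_delta !(dotC (delta_mx _ _)) !dot_delta delta_coord eqxx.
by rewrite !mxE /=; ring.
Qed.

Lemma partial_paraboloid x g c H (i : 'I_n) :
  partial i (paraboloid x g c H) = fun y => g 0 i + 2 * H * (y - x) 0 i.
Proof. by apply/funext => y; have [_] := derive_paraboloid x g c H y i. Qed.

Lemma derive2_paraboloid x g c H y (i j : 'I_n) :
  derivable (partial i (paraboloid x g c H)) y (delta_mx 0 j) /\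
  partial j (partial i (paraboloid x g c H)) y = 2 * H * (i == j)%:R.
Proof.
rewrite partial_paraboloid; apply: (@derive_quadratic _ _ _ _ 0) => h.
by rewrite !mxE /=; ring.
Qed.

Lemma continuous_coordB x (i : 'I_n) : continuous (fun y => (y - x) 0 i : R).
Proof.
apply: (@lipschitz_continuous _ _ 1) => y z; rewrite mul1r.
apply: le_trans (coord_le_enorm _ i); apply: eq_ler.
by congr `|_|; rewrite !mxE; ring.
Qed.

Lemma C2_paraboloid x g c H D : C2 D (paraboloid x g c H).
Proof.
move=> y _; split.
- apply: continuousD; first apply: continuousD.
  + exact: cst_continuous.
  + apply: (continuous_comp (f := fun z => z - x) (g := dot g)).
      by apply: continuousB; [exact: cvg_id|exact: cst_continuous].
    exact: continuous_dot.
  + apply: continuousM; first exact: cst_continuous.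
    apply: (continuous_comp (f := fun z => enorm (z - x)) (g := fun t => t ^+ 2)).
      exact: continuous_enormB.
    exact: exprn_continuous.
- move=> i; split; first by have [] := derive_paraboloid x g c H y i.
  rewrite partial_paraboloid; apply: continuousD; first exact: cst_continuous.
  by apply: continuousM; [exact: cst_continuous|exact: continuous_coordB].
- move=> i j; split; first by have [] := derive2_paraboloid x g c H y i j.
  rewrite (_ : partial j _ = fun=> 2 * H * (i == j)%:R); first exact: cst_continuous.
  by apply/funext => z; have [_] := derive2_paraboloid x g c H z i j.
Qed.

Lemma grad_paraboloid x g c H : grad (paraboloid x g c H) x = g.
Proof.
by apply/rowP => i; rewrite mxE partial_paraboloid subrr !mxE mulr0 addr0.
Qed.

End paraboloid.

(** * From the viscosity inequality to an integral inequality *)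

Section extraction.
Variables (R : realType) (n : nat) (p s lam Lam : R).
Hypotheses (p1 : 1 < p) (s0 : 0 < s) (s1 : s < 1).
Variable K : 'rV[R]_n -> R.
Hypothesis K_adm : admissible_kernel p s lam Lam K.
Implicit Types (x z g : 'rV[R]_n) (u : 'rV[R]_n -> R).

Local Notation mu := (@lebesgue_rV R n).
Local Notation T := (lebesgue_rV_type R n).
Local Notation J := (J p).
Local Notation nps := (n%:R + p * s).

Lemma nps_gt0 : 0 < nps.
Proof. by rewrite ltr_wpDl// mulr_gt0// (lt_trans ltr01). Qed.

Lemma kernel_ge0 z : z != 0 -> 0 <= K z.
Proof. by case: K_adm => _ h _ _ z0; exact/ltW/h. Qed.

Lemma kernel_le z : z != 0 -> K z <= Lam * enorm z `^ (- nps).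
Proof. by case: K_adm => _ _ _ h z0; have /andP[_] := h z z0; rewrite powRN. Qed.

Lemma kernel_sym z : z != 0 -> K (- z) = K z.
Proof. by case: K_adm => _ _ h _; exact: h. Qed.

Lemma eballC_neq0 (e : R) z : 0 < e -> (~` eball 0 e) z -> z != 0.
Proof. by move=> e0 /eballC0P h; rewrite -enorm_gt0; exact: lt_le_trans h. Qed.

Lemma measurable_kernel (e : R) : 0 < e -> measurable_fun (~` eball 0 e : set T) (K : T -> R).
Proof.
move=> e0.
have oU : open [set z : 'rV[R]_n | 0 < enorm z].
  by move/continuousP : (@continuous_enorm R n) => /(_ _ (@open_gt R 0)).
apply: (@measurable_funS _ _ _ _ ([set z : 'rV[R]_n | 0 < enorm z] : set T)).
- exact: measurable_open.
- by move=> z /(eballC_neq0 e0); rewrite /= enorm_gt0.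
apply: continuous_lebesgue_measurable => // z /=; rewrite enorm_gt0.
by case: K_adm => h _ _ _; exact: h.
Qed.

Lemma measurable_shift u x : lebesgue_measurable u ->
  measurable_fun setT (fun z : T => u (x + z)).
Proof.
move=> mu_; rewrite (_ : (fun z => _) = u \o (flip false x)).
  exact: (measurableT_comp mu_ (@lebesgue_measurable_flip R n false x)).
by apply/funext => z; rewrite /flip /= expr0 scale1r.
Qed.

Definition increment u x z : R := J (u x - u (x + z)) * K z.

Lemma measurable_increment u x (e : R) : 0 < e -> lebesgue_measurable u ->
  measurable_fun (~` eball 0 e : set T) (increment u x : T -> R).
Proof.
move=> e0 mu_; apply: measurable_funM; last exact: measurable_kernel.
apply: measurable_funTS; apply: (measurableT_comp (measurable_J _)).
apply: measurable_funB; first exact: measurable_cst.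
exact: measurable_shift.
Qed.

Lemma nonlocal_truncation u x (e : R) : 0 < e -> lebesgue_measurable u ->
  (\int[mu]_(y in ~` eball x e)
     (`|u x - u y| `^ (p - 2) * (u x - u y) * K (x - y))%:E =
   \int[mu]_(z in ~` eball 0 e) (increment u x z)%:E)%E.
Proof.
move=> e0 mu_.
have pre : flip false x @^-1` (~` eball x e) = ~` eball 0 e.
  apply/seteqP; split => z; rewrite /eball /flip /= expr0 scale1r subr0.
    by rewrite addrAC subrr add0r.
  by rewrite addrAC subrr add0r.
rewrite (@integral_flip R n false x); first last.
- apply/measurable_EFinP.
  have -> : ~` eball x e = flip true x @^-1` (~` eball 0 e) :> set T.
    apply/seteqP; split => z; rewrite /eball /flip /= expr1 scaleN1r subr0;
    by rewrite enormBC.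
  have mflip := @lebesgue_measurable_flip R n true x.
  have mD : measurable (flip true x @^-1` (~` eball 0 e) : set T).
    by rewrite -[X in measurable X]setTI; apply: mflip => //; exact: measurable_eballC.
  apply: measurable_funM.
    apply: measurable_funTS; apply: (measurableT_comp (measurable_J _)).
    by apply: measurable_funB; [exact: measurable_cst|exact: mu_].
  rewrite (_ : (fun y => K (x - y)) = K \o flip true x).
    apply: (measurable_comp (measurable_eballC _ _)); last 2 first.
    - exact: (measurable_kernel e0).
    - exact: measurable_funTS.
    by move=> _ [z zD <-].
  by apply/funext => y; rewrite /flip /= expr1 scaleN1r.
- exact: measurable_eballC.
rewrite pre; apply: eq_integral => z; rewrite inE => zD; rewrite /increment /flip expr0 scale1r.
have -> : x - (x + z) = - z by rewrite opprD addrA subrr add0r.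
by rewrite kernel_sym//; exact: eballC_neq0 zD.
Qed.

Lemma J_normB_le (a b : R) : `|J (a - b)| <= 2 `^ (p - 1) * (`|a| `^ (p - 1) + `|b| `^ (p - 1)).
Proof.
have p0 : 0 <= p - 1 by rewrite subr_ge0 ltW.
rewrite norm_J//.
have key (t v : R) : 0 <= t -> v <= 2 * t -> 0 <= v -> v `^ (p - 1) <= 2 `^ (p - 1) * t `^ (p - 1).
  by move=> t0 vt v0; rewrite -powRM// powR_le_pos.
rewrite mulrDr; have := powR_ge0 `|a| (p - 1); have := powR_ge0 `|b| (p - 1) => b0 a0.
have c0 : 0 <= 2 `^ (p - 1) :> R by exact: powR_ge0.
have ha := mulr_ge0 c0 a0; have hb := mulr_ge0 c0 b0.
have h := ler_normB a b.
have [ab|ab] := leP `|a| `|b|.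
  by have := key `|b| `|a - b| (normr_ge0 _) ltac:(lra) (normr_ge0 _); lra.
by have := key `|a| `|a - b| (normr_ge0 _) ltac:(lra) (normr_ge0 _); lra.
Qed.

Lemma measurable_normp u : lebesgue_measurable u ->
  measurable_fun setT (fun z : T => `|u z| `^ (p - 1)).
Proof.
move=> mu_; apply: (measurableT_comp (measurable_powR _)).
by apply: (measurableT_comp (@normr_measurable _ _)).
Qed.

Lemma measurable_tail_density u : lebesgue_measurable u -> measurable_fun setT
  (fun z : T => (`|u z| `^ (p - 1) / (1 + enorm (z : 'rV[R]_n)) `^ (n%:R + s * p))%:E).
Proof.
move=> mu_; apply/measurable_EFinP; apply: measurable_funM; first exact: measurable_normp.
rewrite (_ : (fun z => _) = (fun z : T => (1 + enorm (z : 'rV[R]_n)) `^ (- (n%:R + s * p)))).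
  apply: (measurableT_comp (measurable_powR _)); apply: measurable_funD; first exact: measurable_cst.
  exact: measurable_enorm.
by apply/funext => z; rewrite powRN.
Qed.

(** Away from 0 the weights |z| and 1 + |x + z| are comparable. *)
Lemma shifted_tail_fin u x (e : R) : 0 < e -> Lsp p s u ->
  (\int[mu]_(z in ~` eball 0 e) (`|u (x + z)| `^ (p - 1) * enorm (z : 'rV[R]_n) `^ (- nps))%:E < +oo)%E.
Proof.
move=> e0 [mu_ _ fin].
pose c : R := ((1 + enorm x) / e + 1) `^ nps.
have c1 : 0 < (1 + enorm x) / e + 1.
  by rewrite ltr_wpDl// divr_ge0 ?(ltW e0)// addr_ge0 ?enorm_ge0.
have mE := measurable_tail_density mu_.
have mE2 := measurableT_comp mE (@lebesgue_measurable_flip R n false x).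
apply: (@le_lt_trans _ _ (\int[mu]_(z in ~` eball 0 e)
   (c%:E * (`|u (x + z)| `^ (p - 1) / (1 + enorm (x + z)) `^ (n%:R + s * p))%R%:E))%E).
  apply: ge0_le_integral.
  - exact: measurable_eballC.
  - by move=> z _; rewrite lee_fin mulr_ge0 ?powR_ge0.
  - apply/measurable_EFinP; apply: measurable_funM; last first.
      by apply/measurable_EFinP; apply: measurable_enorm_powR; exact: measurable_eballC.
    by apply: measurable_funTS; apply: (@measurable_normp (fun z => u (x + z))); exact: measurable_shift.
  - apply: measurable_funTS; apply: measurable_funeM.
    by apply: (eq_measurable_fun _ _ mE2) => z _; rewrite /= /flip expr0 scale1r.
  move=> z zD; rewrite -EFinM lee_fin mulrCA ler_wpM2l ?powR_ge0//.
  have z0 : 0 < enorm z by rewrite enorm_gt0; exact: eballC_neq0 zD.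
  have ez : e <= enorm z by exact/eballC0P.
  have b0 : 0 < (1 + enorm (x + z)) `^ nps by rewrite powR_gt0// ltr_wpDr ?enorm_ge0.
  rewrite (mulrC s p) powRN ler_pdivlMr//. rewrite [X in X <= _]mulrC ler_pdivrMr ?powR_gt0//.
  rewrite /c -powRM ?enorm_ge0 ?(ltW c1)//.
  apply: powR_le_pos; [exact/ltW/nps_gt0|by rewrite addr_ge0 ?enorm_ge0|].
  apply: (@le_trans _ _ ((1 + enorm x) + enorm z)).
    by have := enormD x z; lra.
  rewrite mulrDl mul1r lerD2r -{1}[1 + _]mulr1 -mulrA ler_wpM2l ?addr_ge0 ?enorm_ge0//.
  by rewrite ler_pdivlMl// mulr1.
have mg : measurable_fun (~` eball 0 e : set T)
    (fun z : T => (`|u (x + z)| `^ (p - 1) / (1 + enorm (x + z)) `^ (n%:R + s * p))%:E).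
  apply: measurable_funTS.
  by apply: (eq_measurable_fun _ _ mE2) => z _; rewrite /= /flip expr0 scale1r.
have g0 (z : T) : (0 <= (`|u (x + z)| `^ (p - 1) / (1 + enorm (x + z)) `^ (n%:R + s * p))%:E)%E.
  by rewrite lee_fin divr_ge0 ?powR_ge0.
rewrite (ge0_integralZl_EFin mu (measurable_eballC _ _) (fun z _ => g0 z) mg (powR_ge0 _ _)).
suff : (\int[mu]_(z in ~` eball 0 e)
   (`|u (x + z)| `^ (p - 1) / (1 + enorm (x + z)) `^ (n%:R + s * p))%:E < +oo)%E.
  move: (\int[mu]_(z in ~` eball 0 e) _)%E => I Ioo.
  by apply: (@lte_mul_pinfty _ c%:E I) => //; rewrite lee_fin powR_ge0.
apply: (le_lt_trans _ fin).
apply: (@le_trans _ _ (\int[mu]_z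
   (`|u (x + z)| `^ (p - 1) / (1 + enorm (x + z)) `^ (n%:R + s * p))%:E)%E).
  apply: (@ge0_subset_integral _ T R mu _ setT (measurable_eballC _ _) measurableT).
  - by apply: (eq_measurable_fun _ _ mE2) => z _; rewrite /= /flip expr0 scale1r.
  - by move=> z _; exact: g0.
  - exact: subsetT.
have -> : (\int[mu]_z (`|u z| `^ (p - 1) / (1 + enorm (z : 'rV[R]_n)) `^ (n%:R + s * p))%:E =
  \int[mu]_(z in flip false x @^-1` setT)
   (`|u (flip false x z)| `^ (p - 1) / (1 + enorm (flip false x z)) `^ (n%:R + s * p))%:E)%E.
  apply: (@ge0_integral_flip R n false x setT
   (fun z => (`|u z| `^ (p - 1) / (1 + enorm (z : 'rV[R]_n)) `^ (n%:R + s * p))%:E) measurableT mE).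
  by move=> z _; rewrite lee_fin divr_ge0 ?powR_ge0.
rewrite preimage_setT; apply: eq_ler.
by apply: eq_integral => z _; rewrite /flip expr0 scale1r.
Qed.

Lemma integrable_kernel_exterior (e : R) : 0 < e ->
  mu.-integrable (~` eball 0 e) (fun z : T => (enorm (z : 'rV[R]_n) `^ (- nps))%:E).
Proof.
move=> e0; apply/integrableP; split.
  by apply: measurable_enorm_powR; exact: measurable_eballC.
have ps0 : 0 < p * s by rewrite mulr_gt0// (lt_trans ltr01).
have [C C0 HC] := integral_exterior_powR n ps0.
apply: (@le_lt_trans _ _ (C * e `^ (- (p * s)))%:E); last by rewrite ltry.
apply: le_trans (HC e e0).
apply: eq_ler; apply: eq_integral => z _ /=.
rewrite ger0_norm ?powR_ge0//; congr (_ `^ _)%:E; ring.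
Qed.

Lemma integrable_shifted_tail u x (e : R) : 0 < e -> Lsp p s u ->
  mu.-integrable (~` eball 0 e)
    (fun z : T => (`|u (x + z)| `^ (p - 1) * enorm (z : 'rV[R]_n) `^ (- nps))%:E).
Proof.
move=> e0 uL; have mu_ : lebesgue_measurable u by case: uL.
apply/integrableP; split.
  apply/measurable_EFinP; apply: measurable_funM; last first.
    by apply/measurable_EFinP; apply: measurable_enorm_powR; exact: measurable_eballC.
  by apply: measurable_funTS; apply: (@measurable_normp (fun z => u (x + z))); exact: measurable_shift.
apply: le_lt_trans (shifted_tail_fin x e0 uL).
apply: eq_ler; apply: eq_integral => z _ /=.
by rewrite ger0_norm// mulr_ge0 ?powR_ge0.
Qed.

Lemma increment_le u x z : z != 0 ->
  `|increment u x z| <= 2 `^ (p - 1) * Lam *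
     (`|u x| `^ (p - 1) * enorm z `^ (- nps) + `|u (x + z)| `^ (p - 1) * enorm z `^ (- nps)).
Proof.
move=> z0; rewrite normrM (ger0_norm (kernel_ge0 z0)).
apply: le_trans (ler_pM (normr_ge0 _) (kernel_ge0 z0) (J_normB_le _ _) (kernel_le z0)) _.
by apply: eq_ler; ring.
Qed.

Lemma integrable_increment u x (e : R) : 0 < e -> Lsp p s u ->
  mu.-integrable (~` eball 0 e) (fun z : T => (increment u x z)%:E).
Proof.
move=> e0 uL; have mu_ : lebesgue_measurable u by case: uL.
apply: (@le_integrable _ _ _ mu _ (measurable_eballC _ _) _ (fun z : T =>
  ((2 `^ (p - 1) * Lam)%:E * ((`|u x| `^ (p - 1))%:E * (enorm (z : 'rV[R]_n) `^ (- nps))%:E +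
     (`|u (x + z)| `^ (p - 1) * enorm (z : 'rV[R]_n) `^ (- nps))%:E))%E)).
- by apply/measurable_EFinP; exact: measurable_increment.
- move=> z zD; have z0 := eballC_neq0 e0 zD.
  have h := le_trans (increment_le u x z0) (ler_norm _).
  by rewrite -lee_fin in h; exact: h.
- apply: integrableZl; first exact: measurable_eballC.
  apply: integrableD; first exact: measurable_eballC.
    by apply: integrableZl; [exact: measurable_eballC|exact: integrable_kernel_exterior].
  exact: integrable_shifted_tail.
Qed.

End extraction.

Section paraboloid_extraction.
Variables (R : realType) (n : nat) (p s lam Lam : R).
Hypotheses (p1 : 1 < p) (s0 : 0 < s) (s1 : s < 1) (Lam0 : 0 < Lam).
Implicit Types (x z g : 'rV[R]_n) (u K : 'rV[R]_n -> R).

Local Notation mu := (@lebesgue_rV R n).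
Local Notation T := (lebesgue_rV_type R n).
Local Notation J := (J p).
Local Notation nps := (n%:R + p * s).

Lemma measurable_glued (eta u : 'rV[R]_n -> R) x (r : R) :
  lebesgue_measurable eta -> lebesgue_measurable u ->
  lebesgue_measurable (glued eta u x r).
Proof.
move=> meta mu_.
rewrite (_ : glued eta u x r = fun z => (eta z * \1_(eball x r) z + u z * \1_(~` eball x r) z)).
  have m1 : measurable_fun setT (\1_(eball x r : set T) : T -> R).
    by apply: measurable_indic; exact: measurable_eball.
  have m2 : measurable_fun setT (\1_(~` eball x r : set T) : T -> R).
    by apply: measurable_indic; exact: measurable_eballC.
  exact: (measurable_funD (measurable_funM meta m1) (measurable_funM mu_ m2)).
apply/funext => z; rewrite /glued !indicE.
case: ifPn => [zr|zr].
  by rewrite (mem_set (A := eball x r))//= memNset ?mulr1 ?mulr0 ?addr0//; apply.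
rewrite (memNset (A := eball x r)); last exact/negP.
by rewrite mem_set ?mulr1 ?mulr0 ?add0r//; exact/negP.
Qed.

Lemma measurable_paraboloid x g c H : lebesgue_measurable (paraboloid x g c H).
Proof.
apply: (continuous_lebesgue_measurable openT) => z _.
by have [] := C2_paraboloid x g c H (D := setT) (x := z) I.
Qed.

Section near.
Variables (K : 'rV[R]_n -> R) (g : 'rV[R]_n) (H r : R).
Hypotheses (K_adm : admissible_kernel p s lam Lam K) (H0 : 0 < H) (r0 : 0 < r)
  (gH : 2 * H * r <= enorm g).

Let h z : R := H * enorm z ^+ 2.

Let f z : R := J (- dot g z - h z) * K z.

(* Minus twice the even part of f, nonnegative where f has no sign. *)
Let d z : R := (J (dot g z + h z) - J (dot g z - h z)) * K z.

Let annulus_eballC (e : R) : (annulus e r : set T) `<=` ~` eball 0 e.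
Proof. by move=> z /= /andP[ez _]; exact/eballC0P. Qed.

Let h_ge0 z : 0 <= h z.
Proof. by rewrite mulr_ge0 ?exprn_ge0 ?enorm_ge0 ?(ltW H0). Qed.

Let d_ge0 (e : R) z : 0 < e -> annulus e r z -> 0 <= d z.
Proof.
move=> e0 /annulus_eballC/(eballC_neq0 e0) z0; apply: mulr_ge0; last exact: (kernel_ge0 K_adm).
by rewrite subr_ge0 J_homo//; have := h_ge0 z; lra.
Qed.

Let mh : measurable_fun setT (h : T -> R).
Proof.
apply: measurable_funM; first exact: measurable_cst.
by apply: measurable_funX; exact: measurable_enorm.
Qed.

Let integrable_JK (e : R) (k : T -> R) : 0 < e -> measurable_fun setT k ->
  (forall z : T, enorm (z : 'rV[R]_n) < r -> `|k z| <= enorm g * r + H * r ^+ 2) ->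
  mu.-integrable (annulus e r) (fun z : T => (J (k z) * K z)%:E).
Proof.
move=> e0 mk kle.
have mA : measurable (annulus e r : set T) by exact: measurable_annulus.
apply: (@le_integrable _ _ _ mu _ mA _ (fun z : T =>
  (((enorm g * r + H * r ^+ 2) `^ (p - 1) * Lam)%:E * (enorm (z : 'rV[R]_n) `^ (- nps))%:E)%E)).
- apply/measurable_EFinP; apply: measurable_funM.
    by apply: measurable_funTS; exact: (measurableT_comp (measurable_J _) mk).
  apply: (@measurable_funS _ _ _ _ (~` eball 0 e : set T)).
  + exact: measurable_eballC.
  + exact: annulus_eballC.
  + exact: (measurable_kernel K_adm).
- move=> z zA; have z0 := eballC_neq0 e0 (annulus_eballC zA).
  have zr : enorm (z : 'rV[R]_n) < r by move: zA => /= /andP[].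
  have p0 : 0 <= p - 1 by rewrite subr_ge0 ltW.
  have hh : `|J (k z) * K z| <= (enorm g * r + H * r ^+ 2) `^ (p - 1) * Lam * enorm (z : 'rV[R]_n) `^ (- nps).
    rewrite normrM (ger0_norm (kernel_ge0 K_adm z0)) -mulrA.
    apply: ler_pM => //; first exact: (kernel_ge0 K_adm).
      by rewrite norm_J//; apply: powR_le_pos => //; exact: kle.
    exact: (kernel_le K_adm).
  by have := le_trans hh (ler_norm _); rewrite -lee_fin.
- apply: integrableZl => //.
  apply: (@integrableS _ _ _ mu (~` eball 0 e : set T)) => //.
  + exact: measurable_eballC.
  + exact: integrable_kernel_exterior.
Qed.

Let dh_le z : enorm z < r -> `|dot g z| + h z <= enorm g * r + H * r ^+ 2.
Proof.
move=> zr; apply: lerD.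
  apply: le_trans (norm_dot_le _ _) _.
  by rewrite ler_wpM2l ?enorm_ge0// ltW.
by rewrite ler_wpM2l ?(ltW H0)// lerXn2r ?nnegrE ?enorm_ge0 ?(ltW r0) ?(ltW zr).
Qed.

Let mdot := measurable_dot g.

(* For each e > 0 everything is bounded on the annulus, so that the odd part can
   be split off before e tends to 0. *)
Lemma near_integrable (e : R) : 0 < e -> mu.-integrable (annulus e r) (EFin \o f).
Proof.
move=> e0; apply: (integrable_JK e0 (measurable_funB (measurable_funN mdot) mh)).
move=> z /dh_le; apply: le_trans; apply: le_trans (ler_normB _ _) _.
by rewrite normrN (ger0_norm (h_ge0 z)).
Qed.

Let integrable_Jp (e : R) : 0 < e ->
  mu.-integrable (annulus e r) (fun z : T => (J (dot g z + h z) * K z)%:E).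
Proof.
move=> e0; apply: (integrable_JK e0 (measurable_funD mdot mh)).
move=> z /dh_le; apply: le_trans; apply: le_trans (ler_normD _ _) _.
by rewrite (ger0_norm (h_ge0 z)).
Qed.

Let integrable_Jm (e : R) : 0 < e ->
  mu.-integrable (annulus e r) (fun z : T => (J (dot g z - h z) * K z)%:E).
Proof.
move=> e0; apply: (integrable_JK e0 (measurable_funB mdot mh)).
move=> z /dh_le; apply: le_trans; apply: le_trans (ler_normB _ _) _.
by rewrite (ger0_norm (h_ge0 z)).
Qed.

Let integrable_d (e : R) : 0 < e -> mu.-integrable (annulus e r) (EFin \o d).
Proof.
move=> e0; have mA : measurable (annulus e r : set T) by exact: measurable_annulus.
apply: (@eq_integrable _ _ _ mu _ mA ((fun z : T => (J (dot g z + h z) * K z)%:E) \- (fun z : T => (J (dot g z - h z) * K z)%:E))%E).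
  by move=> z _; rewrite /d /= mulrBl EFinB.
by apply: integrableB => //; [exact: integrable_Jp|exact: integrable_Jm].
Qed.

(** Averaging over z and - z removes the odd part g . z and leaves an integrand
    of constant sign. *)
Lemma near_symmetrized (e : R) : 0 < e ->
  \int[mu]_(z in annulus e r) f z = - (\int[mu]_(z in annulus e r) d z) / 2.
Proof.
move=> e0; have mA : measurable (annulus e r : set T) by exact: measurable_annulus.
have flipE z : flip true 0 z = - z by rewrite /flip add0r expr1 scaleN1r.
have fN : \int[mu]_(z in annulus e r) f z = \int[mu]_(z in annulus e r) (J (dot g z - h z) * K z).
  rewrite /Rintegral (@integral_flip R n true 0 _ _ mA); last first.
    exact: (measurable_int _ (near_integrable e0)).
  have -> : flip true 0 @^-1` (annulus e r) = annulus e r :> set T.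
    by apply/seteqP; split => z; rewrite /annulus /= flipE enormN.
  congr fine; apply: eq_integral => z; rewrite inE => zA.
  have z0 := eballC_neq0 e0 (annulus_eballC zA).
  by rewrite flipE /f /h dotNr opprK enormN (kernel_sym K_adm).
have fJ : \int[mu]_(z in annulus e r) f z = - \int[mu]_(z in annulus e r) (J (dot g z + h z) * K z).
  rewrite -mulN1r -RintegralZl//; last exact: integrable_Jp.
  by apply: eq_Rintegral => z _; rewrite /f -opprD JN mulN1r mulNr.
have -> : \int[mu]_(z in annulus e r) d z =
    \int[mu]_(z in annulus e r) (J (dot g z + h z) * K z) -
    \int[mu]_(z in annulus e r) (J (dot g z - h z) * K z).
  rewrite -RintegralB//; [|exact: integrable_Jp|exact: integrable_Jm].
  by apply: eq_Rintegral => z _; rewrite /d mulrBl.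
by rewrite -fN; move: fJ; set a := Rintegral _ _ _; set b := Rintegral _ _ _; lra.
Qed.

Lemma near_homo (e1 e2 : R) : 0 < e1 -> e1 <= e2 ->
  \int[mu]_(z in annulus e1 r) f z <= \int[mu]_(z in annulus e2 r) f z.
Proof.
move=> e10 e12; have e20 := lt_le_trans e10 e12.
rewrite !near_symmetrized// ler_pM2r// lerN2.
have sub : annulus e2 r `<=` (annulus e1 r : set T).
  by move=> z /= /andP[h1 h2]; rewrite /annulus /= h2 (le_trans e12).
rewrite /Rintegral fine_le//.
- by apply: integrable_fin_num; [exact: measurable_annulus|exact: integrable_d].
- by apply: integrable_fin_num; [exact: measurable_annulus|exact: integrable_d].
apply: (ge0_subset_integral mu (@measurable_annulus _ _ _ _) (@measurable_annulus _ _ _ _)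
  (measurable_int _ (integrable_d e10))) => //.
by move=> z zA; rewrite lee_fin; exact: d_ge0 zA.
Qed.

Lemma near_ge (C e : R) : 0 < e ->
  (\int[mu]_(z in annulus e r)
     ((J (dot g z + H * enorm (z : 'rV[R]_n) ^+ 2) - J (dot g z - H * enorm (z : 'rV[R]_n) ^+ 2)) *
       enorm (z : 'rV[R]_n) `^ (- nps))%:E <= C%:E)%E ->
  - (Lam * C) / 2 <= \int[mu]_(z in annulus e r) f z.
Proof.
move=> e0 HC; have mA : measurable (annulus e r : set T) by exact: measurable_annulus.
rewrite near_symmetrized// ler_pM2r// lerN2 /Rintegral.
rewrite -lee_fin fineK; last by apply: integrable_fin_num => //; exact: integrable_d.
pose k (z : T) := ((J (dot g z + H * enorm (z : 'rV[R]_n) ^+ 2) - J (dot g z - H * enorm (z : 'rV[R]_n) ^+ 2)) *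
       enorm (z : 'rV[R]_n) `^ (- nps))%:E.
have mk : measurable_fun (annulus e r) k.
  apply/measurable_EFinP; apply: measurable_funM; last first.
    by apply/measurable_EFinP; exact: measurable_enorm_powR.
  apply: measurable_funTS; apply: measurable_funB; apply: (measurableT_comp (measurable_J _)).
    exact: measurable_funD.
  exact: measurable_funB.
have inc0 z : 0 <= J (dot g z + h z) - J (dot g z - h z).
  by rewrite subr_ge0 J_homo//; have := h_ge0 z; lra.
have k0 z : (0 <= k z)%E by rewrite lee_fin mulr_ge0 ?powR_ge0//; exact: inc0.
apply: (@le_trans _ _ (\int[mu]_(z in annulus e r) (Lam%:E * k z))%E).
  apply: (ge0_le_integral mu mA).
  - by move=> z zA; rewrite lee_fin; exact: d_ge0 zA.
  - exact: (measurable_int _ (integrable_d e0)).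
  - exact: measurable_funeM.
  move=> z zA; have z0 := eballC_neq0 e0 (annulus_eballC zA).
  rewrite /k -EFinM lee_fin /d [leRHS]mulrCA.
  by apply: ler_wpM2l; [exact: inc0|exact: (kernel_le K_adm)].
rewrite (ge0_integralZl_EFin mu mA (fun z _ => k0 z) mk (ltW Lam0)) EFinM.
by apply: lee_wpmul2l => //; rewrite lee_fin ltW.
Qed.

End near.

(** The viscosity inequality for the paraboloid with slope g, which is not 0.  Its
    principal value exists because the symmetrised truncated integrals are
    monotone in the radius of truncation, and [near_field_le] bounds the part
    inside the ball, which is moved to the right-hand side. *)
Lemma viscosity_paraboloid : exists2 C0, 0 < C0 &
  forall K (Omega : set 'rV[R]_n) (C : R) u x g (H r : R),
    admissible_kernel p s lam Lam K -> Lsp p s u ->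
    viscosity_sub p s K (fun=> C) Omega u ->
    0 < r -> 0 < H -> 2 * H * r <= enorm g -> eball x r `<=` Omega ->
    (forall z, enorm z < r -> u (x + z) <= u x + dot g z + H * enorm z ^+ 2) ->
    \int[mu]_(z in ~` eball 0 r) increment p K u x z <=
      C + C0 * (enorm g `^ (p - 2) * H * r `^ (p - p * s)).
Proof.
have [C1 C10 HC1] := near_field_le n p1 s1.
exists (Lam * C1 / 2) => [|K Omega C u x g H r K_adm uL [_ visc _] r0 H0 gH sub touch].
  by rewrite divr_gt0// mulr_gt0.
have mu_ : lebesgue_measurable u by case: uL.
pose eta := paraboloid x g (u x) H.
have etaE z : eta (x + z) = u x + dot g z + H * enorm z ^+ 2.
  by rewrite /eta /paraboloid (addrC x z) addrK.
have etax : eta x = u x.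
  have z00 : enorm (0 : 'rV[R]_n) = 0 by exact: enorm0.
  by rewrite -[x in LHS]addr0 etaE z00 expr0n mulr0 addr0 dotC -(scale0r x) dotZl mul0r addr0.
have g0 : g != 0.
  by rewrite -enorm_gt0; apply: lt_le_trans gH; rewrite !mulr_gt0.
pose w := glued eta u x r.
have := visc x r eta r0 sub (@C2_paraboloid _ _ x g (u x) H (eball x r)) etax.
have touch' y : eball x r y -> u y <= eta y.
  move=> yr; have := touch (y - x) yr; rewrite -etaE.
  by rewrite addrC subrK.
have test : admissible_test p s eta x r by left; right; rewrite grad_paraboloid.
move=> /(_ touch' test); rewrite -/w => viscw.
have mw : lebesgue_measurable w.
  exact: (measurable_glued x r (@measurable_paraboloid x g (u x) H) mu_).
have wx : w x = u x by rewrite /w /glued subrr (enorm0 R n) r0.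
pose F := \int[mu]_(z in ~` eball 0 r) increment p K u x z.
pose N e := \int[mu]_(z in annulus e r) (J (- dot g z - H * enorm z ^+ 2) * K z).
have iF : mu.-integrable (~` eball 0 r) (EFin \o increment p K u x).
  exact: (integrable_increment p1 s0 K_adm).
have truncE e : 0 < e -> e < r ->
   (\int[mu]_(y in ~` eball x e)
     (`|w x - w y| `^ (p - 2) * (w x - w y) * K (x - y))%:E = (N e + F)%:E)%E.
  move=> e0 er; rewrite (nonlocal_truncation K_adm)//.
  have mA : measurable (annulus e r : set T) by exact: measurable_annulus.
  have mB : measurable (~` eball 0 r : set T) by exact: measurable_eballC.
  have dE : ~` eball 0 e = annulus e r `|` ~` eball 0 r :> set T.
    apply/seteqP; split => z.
      move=> /eballC0P ez; have [zr|rz] := ltP (enorm (z : 'rV[R]_n)) r; [left|right].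
        by rewrite /annulus /= ez.
      exact/eballC0P.
    move=> [/= /andP[ez _]|/eballC0P rz]; apply/eballC0P => //.
    by apply: le_trans rz; exact: ltW.
  rewrite dE (integral_setU mu mA mB); first last.
  - rewrite disj_set2E; apply/eqP/seteqP; split => z // [] /= /andP[_ zr] /eballC0P.
    by rewrite leNgt zr.
  - by rewrite -dE; apply/measurable_EFinP; exact: (measurable_increment K_adm).
  have fF := integrable_fin_num mB iF.
  have fN := integrable_fin_num mA (near_integrable g K_adm H0 r0 e0).
  rewrite EFinD /N /F /Rintegral (fineK fN) (fineK fF).
  congr (_ + _)%E; apply: eq_integral => z; rewrite inE => zD; rewrite /increment wx.
    move: zD => /= /andP[_ zr].
    rewrite /w /glued (addrC x z) addrK (addrC z x) zr etaE; congr (J _ * _)%:E; ring.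
  move: zD => /eballC0P; rewrite leNgt => /negbTE zr.
  by rewrite /w /glued (addrC x z) addrK (addrC z x) zr.
have Nge e : 0 < e -> - (Lam * (C1 * (enorm g `^ (p - 2) * H * r `^ (p - p * s)))) / 2 <= N e.
  by move=> e0; apply: near_ge => //; exact: HC1.
have Nhomo e1 e2 : 0 < e1 -> e1 <= e2 -> N e1 <= N e2 by exact: near_homo.
pose G e := (\int[mu]_(y in ~` eball x e)
     (`|w x - w y| `^ (p - 2) * (w x - w y) * K (x - y))%:E)%E.
have Gcvg : cvg (G e @[e --> 0^'+]).
  apply: nondecreasing_at_right_is_cvge; near=> t => a b.
  have tr : t < r by near: t; exact: nbhs_right_lt.
  rewrite !in_itv/= => /andP[a0 at_] /andP[b0 bt] ab.
  rewrite /G !truncE//; [|exact: lt_trans tr|exact: lt_trans tr].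
  by rewrite lee_fin lerD2r Nhomo.
have : ((F - Lam * (C1 * (enorm g `^ (p - 2) * H * r `^ (p - p * s))) / 2)%:E <= C%:E)%E.
  apply: le_trans viscw; apply: lime_ge => //; near=> e.
  have e0 : 0 < e by near: e; exact: nbhs_right_gt.
  have er : e < r by near: e; exact: nbhs_right_lt.
  by rewrite truncE// lee_fin; have := Nge e e0; lra.
rewrite lee_fin /F; lra.
Unshelve. all: by end_near.
Qed.

End paraboloid_extraction.

(** * Normalised solutions *)

Section normalized.
Variables (R : realType) (n : nat) (p s lam Lam : R).
Hypotheses (p1 : 1 < p) (s0 : 0 < s) (s1 : s < 1) (Lam0 : 0 < Lam).
Implicit Types (x z g : 'rV[R]_n) (u v K : 'rV[R]_n -> R).

Local Notation mu := (@lebesgue_rV R n).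
Local Notation T := (lebesgue_rV_type R n).
Local Notation J := (J p).
Local Notation nps := (n%:R + p * s).

(** The conclusion of [viscosity_paraboloid] with right-hand side 1, the
    form in which the equation enters the doubling argument. *)
Definition paraboloid_sub (C0 : R) K v :=
  forall x g (H r : R), 0 < r -> 0 < H -> 2 * H * r <= enorm g ->
    eball x r `<=` eball 0 2 ->
    (forall z, enorm z < r -> v (x + z) <= v x + dot g z + H * enorm z ^+ 2) ->
    \int[mu]_(z in ~` eball 0 r) increment p K v x z <=
      1 + C0 * (enorm g `^ (p - 2) * H * r `^ (p - p * s)).

Record normalized (C0 : R) K v : Prop := Normalized {
  nrm_cont : forall x, eball 0 2 x -> {for x, continuous v};
  nrm_Lsp : Lsp p s v;
  nrm_le1 : forall x, eball 0 2 x -> `|v x| <= 1;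
  nrm_tail : (\int[mu]_(z in ~` eball 0 2)
    (`|v z| `^ (p - 1) * enorm (z : 'rV[R]_n) `^ (- nps))%:E <= 1%:E)%E;
  nrm_sub : paraboloid_sub C0 K v;
  nrm_super : paraboloid_sub C0 K (fun x => - v x) }.

(** For |z| >= rho0 and x in a smaller ball, x + z is either in B_2, where v is at
    most 1 and the kernel is integrable, or outside, where |z| is at least a
    multiple of |x + z| and the tail of v applies. *)
Lemma far_field (r1 rho0 : R) : r1 < 2 -> 0 < rho0 ->
  exists2 F, 0 < F & forall C0 K v x,
    admissible_kernel p s lam Lam K -> normalized C0 K v -> enorm x <= r1 ->
    \int[mu]_(z in ~` eball 0 rho0) `|increment p K v x z| <= F.
Proof.
move=> r12 rho00.
have ps0 : 0 < p * s by rewrite mulr_gt0// (lt_trans ltr01).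
have [C1 C10 HC1] := integral_exterior_powR n ps0.
have nps0 : 0 <= nps by exact/ltW/nps_gt0.
pose e1 := C1 * rho0 `^ (- (p * s)).
have e10 : 0 < e1 by rewrite mulr_gt0// powR_gt0.
pose c := (1 - r1 / 2) `^ (- nps).
have c0 : 0 < c by rewrite powR_gt0//; lra.
pose B := 2 `^ (p - 1) * Lam.
have B0 : 0 < B by rewrite mulr_gt0// powR_gt0.
exists (B * (e1 + (e1 + c))) => [|C0 K v x K_adm vN xr].
  by rewrite mulr_gt0// !addr_gt0.
have mv : lebesgue_measurable v by case: (nrm_Lsp vN).
have mD : measurable (~` eball 0 rho0 : set T) by exact: measurable_eballC.
have x2 : eball 0 2 x by apply/eball0P; exact: le_lt_trans r12.
have vx1 : `|v x| `^ (p - 1) <= 1.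
  by apply: powR_le1; rewrite ?subr_ge0 ?(ltW p1)// normr_ge0 (nrm_le1 vN x2).
pose ker (z : T) := enorm (z : 'rV[R]_n) `^ (- nps).
have ker0 z : 0 <= ker z by exact: powR_ge0.
have mker (D : set T) : measurable D -> measurable_fun D (fun z => (ker z)%:E).
  exact: measurable_enorm_powR.
have Iker : (\int[mu]_(z in ~` eball 0 rho0) (ker z)%:E <= e1%:E)%E.
  apply: le_trans (HC1 rho0 rho00).
  apply: eq_ler; apply: eq_integral => z _ /=.
  by congr (_ `^ _)%:E; ring.
pose far (y : T) := (`|v y| `^ (p - 1) * ker y * \1_(~` eball 0 2) y)%R.
have far0 y : 0 <= far y by rewrite !mulr_ge0 ?powR_ge0.
have mfar : measurable_fun setT (fun y => (far y)%:E).
  apply/measurable_EFinP; apply: measurable_funM.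
    apply: measurable_funM; first exact: measurable_normp.
    by apply/measurable_EFinP; exact: mker.
  by apply: measurable_indic; exact: measurable_eballC.
have Ifar : (\int[mu]_(z in ~` eball 0 rho0) (far (x + z))%:E <= 1%:E)%E.
  apply: (@le_trans _ _ (\int[mu]_z (far (x + z))%:E)%E).
    apply: (@ge0_subset_integral _ T R mu _ setT mD measurableT).
    - apply: (eq_measurable_fun _ _ (measurableT_comp mfar (@lebesgue_measurable_flip R n false x))) => z _.
      by rewrite /= /flip expr0 scale1r.
    - by move=> z _; rewrite lee_fin.
    - exact: subsetT.
  have -> : (\int[mu]_z (far (x + z))%:E = \int[mu]_y (far y)%:E)%E.
    rewrite [RHS](@ge0_integral_flip R n false x setT (fun y => (far y)%:E) measurableT mfar); last first.
      by move=> z _; rewrite lee_fin.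
    by rewrite preimage_setT; apply: eq_integral => z _; rewrite /flip expr0 scale1r.
  apply: le_trans (nrm_tail vN); apply: eq_ler.
  rewrite [RHS]integral_mkcond; apply: eq_integral => z _; rewrite /far patchE indicE.
  by case: ifP => _; rewrite ?mulr1 ?mulr0.
have pw z : (~` eball 0 rho0) z ->
    `|increment p K v x z| <= B * (ker z + (ker z + c * far (x + z))).
  move=> zD; have z0 := eballC_neq0 rho00 zD.
  apply: le_trans (increment_le p1 K_adm v x z0) _.
  rewrite -/B -/(ker z) ler_pM2l//; apply: lerD.
    by rewrite ler_piMl.
  have [y2|y2] := pselect (eball 0 2 (x + z)).
    apply: (@le_trans _ _ (ker z)); last by rewrite lerDl mulr_ge0// ltW.
    rewrite ler_piMl//; apply: powR_le1; rewrite ?subr_ge0 ?(ltW p1)//.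
    by rewrite normr_ge0 (nrm_le1 vN y2).
  apply: (@le_trans _ _ (c * far (x + z))); last by rewrite lerDr.
  rewrite /far indicE mem_set// mulr1 mulrCA ler_wpM2l ?powR_ge0//.
  have y2' : 2 <= enorm (x + z) by exact/eballC0P.
  have zp : 0 < enorm z by rewrite enorm_gt0.
  rewrite /c /ker -powRM ?enorm_ge0//; last lra.
  apply: powR_le_neg; first by rewrite oppr_le0.
    by rewrite mulr_gt0//; lra.
  have r10 : 0 <= r1 by apply: le_trans xr; exact: enorm_ge0.
  have : 0 <= (enorm (x + z) - 2) * r1 by rewrite mulr_ge0// subr_ge0.
  have := enormD x z.
  lra.
have mI : measurable_fun (~` eball 0 rho0 : set T) (fun z : T => (`|increment p K v x z|)%:E).
  apply/measurable_EFinP.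
  exact: (measurableT_comp (@normr_measurable R setT) (measurable_increment K_adm x rho00 mv)).
have mfx : measurable_fun (~` eball 0 rho0 : set T) (fun z : T => (far (x + z))%:E).
  apply: measurable_funTS.
  apply: (eq_measurable_fun _ _ (measurableT_comp mfar (@lebesgue_measurable_flip R n false x))) => z _.
  by rewrite /= /flip expr0 scale1r.
have key : (\int[mu]_(z in ~` eball 0 rho0) (`|increment p K v x z|)%:E <=
    (B * (e1 + (e1 + c)))%:E)%E.
  apply: (@le_trans _ _ (\int[mu]_(z in ~` eball 0 rho0)
     (B%:E * ((ker z)%:E + ((ker z)%:E + c%:E * (far (x + z))%:E)))%E)%E).
    apply: (ge0_le_integral mu mD).
    - by move=> z _; rewrite lee_fin.
    - exact: mI.
    - apply: measurable_funeM; apply: emeasurable_funD; first exact: mker.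
      by apply: emeasurable_funD; [exact: mker|exact: measurable_funeM].
    - by move=> z zD; have := pw z zD; rewrite -lee_fin.
  have mcf : measurable_fun (~` eball 0 rho0 : set T) (fun z : T => (c%:E * (far (x + z))%:E)%E).
    exact: measurable_funeM.
  have cf0 (z : T) : (0 <= c%:E * (far (x + z))%:E)%E by rewrite -EFinM lee_fin mulr_ge0// ltW.
  have k0 (z : T) : (0 <= (ker z)%:E)%E by rewrite lee_fin.
  rewrite (ge0_integralZl_EFin mu mD _ _ (ltW B0)); first last.
  - apply: emeasurable_funD; first exact: mker.
    by apply: emeasurable_funD; [exact: mker|].
  - by move=> z _; apply: adde_ge0 => //; exact: adde_ge0.
  rewrite (ge0_integralD mu mD (fun z _ => k0 z) (mker _ mD)); first last.
  - by apply: emeasurable_funD; [exact: mker|].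
  - by move=> z _; exact: adde_ge0.
  rewrite (ge0_integralD mu mD (fun z _ => k0 z) (mker _ mD) (fun z _ => cf0 z) mcf).
  rewrite (ge0_integralZl_EFin mu mD _ mfx (ltW c0)); last by move=> z _; rewrite lee_fin.
  rewrite [leRHS]EFinM. apply: lee_wpmul2l; first by rewrite lee_fin ltW.
  rewrite EFinD; apply: leeD => //; rewrite EFinD; apply: leeD => //.
  by rewrite -[leRHS]mule1; apply: lee_wpmul2l => //; rewrite lee_fin ltW.
rewrite /Rintegral -lee_fin fineK//.
rewrite ge0_fin_numE; last by apply: integral_ge0 => z _; rewrite lee_fin.
by apply: le_lt_trans key _; rewrite ltry.
Qed.

End normalized.

Section doubled_integrals.
Variables (R : realType) (n : nat).
Local Notation mu := (@lebesgue_rV R n).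
Local Notation T := (lebesgue_rV_type R n).

(** The bookkeeping of the doubling argument: f1 and f2 are the increments at the
    two points, G the region of the gain, rho0 the start of the far field, and M1
    and M2 come from the two viscosity inequalities. *)
Lemma doubled_integral_le (f1 f2 loss : T -> R) (G : set T) (r rho0 gain M1 M2 F Ls V : R) :
  0 < r -> r <= rho0 ->
  mu.-integrable (~` eball 0 r) (EFin \o f1) ->
  mu.-integrable (~` eball 0 r) (EFin \o f2) ->
  measurable G -> G `<=` annulus r rho0 -> 0 <= gain -> (V%:E <= mu G)%E ->
  measurable_fun setT loss -> (forall z, annulus r rho0 z -> 0 <= loss z) ->
  (\int[mu]_(z in annulus r rho0) (loss z)%:E <= Ls%:E)%E ->
  \int[mu]_(z in ~` eball 0 rho0) `|f1 z| <= F ->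
  \int[mu]_(z in ~` eball 0 rho0) `|f2 z| <= F ->
  (forall z, annulus r rho0 z -> - loss z <= f1 z - f2 z) ->
  (forall z, G z -> gain <= f1 z - f2 z) ->
  \int[mu]_(z in ~` eball 0 r) f1 z <= M1 ->
  - (\int[mu]_(z in ~` eball 0 r) f2 z) <= M2 ->
  gain * V <= M1 + M2 + Ls + 2 * F.
Proof.
move=> r0 rr if1 if2 mG GA gain0 VG mloss loss0 hloss F1 F2 hl hG h1 h2.
have mA : measurable (annulus r rho0 : set T) by exact: measurable_annulus.
have mB : measurable (~` eball 0 rho0 : set T) by exact: measurable_eballC.
have mD : measurable (~` eball 0 r : set T) by exact: measurable_eballC.
have dE : ~` eball 0 r = annulus r rho0 `|` ~` eball 0 rho0 :> set T.
  apply/seteqP; split => z.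
    move=> /eballC0P ez; have [zr|rz] := ltP (enorm (z : 'rV[R]_n)) rho0; [left|right].
      by rewrite /annulus /= ez.
    exact/eballC0P.
  move=> [/= /andP[ez _]|/eballC0P rz]; apply/eballC0P => //.
  exact: le_trans rz.
have subA : annulus r rho0 `<=` (~` eball 0 r : set T) by rewrite dE; left.
have subB : ~` eball 0 rho0 `<=` (~` eball 0 r : set T) by rewrite dE; right.
have split f : mu.-integrable (~` eball 0 r) (EFin \o f) ->
    \int[mu]_(z in ~` eball 0 r) f z =
    \int[mu]_(z in annulus r rho0) f z + \int[mu]_(z in ~` eball 0 rho0) f z.
  move=> fi; rewrite [in LHS]dE Rintegral_setU//; first by rewrite -dE.
  rewrite disj_set2E; apply/eqP/seteqP; split => z // [] /= /andP[_ zr] /eballC0P.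
  by rewrite leNgt zr.
have i1A := integrableS mD mA subA if1.
have i2A := integrableS mD mA subA if2.
have i1B := integrableS mD mB subB if1.
have i2B := integrableS mD mB subB if2.
have B1 : - F <= \int[mu]_(z in ~` eball 0 rho0) f1 z.
  have := le_normr_Rintegral mB i1B; rewrite ler_norml => /andP[h _].
  by apply: le_trans h; rewrite lerN2.
have B2 : \int[mu]_(z in ~` eball 0 rho0) f2 z <= F.
  have := le_normr_Rintegral mB i2B; rewrite ler_norml => /andP[_ h].
  exact: le_trans h F2.
have iloss : mu.-integrable (annulus r rho0) (EFin \o loss).
  apply/integrableP; split; first by apply/measurable_EFinP; exact: measurable_funTS.
  apply: (@le_lt_trans _ _ Ls%:E); last by rewrite ltry.
  apply: le_trans hloss; apply: eq_ler.
  by apply: eq_integral => z; rewrite inE => zA /=; rewrite ger0_norm// loss0.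
have muA : (mu (annulus r rho0) < +oo)%E.
  apply: le_lt_trans (lebesgue_eball_fin 0 rho0); apply: le_measure; rewrite ?inE//.
    exact: measurable_eball.
  by move=> z /= /andP[_ zr]; exact/eball0P.
have i1G : mu.-integrable (annulus r rho0) (EFin \o (\1_G : T -> R)).
  apply/integrableP; split.
    by apply/measurable_EFinP; exact: measurable_indic.
  rewrite (eq_integral (EFin \o (\1_G : T -> R))); last by move=> z _ /=; rewrite ger0_norm.
  rewrite integral_indic//; apply: le_lt_trans muA.
  by apply: le_measure; rewrite ?inE//; exact: measurableI.
have iG : mu.-integrable (annulus r rho0) (fun z : T => (gain * \1_G z)%:E).
  rewrite (_ : (fun z => _) = (fun z => gain%:E * (\1_G z)%:E)%E); last by apply/funext => z; rewrite EFinM.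
  exact: (integrableZl mA _ i1G).
have iG' : mu.-integrable (annulus r rho0) (EFin \o (fun z : T => gain * \1_G z)) := iG.
have IG : gain * V <= \int[mu]_(z in annulus r rho0) (gain * \1_G z).
  rewrite (RintegralZl _ mA i1G).
  rewrite ler_wpM2l// /Rintegral integral_indic// (setIidl GA).
  rewrite -lee_fin fineK// ge0_fin_numE//.
  by apply: le_lt_trans muA; apply: le_measure; rewrite ?inE.
have IL : \int[mu]_(z in annulus r rho0) loss z <= Ls.
  by rewrite -lee_fin /Rintegral fineK//; exact: (integrable_fin_num mA iloss).
have main : \int[mu]_(z in annulus r rho0) (gain * \1_G z) - \int[mu]_(z in annulus r rho0) loss z
   <= \int[mu]_(z in annulus r rho0) f1 z - \int[mu]_(z in annulus r rho0) f2 z.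
  rewrite -!RintegralB//; apply: le_Rintegral => //.
  - exact: (integrableB mA iG' iloss).
  - exact: (integrableB mA i1A i2A).
  move=> z zA; rewrite indicE; case: (boolP (z \in G)) => [zG|_].
    rewrite mulr1; rewrite inE in zG.
    by have := hG z zG; have := loss0 z zA; lra.
  by rewrite mulr0 sub0r; exact: hl.
rewrite (split _ if1) in h1; rewrite (split _ if2) in h2; lra.
Qed.

End doubled_integrals.

(** * Concave profiles and the doubling of variables *)

Section profiles.
Variable R : realType.
Implicit Types (t gam th c : R) (phi dphi : R -> R).

(** What the doubling argument needs of the modulus L phi(|x - y|).  The gap
    2 phi(t) - phi(2 t) measures the concavity, and th how much smaller it is
    than for t^gam, gam < 1.  The function dphi stands for the derivative, of
    which only the tangent inequality and the size matter. *)
Record profile gam th c phi dphi : Prop := Profile {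
  prf_tangent : forall t t', 0 < t <= 1 -> 0 <= t' <= 1 ->
    phi t' <= phi t + dphi t * (t' - t);
  prf_ge : forall t, 0 <= t <= 4 -> c * t `^ gam <= phi t;
  prf_le : forall t, 0 <= t <= 4 -> phi t <= t `^ gam;
  prf_dge : forall t, 0 < t <= 1 -> c * t `^ (gam - 1) <= dphi t;
  prf_dle : forall t, 0 < t <= 1 -> dphi t <= t `^ (gam - 1);
  prf_gap : forall t, 0 < t <= 2^-1 -> c * t `^ (gam + th) <= 2 * phi t - phi (2 * t);
  prf_cont : continuous (fun t => phi `|t|) }.

Lemma powR_norm_continuous gam : 0 < gam <= 1 -> continuous (fun t : R => `|t| `^ gam).
Proof.
move=> gam01; have /andP[g0 g1] := gam01; move=> x.
have key (a b : R) : 0 <= a -> 0 <= b -> a `^ gam - b `^ gam <= `|a - b| `^ gam.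
  move=> a0 b0; have [ab|ba] := leP a b.
    apply: (@le_trans _ _ 0); last exact: powR_ge0.
    by rewrite subr_le0 powR_le_pos// ltW.
  rewrite ger0_norm ?subr_ge0 ?(ltW ba)//.
  have := @powR_subadd _ gam (a - b) b gam01; rewrite subrK subr_ge0 => /(_ (ltW ba) b0).
  by lra.
apply/(@cvgrPdist_lt R R^o) => /= e e0; near=> y.
apply: (@le_lt_trans _ _ (`|x - y| `^ gam)).
  apply: (@le_trans _ _ (`| `|x| - `|y| | `^ gam)); last first.
    by apply: powR_le_pos; rewrite ?(ltW g0)// ler_dist_dist.
  rewrite ler_norml; apply/andP; split; last exact: key.
  by rewrite lerNl opprB distrC key.
have -> : e = (e `^ gam^-1) `^ gam by rewrite -powRrM mulVf ?gt_eqF// powRr1// ltW.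
have xy : `|x - y| < e `^ gam^-1.
  near: y; have ee : 0 < e `^ gam^-1 by rewrite powR_gt0.
  by apply: (@cvgr_dist_lt R R^o); [exact: cvg_id|exact: ee].
by apply: gt0_ltr_powR; rewrite ?nnegrE ?powR_ge0.
Unshelve. all: by end_near. Qed.

Lemma profile_power gam : 0 < gam < 1 -> exists2 c, 0 < c <= 1 &
  profile gam 0 c (fun t => t `^ gam) (fun t => gam * t `^ (gam - 1)).
Proof.
move=> /andP[g0 g1].
have g01 : 0 <= gam <= 1 by rewrite !ltW.
have g2 : 0 < 2 - 2 `^ gam :> R.
  rewrite subr_gt0.
  have -> : 2 = 2 `^ 1 :> R by rewrite powRr1.
  rewrite -powRrM mul1r /powR ifF; last by apply/negbTE; rewrite pnatr_eq0.
  rewrite ifF; last by apply/negbTE; rewrite pnatr_eq0.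
  by rewrite ltr_expR ltr_pM2r// ln_gt0// ltr1n.
exists (Num.min gam (2 - 2 `^ gam)).
  by rewrite lt_min g0 g2 ge_min (ltW g1).
have c1 : Num.min gam (2 - 2 `^ gam) <= 1 by rewrite ge_min (ltW g1).
have cg : Num.min gam (2 - 2 `^ gam) <= gam by rewrite ge_min lexx.
have c2 : Num.min gam (2 - 2 `^ gam) <= 2 - 2 `^ gam by rewrite ge_min lexx orbT.
split.
- by move=> t t' /andP[t0 _] /andP[t'0 _]; exact: powR_tangent_le.
- by move=> t _; rewrite ler_piMl ?powR_ge0.
- by [].
- by move=> t _; rewrite ler_wpM2r ?powR_ge0.
- by move=> t _; rewrite ler_piMl ?powR_ge0 ?ltW.
- move=> t /andP[t0 _]; rewrite addr0 powRM ?(ltW t0)// -mulrBl.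
  by rewrite ler_wpM2r ?powR_ge0.
- by apply: powR_norm_continuous; rewrite g0 ltW.
Qed.

(** The linear function has no gap; subtracting t^(1+th) restores strict
    concavity, and the factor 1/8 keeps the profile increasing on the unit
    interval and above a multiple of t up to t = 4, the diameter of B_2. *)
Lemma profile_lipschitz th : 0 < th <= 1 -> exists2 c, 0 < c <= 1 &
  profile 1 th c (fun t => t - t `^ (1 + th) / 8) (fun t => 1 - (1 + th) * t `^ th / 8).
Proof.
move=> /andP[th0 th1].
have g2 : 0 < (2 `^ (1 + th) - 2) / 8 :> R.
  rewrite divr_gt0// subr_gt0.
  have {1}-> : 2 = 2 `^ 1 :> R by rewrite powRr1.
  rewrite /powR ifF; last by apply/negbTE; rewrite pnatr_eq0.
  rewrite ifF; last by apply/negbTE; rewrite pnatr_eq0.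
  by rewrite ltr_expR ltr_pM2r ?ltrDl// ln_gt0// ltr1n.
set c2 := _ / 8 in g2.
exists (Num.min 2^-1 c2).
  rewrite lt_min g2 invr_gt0 ltr0n/= ge_min invf_le1//.
  by rewrite ler1n.
have c1 : Num.min 2^-1 c2 <= 2^-1 by rewrite ge_min lexx.
have cc2 : Num.min 2^-1 c2 <= c2 by rewrite ge_min lexx orbT.
have pS t : 0 <= t -> t `^ (1 + th) = t * t `^ th.
  rewrite le_eqVlt => /predU1P[<-|t0]; first by rewrite mul0r powR0// gt_eqF// addr_gt0.
  by rewrite powRD_pos// powRr1// ltW.
have small t : 0 <= t <= 4 -> t `^ th <= 4.
  move=> /andP[t0 t4]; apply: (@le_trans _ _ (4 `^ th)).
    by apply: powR_le_pos => //; exact: ltW.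
  by apply: le_trans (ler_powR _ th1) _; rewrite ?powRr1// ler1n.
split.
- move=> t t' /andP[t0 _] /andP[t'0 _].
  have := @powR_tangent_ge _ (1 + th) t t' _ t0 t'0.
  rewrite lerDl => /(_ (ltW th0)).
  by rewrite addrAC subrr add0r; lra.
- move=> t t04; have /andP[t0 t4] := t04; rewrite powRr1// pS//.
  have h1 : t * t `^ th <= t * 4 by rewrite ler_wpM2l// small.
  have h2 : Num.min 2^-1 c2 * t <= 2^-1 * t by rewrite ler_wpM2r.
  lra.
- move=> t /andP[t0 _]; rewrite powRr1//.
  by have := powR_ge0 t (1 + th); lra.
- move=> t /andP[t0 t1]; rewrite subrr powRr0 mulr1.
  have h1 : t `^ th <= 1 by apply: powR_le1; [exact: ltW|rewrite (ltW t0)].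
  have h2 : (1 + th) * t `^ th <= 2 * 1 by rewrite ler_pM ?powR_ge0//; lra.
  lra.
- move=> t /andP[t0 t1]; rewrite subrr powRr0.
  have : 0 <= (1 + th) * t `^ th by rewrite mulr_ge0 ?powR_ge0//; lra.
  lra.
- move=> t /andP[t0 _]; rewrite powRM ?(ltW t0)//.
  have : Num.min 2^-1 c2 * t `^ (1 + th) <= c2 * t `^ (1 + th).
    by rewrite ler_wpM2r ?powR_ge0.
  by rewrite /c2; lra.
- move=> t; apply: cvgB; first exact: norm_continuous.
  apply: cvgM; last exact: cvg_cst.
  rewrite pS ?normr_ge0//.
  have -> : (fun t : R => `|t| `^ (1 + th)) = (fun t => `|t| * `|t| `^ th).
    by apply/funext => u; rewrite pS.
  apply: cvgM; first exact: norm_continuous.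
  by apply: powR_norm_continuous; rewrite th0.
Qed.

End profiles.

Section maximum.
Variables (R : realType) (n : nat).
Implicit Types (x y z : 'rV[R]_n) (v : 'rV[R]_n -> R).

(** The penalisation keeps the maximum near x0, away from the boundary. *)
Definition doubling v (phi : R -> R) (L m : R) x0 x y : R :=
  v x - v y - L * phi (enorm (x - y)) - m * enorm (x - x0) ^+ 2.

Lemma doubling_max v phi (L m rho : R) x0 : 0 <= rho ->
  (forall x, enorm x <= rho -> {for x, continuous v}) ->
  continuous (fun t : R => phi `|t|) ->
  exists xb yb, [/\ enorm xb <= rho, enorm yb <= rho &
    forall x y, enorm x <= rho -> enorm y <= rho ->
      doubling v phi L m x0 x y <= doubling v phi L m x0 xb yb].
Proof.
move=> rho0 cv cphi.
pose A : set ('rV[R]_n * 'rV[R]_n) := cball 0 rho `*` cball 0 rho.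
have cA : compact A by apply: compact_setX; exact: compact_cball.
have A0 : A !=set0.
  by exists (0, 0); split => /=; rewrite /cball /= subrr (enorm0 R n).
have cF : {within A, continuous (fun q => doubling v phi L m x0 q.1 q.2)}.
  apply: continuous_in_subspaceT => -[x y]; rewrite inE => -[/= hx hy].
  rewrite /cball /= !subr0 in hx hy.
  have c1 : {for (x, y), continuous (fun q : 'rV[R]_n * 'rV[R]_n => v q.1)}.
    by apply: (continuous_comp (f := fst) (g := v)); [exact: cvg_fst|exact: cv].
  have c2 : {for (x, y), continuous (fun q : 'rV[R]_n * 'rV[R]_n => v q.2)}.
    by apply: (continuous_comp (f := snd) (g := v)); [exact: cvg_snd|exact: cv].
  have c3 : {for (x, y), continuous (fun q : 'rV[R]_n * 'rV[R]_n => phi (enorm (q.1 - q.2)))}.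
    have -> : (fun q : 'rV[R]_n * 'rV[R]_n => phi (enorm (q.1 - q.2))) =
       (fun t => phi `|t|) \o (fun q : 'rV[R]_n * 'rV[R]_n => enorm (q.1 - q.2)).
      by apply/funext => q /=; rewrite ger0_norm ?enorm_ge0.
    apply: continuous_comp; last exact: cphi.
    apply: (continuous_comp (f := fun q : 'rV[R]_n * 'rV[R]_n => q.1 - q.2) (g := @enorm R 1 n)).
      by apply: continuousB; [exact: cvg_fst|exact: cvg_snd].
    exact: continuous_enorm.
  have c4 : {for (x, y), continuous (fun q : 'rV[R]_n * 'rV[R]_n => enorm (q.1 - x0) ^+ 2)}.
    apply: (continuous_comp (f := fun q : 'rV[R]_n * 'rV[R]_n => enorm (q.1 - x0)) (g := fun t => t ^+ 2)).
      apply: (continuous_comp (f := fst) (g := fun z => enorm (z - x0))); first exact: cvg_fst.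
      exact: continuous_enormB.
    exact: exprn_continuous.
  have cL k : {for (x, y), continuous (fun _ : 'rV[R]_n * 'rV[R]_n => k : R)}.
    exact: cst_continuous.
  exact: (continuousB (continuousB (continuousB c1 c2) (continuousM (cL L) c3))
    (continuousM (cL m) c4)).
have [[xb yb]] := compact_EVT_max A0 cA cF.
rewrite inE => -[/= hx hy] H.
exists xb, yb; split; [by move: hx; rewrite /cball /= subr0|by move: hy; rewrite /cball /= subr0|].
move=> x y xr yr; apply: (H (x, y)); rewrite inE.
by split; rewrite /cball /= subr0.
Qed.

End maximum.

(** * The estimates at a maximum point of the doubled function *)

Section modulus.
Variables (R : realType) (n : nat) (gam th c : R) (phi dphi : R -> R).
Hypotheses (gam01 : 0 < gam <= 1) (th0 : 0 <= th) (thg : th * gam = th) (c01 : 0 < c <= 1).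
Hypothesis pr : profile gam th c phi dphi.
Implicit Types (a z w : 'rV[R]_n).

Let gam0 : 0 < gam. Proof. by case/andP: gam01. Qed.
Let c0 : 0 < c. Proof. by case/andP: c01. Qed.

Lemma dphi_ge0 t : 0 < t <= 1 -> 0 <= dphi t.
Proof. by move=> t01; apply: le_trans (prf_dge pr t01); rewrite mulr_ge0 ?powR_ge0 ?(ltW c0). Qed.

(** The tangent line of the concave phi, composed with the paraboloid tangent to
    the norm at a. *)
Lemma phi_taylor a z : a != 0 -> enorm a <= 2^-1 -> enorm z <= enorm a ->
  phi (enorm (a + z)) <= phi (enorm a) + dot ((dphi (enorm a) / enorm a) *: a) z +
    dphi (enorm a) / (2 * enorm a) * enorm z ^+ 2.
Proof.
move=> a0 a1 za; have t0 : 0 < enorm a by rewrite enorm_gt0.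
have half : (2^-1 : R) + 2^-1 = 1 by rewrite -div1r -splitr.
have half1 : (2^-1 : R) <= 1 by rewrite invf_le1// ler1n.
have t01 : 0 < enorm a <= 1 by rewrite t0 (le_trans a1).
have az : 0 <= enorm (a + z) <= 1.
  rewrite enorm_ge0/= -half; apply: le_trans (enormD _ _) (lerD a1 _).
  exact: le_trans za a1.
apply: le_trans (prf_tangent pr t01 az) _.
rewrite -addrA lerD2l dotZl.
have := enorm_taylor z a0 => h.
have : dphi (enorm a) * (enorm (a + z) - enorm a) <=
   dphi (enorm a) * (dot a z / enorm a + enorm z ^+ 2 / (2 * enorm a)).
  by rewrite ler_wpM2l ?dphi_ge0//; lra.
move=> /le_trans; apply; apply: eq_ler.
by field; rewrite gt_eqF.
Qed.

(** Chosen so that phi(|w|) <= |w|^gam is a quarter of the gap. *)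
Definition gap_radius : R := (c / 4) `^ gam^-1.

Lemma gap_radius_gt0 : 0 < gap_radius.
Proof. by rewrite powR_gt0// divr_gt0. Qed.

Let c4 : 0 < c / 4. Proof. by rewrite divr_gt0. Qed.

Let c41 : c / 4 <= 1.
Proof. by case/andP: c01 => _ h; rewrite ler_pdivrMr// mul1r; apply: le_trans h _; rewrite ler1n. Qed.

Lemma gap_radius_le : gap_radius <= c / 4.
Proof.
rewrite -[leRHS]powRr1 ?(ltW c4)//; apply: ger_powR; first by rewrite c4 c41.
by case/andP: gam01 => g0 g1; rewrite invf_ge1.
Qed.

(** Near z = a the points x + z and y + z are moved to distances 2t + O(|w|) and
    |w| of y and x; the concavity of phi between 0, t and 2t gives the gain. *)
Lemma phi_gap a w : a != 0 -> enorm a <= 4^-1 ->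
  enorm w <= gap_radius * enorm a `^ (1 + th) ->
  phi (enorm (2 *: a + w)) + phi (enorm w) <=
    2 * phi (enorm a) - c / 2 * enorm a `^ (gam + th).
Proof.
move=> a0 a4 hw; set t := enorm a in a4 hw *.
have t0 : 0 < t by rewrite enorm_gt0.
have t1 : t <= 1 by apply: le_trans a4 _; rewrite invf_le1// ler1n.
have tth1 : t `^ th <= 1 by apply: powR_le1 => //; rewrite (ltW t0).
have wt : enorm w <= c / 4 * (t * t `^ th).
  apply: le_trans hw _; rewrite powRD_pos// powRr1 ?(ltW t0)//.
  by rewrite ler_wpM2r ?gap_radius_le// mulr_ge0 ?powR_ge0 ?(ltW t0).
have wt1 : enorm w <= t.
  apply: le_trans wt _; rewrite mulrCA ler_piMr ?(ltW t0)//.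
  by rewrite mulr_ile1 ?powR_ge0 ?(ltW c4).
have t4 : 4 * t <= 1 by rewrite -ler_pdivlMl ?mulr1.
have n2 : enorm (2 *: a) = 2 * t by rewrite enormZ ger0_norm.
have h1 : phi (enorm (2 *: a + w)) <= phi (2 * t) + t `^ (gam - 1) * enorm w.
  have t2 : 0 < 2 * t <= 1 by rewrite mulr_gt0//=; lra.
  have le3 : enorm (2 *: a + w) <= 2 * t + enorm w by rewrite -n2 enormD.
  have t3 : 0 <= enorm (2 *: a + w) <= 1 by rewrite enorm_ge0/=; lra.
  apply: le_trans (prf_tangent pr t2 t3) _; rewrite lerD2l.
  apply: (@le_trans _ _ (dphi (2 * t) * enorm w)).
    by rewrite ler_wpM2l ?dphi_ge0//; lra.
  rewrite ler_wpM2r ?enorm_ge0//; apply: le_trans (prf_dle pr t2) _.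
  by apply: powR_le_neg => //; [case/andP: gam01 => _ h; rewrite subr_le0|lra].
have h2 : phi (enorm w) <= c / 4 * t `^ (gam + th).
  have w4 : 0 <= enorm w <= 4 by rewrite enorm_ge0/=; lra.
  apply: le_trans (prf_le pr w4) _.
  apply: le_trans (powR_le_pos (ltW gam0) (enorm_ge0 _) hw) _.
  rewrite powRM ?powR_ge0 ?(ltW gap_radius_gt0)//.
  rewrite /gap_radius -powRrM mulVf ?gt_eqF// powRr1 ?(ltW c4)//.
  by rewrite -powRrM mulrDl mul1r thg.
have h3 : t `^ (gam - 1) * enorm w <= c / 4 * t `^ (gam + th).
  have -> : t `^ (gam + th) = t `^ (gam - 1) * (t * t `^ th).
    rewrite -[X in X * t `^ th](powRr1 (ltW t0)) -!powRD_pos//.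
    by congr (_ `^ _); ring.
  by rewrite mulrCA ler_wpM2l ?powR_ge0.
have t2 : 0 < t <= 2^-1.
  rewrite t0/=; apply: le_trans a4 _; rewrite lef_pV2 ?posrE//.
  by rewrite ler_nat.
have := prf_gap pr t2.
lra.
Qed.

End modulus.

Section comparison.
Variables (R : realType) (n : nat) (v : 'rV[R]_n -> R) (phi dphi : R -> R)
  (L m rho d : R) (x0 xb yb : 'rV[R]_n).
Implicit Types (z : 'rV[R]_n).
Let a := xb - yb.
Hypotheses (xd : enorm xb + d <= rho) (yd : enorm yb + d <= rho).
Hypothesis maxb : forall x y, enorm x <= rho -> enorm y <= rho ->
  doubling v phi L m x0 x y <= doubling v phi L m x0 xb yb.

Let xz z : enorm z <= d -> enorm (xb + z) <= rho.
Proof. by move=> zd; apply: le_trans (enormD _ _) (le_trans _ xd); rewrite lerD2l. Qed.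

Let yz z : enorm z <= d -> enorm (yb + z) <= rho.
Proof. by move=> zd; apply: le_trans (enormD _ _) (le_trans _ yd); rewrite lerD2l. Qed.

Let xb_le : 0 <= d -> enorm xb <= rho.
Proof. by move=> d0; have := @xz 0; rewrite addr0 (enorm0 R n); apply. Qed.

Let yb_le : 0 <= d -> enorm yb <= rho.
Proof. by move=> d0; have := @yz 0; rewrite addr0 (enorm0 R n); apply. Qed.

Definition penalty_increment z : R :=
  m * (2 * dot (xb - x0) z + enorm z ^+ 2).

Let penE z : m * enorm (xb + z - x0) ^+ 2 = m * enorm (xb - x0) ^+ 2 + penalty_increment z.
Proof.
have -> : xb + z - x0 = (xb - x0) + z by rewrite addrAC.
by rewrite sqr_enormD /penalty_increment; ring.
Qed.

(* The maximality of (xb, yb), against the pairs (xb + z, yb), (xb, yb + z) and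
   (xb + z, yb + z). *)
Lemma increment_x z : 0 <= d -> enorm z <= d ->
  v (xb + z) - v xb <= L * (phi (enorm (a + z)) - phi (enorm a)) + penalty_increment z.
Proof.
move=> d0 zd; have := maxb (xz zd) (yb_le d0); rewrite /doubling penE.
have -> : xb + z - yb = a + z by rewrite addrAC.
rewrite -/a; lra.
Qed.

Lemma increment_y z : 0 <= d -> enorm z <= d ->
  v yb - v (yb + z) <= L * (phi (enorm (a - z)) - phi (enorm a)).
Proof.
move=> d0 zd; have := maxb (xb_le d0) (yz zd); rewrite /doubling.
have -> : xb - (yb + z) = a - z by rewrite opprD addrA.
rewrite -/a; lra.
Qed.

Lemma increment_xy z : 0 <= d -> enorm z <= d ->
  (v yb - v (yb + z)) - (v xb - v (xb + z)) <= penalty_increment z.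
Proof.
move=> d0 zd; have := maxb (xz zd) (yz zd); rewrite /doubling penE.
have -> : xb + z - (yb + z) = a by rewrite opprD addrACA subrr addr0.
rewrite -/a; lra.
Qed.

Lemma penalty_increment_le z : 0 <= m ->
  penalty_increment z <= m * (2 * enorm (xb - x0) * enorm z + enorm z ^+ 2).
Proof.
move=> m0; rewrite ler_wpM2l// lerD2r -mulrA ler_wpM2l//.
exact: cauchy_schwarz.
Qed.

End comparison.

Section losses.
Variables (R : realType) (n : nat) (p s : R).
Hypotheses (p1 : 1 < p).
Local Notation mu := (@lebesgue_rV R n).
Local Notation T := (lebesgue_rV_type R n).
Local Notation J := (J p).
Let q := Num.min 1 (p - 1).
Let Q := Num.max 1 (p - 1).

(** Unified form of the two cases: for beta > 0 the outer radius, at most 1,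
    dominates, for beta < 0 the inner one. *)
Lemma integral_annulus_powR (beta : R) : beta != 0 -> exists2 C, 0 < C &
  forall r rho0 : R, 0 < r -> r <= rho0 -> rho0 <= 1 ->
  (\int[mu]_(z in annulus r rho0) (enorm (z : 'rV[R]_n) `^ (beta - n%:R))%:E <=
   (C * r `^ (Num.min beta 0))%:E)%E.
Proof.
rewrite neq_lt => /orP[b0|b0].
  have nb0 : 0 < - beta by rewrite oppr_gt0.
  have [C C0 HC] := integral_exterior_powR n nb0.
  exists C => // r rho0 r0 _ _; have -> : Num.min beta 0 = beta by apply/min_idPl; exact: ltW.
  have := HC r r0; rewrite opprK; apply: le_trans.
  apply: ge0_subset_integral.
  - exact: measurable_annulus.
  - exact: measurable_eballC.
  - by apply: measurable_enorm_powR; exact: measurable_eballC.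
  - by move=> z _; rewrite lee_fin powR_ge0.
  - by move=> z /= /andP[rz _]; exact/eballC0P.
have [C C0 HC] := integral_ball_powR n b0.
exists C => // r rho0 r0 rr r1; have -> : Num.min beta 0 = 0 by apply/min_idPr; exact: ltW.
rewrite powRr0 mulr1; apply: le_trans (HC r rho0 r0 (lt_le_trans r0 rr)) _.
rewrite lee_fin ler_piMr ?(ltW C0)//; apply: powR_le1; first exact: ltW.
by rewrite r1 (le_trans (ltW r0)).
Qed.

(** Here zt stands for |z| and A zt^kappa is the modulus of continuity at hand.
    The penalisation moves T2 by at most b, and [J_sub_le] turns this into
    b^q |z|^(kappa (p-1-q)); for p > 2 the second factor uses the regularity of v,
    through the degeneracy of J at 0. *)
Lemma penalty_loss (kappa A m CX : R) : 0 <= kappa <= 1 -> 0 <= A -> 0 < m -> 0 <= CX ->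
  exists2 C, 0 < C & forall t zt X T1 T2 b : R,
    0 < t -> 0 < zt <= 1 -> 0 <= X <= 1 -> X <= CX * t `^ (kappa / 2) ->
    b <= m * (2 * X * zt + zt ^+ 2) -> `|T2| <= A * zt `^ kappa -> T2 - b <= T1 ->
    J T2 - J T1 <= C * (t `^ (kappa * q / 2) * zt `^ (q + kappa * (p - 1 - q)) +
                        zt `^ (q + q + kappa * (p - 1 - q))).
Proof.
move=> /andP[k0 k1] A0 m0 CX0.
have [C C0 HC] := J_sub_le p1.
have q0 : 0 < q by rewrite lt_min ltr01 subr_gt0.
have q1 : q <= 1 by rewrite ge_min lexx.
have pq : 0 <= p - 1 - q by rewrite subr_ge0 ge_min lexx orbT.
have B0 : 0 < A + 3 * m by rewrite ltr_wpDl// mulr_gt0.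
pose D := m `^ q * ((2 * CX) `^ q + 1).
have D0 : 0 < D by rewrite mulr_gt0 ?powR_gt0// ltr_wpDl ?powR_ge0.
exists (C * (D * (A + 3 * m) `^ (p - 1 - q))); first by rewrite mulr_gt0 // mulr_gt0 // powR_gt0.
move=> t zt X T1 T2 b t0 /andP[z0 z1] /andP[X0 X1] XC hb hT2 hT1.
pose B := m * (2 * X * zt + zt ^+ 2).
have zz0 : 0 <= 2 * X * zt by rewrite !mulr_ge0 ?(ltW z0).
have B00 : 0 <= B by rewrite mulr_ge0 ?(ltW m0)// addr_ge0// exprn_ge0 ?ltW.
have : J (T2 - B) <= J T1 by apply: J_homo => //; apply: le_trans hT1; rewrite lerD2l lerN2.
have := HC T2 B B00.
have zk : zt <= zt `^ kappa.
  by apply: ger1_powR => //; rewrite z0.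
have BL : `|T2| + B <= (A + 3 * m) * zt `^ kappa.
  rewrite mulrDl; apply: lerD => //.
  apply: (@le_trans _ _ (3 * m * zt)).
    have h1 : 2 * X * zt <= 2 * 1 * zt by rewrite ler_wpM2r ?(ltW z0)// ler_wpM2l.
    have h2 : zt ^+ 2 <= 1 * zt by rewrite expr2 ler_wpM2r ?(ltW z0).
    have : 0 <= m * (3 * zt - (2 * X * zt + zt ^+ 2)) by rewrite mulr_ge0 ?(ltW m0)//; lra.
    rewrite /B; lra.
  by rewrite ler_wpM2l// mulr_ge0 ?(ltW m0).
have P1 : (`|T2| + B) `^ (p - 1 - q) <= (A + 3 * m) `^ (p - 1 - q) * zt `^ (kappa * (p - 1 - q)).
  apply: le_trans (powR_le_pos pq _ BL) _; first by rewrite addr_ge0.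
  by rewrite powRM ?powR_ge0 ?(ltW B0)// powRrM.
have q01 : 0 < q <= 1 by rewrite q0 q1.
have P2 : B `^ q <= D * (t `^ (kappa * q / 2) * zt `^ q + zt `^ (q + q)).
  rewrite /B powRM ?(ltW m0)//; last by rewrite addr_ge0// exprn_ge0 ?ltW.
  rewrite /D -[leRHS]mulrA ler_wpM2l ?powR_ge0//.
  have zq : (zt ^+ 2) `^ q = zt `^ (q + q).
    rewrite -powR_mulrn ?(ltW z0)// -powRrM; congr (_ `^ _); ring.
  have := powR_subadd q01 zz0 (exprn_ge0 2 (ltW z0)); rewrite zq => /le_trans; apply.
  have h1 : (2 * X * zt) `^ q <= (2 * CX) `^ q * (t `^ (kappa * q / 2) * zt `^ q).
    rewrite mulrA -(_ : (2 * CX * t `^ (kappa / 2)) `^ q = (2 * CX) `^ q * t `^ (kappa * q / 2)).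
      rewrite -powRM ?mulr_ge0 ?powR_ge0 ?(ltW z0)//.
      apply: powR_le_pos; [exact: ltW|exact: zz0|].
      by rewrite ler_wpM2r ?(ltW z0)// -mulrA ler_wpM2l.
    rewrite powRM ?mulr_ge0 ?powR_ge0// -powRrM; congr (_ * _ `^ _); ring.
  have h2 : 0 <= (2 * CX) `^ q * zt `^ (q + q) by rewrite mulr_ge0 ?powR_ge0.
  have h3 : 0 <= t `^ (kappa * q / 2) * zt `^ q by rewrite mulr_ge0 ?powR_ge0.
  lra.
have P3 : B `^ q * (`|T2| + B) `^ (p - 1 - q) <=
    D * (t `^ (kappa * q / 2) * zt `^ q + zt `^ (q + q)) *
    ((A + 3 * m) `^ (p - 1 - q) * zt `^ (kappa * (p - 1 - q))).
  by apply: ler_pM => //; exact: powR_ge0.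
have P4 := ler_wpM2l (ltW C0) P3.
move=> h1 h2; apply: (@le_trans _ _ (J T2 - J (T2 - B))); first by rewrite lerB.
apply: le_trans h1 _; apply: le_trans P4 _.
rewrite !powRD_pos//; apply: eq_ler; ring.
Qed.

End losses.

Section values.
Variables (R : realType) (p s n' gam th c Q : R).
Implicit Types t L : R.
(* E is the order in t of the gain: J has degree p - 1, the kernel at distance t
   degree - n - ps, and the gain region has volume t^((1+th) n).  Each factor
   t^th of the gap enters with the exponent Q or n, hence N. *)
Let N := n' + Q.
Let E := gam * (p - 1) - p * s + th * N.

Lemma gain_value (cJ cn lam gr L t : R) : 0 < t -> 0 < L -> 0 < c -> 0 < gr ->
  cJ * ((L * (c / 4) * t `^ (gam + th)) `^ Q * (L * t `^ gam) `^ (p - 1 - Q)) *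
    (lam * (2 * t) `^ (- (n' + p * s))) * (cn * (gr * t `^ (1 + th)) `^ n') =
  cJ * (c / 4) `^ Q * lam * 2 `^ (- (n' + p * s)) * cn * gr `^ n' * (L `^ (p - 1) * t `^ E).
Proof.
move=> t0 L0 c0 gr0.
have c4 : 0 <= c / 4 by rewrite divr_ge0 ?ltW.
move: (c / 4) c4 => k k0.
have lt0 := ltW t0; have lL0 := ltW L0; have lgr0 := ltW gr0.
rewrite !powRM ?mulr_ge0 ?powR_ge0// -!powRrM.
have -> : L `^ (p - 1) = L `^ Q * L `^ (p - 1 - Q).
  by rewrite -powRD_pos//; congr (_ `^ _); ring.
have -> : t `^ E = t `^ ((gam + th) * Q) * t `^ (gam * (p - 1 - Q)) *
    t `^ (- (n' + p * s)) * t `^ ((1 + th) * n').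
  by rewrite -!powRD_pos//; congr (_ `^ _); rewrite /E /N; ring.
ring.
Qed.

(** The radius is the power of t for which the near field is of the same order as
    the gain; the factor ce makes it smaller. *)
Lemma loss_value (Cg ce L t G : R) : 0 < t -> 0 < L -> 0 < c -> 0 < ce -> 0 < p - p * s ->
  G <= Cg * (L * t `^ (gam - 1)) `^ (p - 2) ->
  G * (L * t `^ (gam - 2)) * (ce * t `^ (1 + th * N / (p - p * s))) `^ (p - p * s) <=
  Cg * ce `^ (p - p * s) * (L `^ (p - 1) * t `^ E).
Proof.
move=> t0 L0 c0 ce0 ps0 hG.
have lt0 := ltW t0; have lL0 := ltW L0; have lce0 := ltW ce0.
apply: (@le_trans _ _ (Cg * (L * t `^ (gam - 1)) `^ (p - 2) * (L * t `^ (gam - 2)) *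
  (ce * t `^ (1 + th * N / (p - p * s))) `^ (p - p * s))).
  by rewrite !ler_wpM2r ?mulr_ge0 ?powR_ge0.
rewrite !powRM ?mulr_ge0 ?powR_ge0// -!powRrM.
have -> : L `^ (p - 1) = L * L `^ (p - 2).
  have {2}-> : L = L `^ 1 by rewrite powRr1.
  by rewrite -powRD_pos//; congr (_ `^ _); ring.
have -> : t `^ E = t `^ ((gam - 1) * (p - 2)) * t `^ (gam - 2) *
    t `^ ((1 + th * N / (p - p * s)) * (p - p * s)).
  rewrite -!powRD_pos//; congr (_ `^ _); rewrite /E.
  by field; rewrite gt_eqF.
by apply: eq_ler; ring.
Qed.

Lemma powR_between (Y G : R) : 0 < c <= 1 -> 0 < Y -> c / 2 * Y <= G -> G <= 2 * Y ->
  G `^ (p - 2) <= (2 `^ (p - 2) + (c / 2) `^ (p - 2)) * Y `^ (p - 2).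
Proof.
move=> /andP[c0 c1] Y0 h1 h2.
have c2 : 0 < c / 2 by rewrite divr_gt0.
have cY : 0 < c / 2 * Y by rewrite mulr_gt0.
have [p2|p2] := leP 2 p.
  apply: le_trans (powR_le_pos _ _ h2) _; first by rewrite subr_ge0.
    by apply: le_trans h1; exact: ltW.
  by rewrite powRM ?(ltW Y0)// mulrDl lerDl mulr_ge0 ?powR_ge0.
apply: le_trans (powR_le_neg _ cY h1) _; first by rewrite subr_le0 ltW.
by rewrite powRM ?(ltW Y0) ?(ltW c2)// mulrDl lerDr mulr_ge0 ?powR_ge0.
Qed.

End values.

(** * The doubling argument *)

Section doubling_argument.
Variables (R : realType) (n : nat) (p s lam Lam C0 : R).
Hypotheses (p1 : 1 < p) (s0 : 0 < s) (s1 : s < 1)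
  (lam0 : 0 < lam) (Lam0 : 0 < Lam) (C00 : 0 < C0).
Local Notation mu := (@lebesgue_rV R n).
Local Notation T := (lebesgue_rV_type R n).
Local Notation J := (J p).
Local Notation nps := (n%:R + p * s).
Let q := Num.min 1 (p - 1).
Implicit Types (z : 'rV[R]_n).
Let Q := Num.max 1 (p - 1).
Let N := n%:R + Q.

Section step.
Variables (kappa gam th c beta1 beta2 : R) (phi dphi : R -> R).
Hypotheses (k01 : 0 <= kappa <= 1) (gam01 : 0 < gam <= 1) (th0 : 0 <= th)
  (thg : th * gam = th) (gth : gam + th <= 1 + kappa / 2) (c01 : 0 < c <= 1).
Hypothesis pr : profile gam th c phi dphi.
(* The radius of the paraboloids is of order t^(1+th2); alpha and alpha + q are
   the orders in |z| of the two losses in penalty_loss after integration, and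
   beta1 and beta2 are numbers below them. *)
Let th2 := th * N / (p - p * s).
Let E := gam * (p - 1) - p * s + th * N.
Let alpha := q + kappa * (p - 1 - q) - p * s.
Hypotheses (b1_le : beta1 <= alpha) (b2_le : beta2 <= alpha + q)
  (E1 : E <= kappa * q / 2 + (1 + th2) * Num.min beta1 0)
  (E2 : E <= (1 + th2) * Num.min beta2 0).

Let c0 : 0 < c. Proof. by case/andP: c01. Qed.
Let gam0 : 0 < gam. Proof. by case/andP: gam01. Qed.
Let gr := gap_radius gam c.
Let gr0 : 0 < gr. Proof. exact: gap_radius_gt0. Qed.
Let p0 : 0 < p - 1. Proof. by rewrite subr_gt0. Qed.
Let ps0 : 0 < p - p * s. Proof. exact: kernel_gap_gt0. Qed.
Let N0 : 0 <= N. Proof. by rewrite addr_ge0// le_max ler01. Qed.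
Let th20 : 0 <= th2. Proof. by rewrite divr_ge0 ?mulr_ge0 ?(ltW ps0). Qed.

Section at_maximum.
Variables (K v : 'rV[R]_n -> R) (L m d rho1 A CX ce : R) (x0 xb yb : 'rV[R]_n).
Hypotheses (K_adm : admissible_kernel p s lam Lam K) (vN : normalized p s C0 K v).
Let a := xb - yb.
Let t := enorm a.
Let X := enorm (xb - x0).
Let r := ce * t `^ (1 + th2).
Hypotheses (d01 : 0 < d <= 1) (xd : enorm xb + d <= rho1) (yd : enorm yb + d <= rho1)
  (rho12 : rho1 < 2).
Hypothesis maxb : forall x y, enorm x <= rho1 -> enorm y <= rho1 ->
  doubling v phi L m x0 x y <= doubling v phi L m x0 xb yb.
Hypotheses (a0 : a != 0) (td : 4 * t <= d) (X1 : X <= 1) (XC : X <= CX * t `^ (kappa / 2))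
  (CX0 : 0 <= CX) (m0 : 0 < m) (L0 : 0 < L)
  (L1 : 4 * m <= c * L) (L2 : 2 * m <= L) (L3 : 16 * m * (CX + 1) <= c * L)
  (ce0 : 0 < ce) (ce1 : ce <= c / 4).
Hypothesis vA : forall z, enorm z < d -> `|v yb - v (yb + z)| <= A * enorm z `^ kappa.
(* The constants of J_add_ge, lebesgue_eball_ge, penalty_loss,
   integral_annulus_powR (twice) and far_field: they are fixed before the
   solution, so that L can be taken large compared with all of them. *)
Variables (cJ cn Cl I1 I2 F : R).
Hypotheses (I10 : 0 < I1) (I20 : 0 < I2).
Hypothesis cJ0 : 0 < cJ.
Hypothesis HcJ : forall t b S : R, 0 <= b <= S -> `|t| <= S -> 0 < S ->
  cJ * (b `^ Q * S `^ (p - 1 - Q)) <= J (t + b) - J t.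
Hypothesis Hcn : forall (x : 'rV[R]_n) (r : R), 0 <= r -> ((cn * r ^+ n)%:E <= mu (eball x r))%E.
Hypothesis Cl0 : 0 < Cl.
Hypothesis HCl : forall t zt X T1 T2 b : R,
  0 < t -> 0 < zt <= 1 -> 0 <= X <= 1 -> X <= CX * t `^ (kappa / 2) ->
  b <= m * (2 * X * zt + zt ^+ 2) -> `|T2| <= A * zt `^ kappa -> T2 - b <= T1 ->
  J T2 - J T1 <= Cl * (t `^ (kappa * q / 2) * zt `^ (q + kappa * (p - 1 - q)) +
                      zt `^ (q + q + kappa * (p - 1 - q))).
Hypothesis HI1 : forall r rho0 : R, 0 < r -> r <= rho0 -> rho0 <= 1 ->
  (\int[mu]_(z in annulus r rho0) (enorm (z : 'rV[R]_n) `^ (beta1 - n%:R))%:E <=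
   (I1 * r `^ (Num.min beta1 0))%:E)%E.
Hypothesis HI2 : forall r rho0 : R, 0 < r -> r <= rho0 -> rho0 <= 1 ->
  (\int[mu]_(z in annulus r rho0) (enorm (z : 'rV[R]_n) `^ (beta2 - n%:R))%:E <=
   (I2 * r `^ (Num.min beta2 0))%:E)%E.
Hypothesis HF : forall x, enorm x <= rho1 ->
  \int[mu]_(z in ~` eball 0 d) `|increment p K v x z| <= F.

Let t0 : 0 < t. Proof. by rewrite /t enorm_gt0. Qed.
Let d0 : 0 < d. Proof. by case/andP: d01. Qed.
Let d1 : d <= 1. Proof. by case/andP: d01. Qed.
Let c1 : c <= 1. Proof. by case/andP: c01. Qed.
Let t4 : t <= 4^-1.
Proof. by rewrite -div1r ler_pdivlMr// mulrC; apply: le_trans d1. Qed.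
Let t1 : t <= 1. Proof. by apply: le_trans t4 _; rewrite invf_le1// ler1n. Qed.
Let tle x y : x <= y -> t `^ y <= t `^ x.
Proof. by move=> xy; apply: ger_powR => //; rewrite t0. Qed.
Let r0 : 0 < r. Proof. by rewrite mulr_gt0 ?powR_gt0. Qed.

Let r_le : r <= c / 4 * t.
Proof.
rewrite /r powRD_pos// powRr1 ?(ltW t0)//.
have h : t `^ th2 <= 1 by apply: powR_le1; rewrite ?th20 ?(ltW t0).
have h2 : t * t `^ th2 <= t * 1 by rewrite ler_wpM2l ?(ltW t0).
by rewrite mulr1 in h2; apply: ler_pM; rewrite ?(ltW ce0) ?mulr_ge0 ?powR_ge0 ?(ltW t0).
Qed.

Let r_t4 : 4 * r <= t.
Proof.
have : c * t <= 1 * t by rewrite ler_wpM2r ?(ltW t0).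
by move: r_le; lra.
Qed.

Let Y := L * t `^ (gam - 1).
Let Y0 : 0 < Y. Proof. by rewrite mulr_gt0 ?powR_gt0. Qed.
Let YL : L <= Y.
Proof.
rewrite /Y ler_peMr ?(ltW L0)// -[leLHS](powRr0 t) tle// subr_le0.
by case/andP: gam01.
Qed.
Let H := L * t `^ (gam - 2).
Let HE : H * t = Y.
Proof.
rewrite /H /Y -mulrA -{2}(powRr1 (ltW t0)) -powRD_pos//.
by congr (_ * _ `^ _); ring.
Qed.
Let H0 : 0 < H. Proof. by rewrite mulr_gt0 ?powR_gt0. Qed.

Let Dt := dphi t.
Let t01 : 0 < t <= 1. Proof. by rewrite t0. Qed.
Let D_ge : c * Y <= L * Dt.
Proof. by rewrite mulrCA ler_wpM2l ?(ltW L0)//; exact: (prf_dge pr). Qed.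
Let D_le : L * Dt <= Y.
Proof. by rewrite ler_wpM2l ?(ltW L0)//; exact: (prf_dle pr). Qed.

Let H_ge : L * (Dt / (2 * t)) + m <= H.
Proof.
have h1 : L * (Dt / (2 * t)) <= H / 2.
  have -> : L * (Dt / (2 * t)) = (L * Dt) / t / 2 by field; rewrite gt_eqF.
  by rewrite ler_pM2r ?invr_gt0// ler_pdivrMr// HE.
have h2 : L <= H.
  by apply: le_trans YL _; rewrite -HE ler_piMr ?(ltW H0).
by move: L2 h1 h2; lra.
Qed.

Let slope := (Dt / t) *: a.
Let slopeE : enorm slope = Dt.
Proof.
rewrite enormZ ger0_norm -/t ?divfK ?gt_eqF//.
by rewrite divr_ge0 ?(ltW t0)//; exact: (dphi_ge0 c01 pr).
Qed.

Let ball_sub (x : 'rV[R]_n) : enorm x + d <= rho1 -> eball x r `<=` eball 0 2.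
Proof.
move=> xr z zr; apply/eball0P; rewrite -(subrK x z).
apply: le_lt_trans (enormD _ _) _.
have rd : r <= d by move: r_t4 td; have := t0; have := r0; lra.
apply: le_lt_trans rho12; apply: le_trans xr.
rewrite addrC lerD2l; apply: le_trans rd; exact: ltW zr.
Qed.

Let loss_of (g : 'rV[R]_n) : c / 2 * Y <= enorm g -> enorm g <= 2 * Y ->
  enorm g `^ (p - 2) * H * r `^ (p - p * s) <=
  (2 `^ (p - 2) + (c / 2) `^ (p - 2)) * ce `^ (p - p * s) * (L `^ (p - 1) * t `^ E).
Proof.
move=> h1 h2; apply: (loss_value n%:R th Q t0 L0 c0 ce0 ps0).
exact: (powR_between p c01 Y0).
Qed.

Let slope_ok (g : 'rV[R]_n) : c / 2 * Y <= enorm g -> 2 * H * r <= enorm g.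
Proof.
apply: le_trans; have : H * r <= H * (c / 4 * t) by rewrite ler_wpM2l ?(ltW H0).
have -> : H * (c / 4 * t) = c / 4 * Y by rewrite mulrCA HE.
by lra.
Qed.

Let t_half : t <= 2^-1.
Proof. by apply: le_trans t4 _; rewrite lef_pV2 ?posrE// ler_nat. Qed.

Let small_z z : enorm z < r -> enorm z <= d /\ enorm z <= t.
Proof. by move=> /ltW zr; have := r_t4; have := td; have := t0; have := enorm_ge0 z; lra. Qed.

Let M := 1 + C0 * ((2 `^ (p - 2) + (c / 2) `^ (p - 2)) * ce `^ (p - p * s) *
  (L `^ (p - 1) * t `^ E)).

(* At xb the slope also contains the gradient of the penalisation, which is small
   compared with L. *)
Let bound_x : \int[mu]_(z in ~` eball 0 r) increment p K v xb z <= M.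
Proof.
pose g := L *: slope + (2 * m) *: (xb - x0).
have gL : enorm (L *: slope) = L * Dt by rewrite enormZ slopeE ger0_norm// ltW.
have gX : enorm ((2 * m) *: (xb - x0)) <= 2 * m.
  rewrite enormZ ger0_norm; last by rewrite mulr_ge0// ltW.
  by rewrite ler_piMr ?mulr_ge0 ?(ltW m0).
have cYL : c * L <= c * Y by rewrite ler_wpM2l ?(ltW c0).
have g1 : c / 2 * Y <= enorm g.
  by have := enorm_triD (L *: slope) ((2 * m) *: (xb - x0)); rewrite gL; move: D_ge gX L1 cYL; rewrite /g; lra.
have g2 : enorm g <= 2 * Y.
  apply: le_trans (enormD _ _) _; rewrite gL.
  by move: D_le gX L2 YL; lra.
apply: le_trans (nrm_sub vN r0 H0 (slope_ok g1) (ball_sub xd) _) _; last first.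
  by rewrite lerD2l ler_wpM2l ?(ltW C00)//; exact: loss_of.
move=> z zr; have [zd zt] := small_z zr.
have := increment_x xd yd maxb (ltW d0) zd; rewrite -/a -/t => h.
have := phi_taylor c01 pr a0 t_half zt; rewrite -/t -/Dt -/slope => h2.
have h3 : L * (phi (enorm (a + z)) - phi t) <= L * (dot slope z + Dt / (2 * t) * enorm z ^+ 2).
  by rewrite ler_wpM2l ?(ltW L0)//; move: h2; lra.
have h4 : 0 <= (H - (L * (Dt / (2 * t)) + m)) * enorm z ^+ 2.
  by rewrite mulr_ge0 ?subr_ge0 ?exprn_ge0 ?enorm_ge0.
rewrite /g dotDl (dotZl L) (dotZl (2 * m)); move: h; rewrite /penalty_increment; lra.
Qed.

Let bound_y : - (\int[mu]_(z in ~` eball 0 r) increment p K v yb z) <= M.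
Proof.
have mB : measurable (~` eball 0 r : set T) by exact: measurable_eballC.
have iv := integrable_increment p1 s0 K_adm yb r0 (nrm_Lsp vN).
have -> : - (\int[mu]_(z in ~` eball 0 r) increment p K v yb z) =
    \int[mu]_(z in ~` eball 0 r) increment p K (fun x => - v x) yb z.
  rewrite -mulN1r -(RintegralZl _ mB iv); apply: eq_Rintegral => z _.
  by rewrite /increment opprK mulN1r -mulNr -JN; congr (J _ * _); ring.
pose g := (- L) *: slope.
have gL : enorm g = L * Dt by rewrite enormZ slopeE normrN ger0_norm// ltW.
have cYL : 0 <= c * Y by rewrite mulr_ge0 ?(ltW Y0) ?(ltW c0).
have g1 : c / 2 * Y <= enorm g by rewrite gL; move: D_ge cYL; lra.
have g2 : enorm g <= 2 * Y by rewrite gL; move: D_le Y0; lra.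
apply: le_trans (nrm_super vN r0 H0 (slope_ok g1) (ball_sub yd) _) _; last first.
  by rewrite lerD2l ler_wpM2l ?(ltW C00)//; exact: loss_of.
move=> z zr; have [zd zt] := small_z zr.
have := increment_y xd yd maxb (ltW d0) zd; rewrite -/a -/t => h.
have zt' : enorm (- z) <= enorm a by rewrite enormN.
have := phi_taylor c01 pr a0 t_half zt'; rewrite -/t -/Dt -/slope dotNr enormN => h2.
have h3 : L * (phi (enorm (a - z)) - phi t) <= L * (- dot slope z + Dt / (2 * t) * enorm z ^+ 2).
  by rewrite ler_wpM2l ?(ltW L0)//; move: h2; lra.
have h4 : 0 <= (H - (L * (Dt / (2 * t)) + m)) * enorm z ^+ 2.
  by rewrite mulr_ge0 ?subr_ge0 ?exprn_ge0 ?enorm_ge0.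
have h5 : 0 <= m * enorm z ^+ 2 by rewrite mulr_ge0 ?(ltW m0) ?exprn_ge0 ?enorm_ge0.
by rewrite /g dotZl; move: h; lra.
Qed.

Let T1 z := v xb - v (xb + z).
Let T2 z := v yb - v (yb + z).

Let kernel_mono z (W V : R) : z != 0 -> W <= V -> 0 <= V ->
  W * K z <= V * (Lam * enorm z `^ (- nps)).
Proof.
move=> z0 WV V0; apply: (@le_trans _ _ (V * K z)).
  exact: (ler_wpM2r (kernel_ge0 K_adm z0) WV).
exact: (ler_wpM2l V0 (kernel_le K_adm z0)).
Qed.

Let q0 : 0 < q. Proof. by rewrite lt_min ltr01. Qed.

Let loss z : R := Lam * Cl *
  (t `^ (kappa * q / 2) * enorm z `^ (beta1 - n%:R) + enorm z `^ (beta2 - n%:R)).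

(* Comparison of (xb, yb) with (xb + z, yb + z): phi does not see the common
   translation, only the penalisation does. *)
Let mid_le z : annulus r d z ->
  - loss z <= increment p K v xb z - increment p K v yb z.
Proof.
move=> /= /andP[rz zd].
have zp : 0 < enorm z by exact: lt_le_trans rz.
have z0 : z != 0 by rewrite -enorm_gt0.
have z1 : enorm z <= 1 by apply: le_trans (ltW zd) d1.
have zt01 : 0 < enorm z <= 1 by rewrite zp.
have X01 : 0 <= X <= 1 by rewrite enorm_ge0.
have hb := penalty_increment_le x0 xb z (ltW m0); rewrite -/X in hb.
have hT := increment_xy xd yd maxb (ltW d0) (ltW zd).
have hT' : T2 z - penalty_increment m x0 xb z <= T1 z by move: hT; rewrite /T1 /T2; lra.
have := HCl t0 zt01 X01 XC hb (vA zd) hT'.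
set W := t `^ (kappa * q / 2) * enorm z `^ (q + kappa * (p - 1 - q)) +
  enorm z `^ (q + q + kappa * (p - 1 - q)) => hJ.
have W0 : 0 <= W by apply: addr_ge0; [apply: mulr_ge0; exact: powR_ge0|exact: powR_ge0].
have := kernel_mono z0 hJ (mulr_ge0 (ltW Cl0) W0).
have -> : (J (T2 z) - J (T1 z)) * K z = increment p K v yb z - increment p K v xb z.
  by rewrite mulrBl.
have mono (b b' : R) : b <= b' -> enorm z `^ b' <= enorm z `^ b by move=> h; exact: ger_powR.
have h1 : enorm z `^ (q + kappa * (p - 1 - q)) * enorm z `^ (- nps) <= enorm z `^ (beta1 - n%:R).
  by rewrite -powRD_pos//; apply: mono; move: b1_le; rewrite /alpha; lra.
have h2 : enorm z `^ (q + q + kappa * (p - 1 - q)) * enorm z `^ (- nps) <= enorm z `^ (beta2 - n%:R).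
  by rewrite -powRD_pos//; apply: mono; move: b2_le; rewrite /alpha; lra.
have h3 := ler_wpM2l (powR_ge0 t (kappa * q / 2)) h1.
have : Cl * W * (Lam * enorm z `^ (- nps)) <= loss z.
  have -> : Cl * W * (Lam * enorm z `^ (- nps)) = Lam * Cl * (W * enorm z `^ (- nps)) by ring.
  apply: (ler_wpM2l (mulr_ge0 (ltW Lam0) (ltW Cl0))); rewrite /W mulrDl -mulrA.
  exact: lerD.
by move=> u1 u2; rewrite lerNl opprB; exact: le_trans u2 u1.
Qed.

Let gr_small : gr <= c / 4. Proof. exact: gap_radius_le. Qed.

Let G : set T := eball a (gr * t `^ (1 + th)).

Let tth : t `^ (1 + th) <= t.
Proof. by rewrite -{2}(powRr1 (ltW t0)) tle// lerDl. Qed.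

Let G_w z : G z -> enorm (z - a) <= gr * t `^ (1 + th) /\ 4 * enorm (z - a) <= t.
Proof.
move=> /ltW h; split => //.
have : gr * t `^ (1 + th) <= c / 4 * t by apply: ler_pM; rewrite ?powR_ge0 ?(ltW gr0).
have : c * t <= 1 * t by rewrite ler_wpM2r ?(ltW t0).
by move: h; rewrite /=; lra.
Qed.

Let G_sub : G `<=` annulus r d.
Proof.
move=> z /G_w[_ h].
have e : a + (z - a) = z by rewrite addrC subrK.
have h1 := enorm_triD a (z - a); have h2 := enormD a (z - a).
rewrite e -/t in h1 h2; rewrite /annulus /=.
have rr := r_t4; have t0' := t0; have td' := td.
by apply/andP; split; lra.
Qed.

Let g0 := cJ * ((L * (c / 4) * t `^ (gam + th)) `^ Q * (L * t `^ gam) `^ (p - 1 - Q)).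

(* The gap of phi beats the penalisation by L3, because gam + th is at most
   1 + kappa / 2. *)
Let gain_le z : G z ->
  g0 * (lam * (2 * t) `^ (- nps)) <= increment p K v xb z - increment p K v yb z.
Proof.
move=> Gz; have [w1 w2] := G_w Gz; set w := z - a in w1 w2.
have zE : z = a + w by rewrite /w addrC subrK.
have ww := enorm_ge0 w.
have zt : enorm z <= 2 * t.
  by have := enormD a w; rewrite -zE -/t; move: w2 ww t0; lra.
have zd : enorm z <= d by move: zt td t0; lra.
have zp : 0 < enorm z.
  by have := enorm_triD a w; rewrite -zE -/t; move: w2 ww t0; lra.
have z0 : z != 0 by rewrite -enorm_gt0.
have hgap := phi_gap gam01 th0 thg c01 pr a0 t4 w1; rewrite -/t in hgap.
have hx := increment_x xd yd maxb (ltW d0) zd; rewrite -/a -/t in hx.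
have hy := increment_y xd yd maxb (ltW d0) zd; rewrite -/a -/t in hy.
have e1 : a + z = 2 *: a + w by rewrite zE addrA -mulr2n scaler_nat.
have e2 : enorm (a - z) = enorm w by rewrite zE opprD addrA subrr add0r enormN.
rewrite e1 in hx; rewrite e2 in hy.
have hb := penalty_increment_le x0 xb z (ltW m0); rewrite -/X in hb.
have k2 : kappa / 2 <= 1 by case/andP: k01; lra.
have tk : t <= t `^ (kappa / 2) by rewrite -{1}(powRr1 (ltW t0)) tle.
have bL : penalty_increment m x0 xb z <= L * (c / 4) * t `^ (gam + th).
  apply: le_trans hb _.
  have s1' : 2 * X * enorm z + enorm z ^+ 2 <= 4 * (CX + 1) * (t * t `^ (kappa / 2)).
    have X0 : 0 <= X := enorm_ge0 _.
    have i1 : 2 * X * enorm z <= 2 * (CX * t `^ (kappa / 2)) * (2 * t).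
      by rewrite ler_pM ?mulr_ge0 ?enorm_ge0// ler_wpM2l.
    have i2 : enorm z ^+ 2 <= (2 * t) * (2 * t).
      by rewrite expr2 ler_pM ?enorm_ge0.
    have i3 : t * t <= t * t `^ (kappa / 2) by rewrite ler_wpM2l ?(ltW t0).
    lra.
  have s2 : t * t `^ (kappa / 2) <= t `^ (gam + th).
    by rewrite -{1}(powRr1 (ltW t0)) -powRD_pos// tle.
  have CX1 : 0 <= 4 * (CX + 1) by move: CX0; lra.
  have s3 : m * (4 * (CX + 1) * (t * t `^ (kappa / 2))) <= m * (4 * (CX + 1) * t `^ (gam + th)).
    by rewrite ler_wpM2l ?(ltW m0)// ler_wpM2l.
  have s4 := ler_wpM2l (ltW m0) s1'.
  have s5 : 0 <= (c * L - 16 * m * (CX + 1)) * t `^ (gam + th).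
    by rewrite mulr_ge0 ?powR_ge0// subr_ge0.
  by move: s3 s4 s5; lra.
pose A2 := L * (phi (enorm w) - phi t).
pose dl := L * (c / 4) * t `^ (gam + th).
have hT2 : T2 z <= A2 by exact: hy.
have hT1 : A2 + dl <= T1 z.
  have : L * (phi (enorm (2 *: a + w)) + phi (enorm w)) <= L * (2 * phi t - c / 2 * t `^ (gam + th)).
    by rewrite ler_wpM2l ?(ltW L0).
  by rewrite /A2 /dl /T1; move: hx bL; lra.
pose S := L * t `^ gam.
have S0 : 0 < S by rewrite mulr_gt0 ?powR_gt0.
have phib u : 0 <= u -> u <= t -> 0 <= phi u <= t `^ gam.
  move=> u0 ut; have u4 : 0 <= u <= 4.
    by rewrite u0/=; apply: le_trans ut (le_trans t1 _); rewrite ler1n.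
  apply/andP; split.
    by apply: le_trans (prf_ge pr u4); rewrite mulr_ge0 ?powR_ge0 ?(ltW c0).
  by apply: le_trans (prf_le pr u4) _; apply: powR_le_pos => //; exact: ltW.
have wt : enorm w <= t by move: w2 ww; lra.
have /andP[f1 f2] := phib _ ww wt; have /andP[f3 f4] := phib _ (ltW t0) (lexx t).
have A2S : `|A2| <= S.
  rewrite /A2 normrM gtr0_norm// ler_wpM2l ?(ltW L0)//.
  by rewrite ler_norml; apply/andP; split; lra.
have dl0 : 0 <= dl <= S.
  have tg : t `^ (gam + th) <= t `^ gam by rewrite tle// lerDl.
  have c4' : c / 4 <= 1 by move: c1; lra.
  rewrite !mulr_ge0 ?powR_ge0 ?(ltW L0) ?(ltW c0)//=.
  rewrite /dl /S -mulrA ler_wpM2l ?(ltW L0)//.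
  apply: le_trans tg; rewrite ler_piMl ?powR_ge0//.
have hJ := HcJ dl0 A2S S0; rewrite -/g0 in hJ.
have JJ : g0 <= J (T1 z) - J (T2 z).
  have j1 : J (A2 + dl) <= J (T1 z) by exact: J_homo.
  have j2 : J (T2 z) <= J A2 by exact: J_homo.
  by move: hJ; rewrite -/dl -/S -/g0; lra.
have g00 : 0 <= g0 by rewrite !mulr_ge0 ?powR_ge0 ?(ltW cJ0).
have -> : increment p K v xb z - increment p K v yb z = (J (T1 z) - J (T2 z)) * K z.
  by rewrite mulrBl.
have K1 : lam * (2 * t) `^ (- nps) <= K z.
  case: K_adm => _ _ _ /(_ z z0) /andP[h _]; apply: le_trans h.
  rewrite -powRN; apply: (ler_wpM2l (ltW lam0)); apply: powR_le_neg => //.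
  by rewrite oppr_le0; exact/ltW/nps_gt0.
by apply: ler_pM => //; rewrite mulr_ge0 ?powR_ge0 ?(ltW lam0).
Qed.

(** All terms but 2 + 2 F have the factor t^E, E being the order of the gain.
    On the left L^(p-1) has a fixed coefficient; on the right its coefficient is
    small with ce. *)
Lemma maximum_inequality :
  cJ * (c / 4) `^ Q * lam * 2 `^ (- nps) * cn * gr `^ n%:R * (L `^ (p - 1) * t `^ E) <=
  2 + 2 * (C0 * ((2 `^ (p - 2) + (c / 2) `^ (p - 2)) * ce `^ (p - p * s) *
    (L `^ (p - 1) * t `^ E))) +
  Lam * Cl * (I1 * ce `^ (Num.min beta1 0) + I2 * ce `^ (Num.min beta2 0)) * t `^ E + 2 * F.
Proof.
have iv := integrable_increment p1 s0 K_adm _ r0 (nrm_Lsp vN).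
have mK (bt : R) : measurable_fun setT (fun z : T => enorm (z : 'rV[R]_n) `^ bt).
  by apply/measurable_EFinP; apply: measurable_enorm_powR; exact: measurableT.
have mloss : measurable_fun setT (loss : T -> R).
  apply: measurable_funM; first exact: measurable_cst.
  apply: measurable_funD; last exact: mK.
  by apply: measurable_funM; [exact: measurable_cst|exact: mK].
have rd : r <= d by move: r_t4 td t0; lra.
pose Ls := Lam * Cl * (t `^ (kappa * q / 2) * (I1 * r `^ (Num.min beta1 0)) + I2 * r `^ (Num.min beta2 0)).
have hLs : (\int[mu]_(z in annulus r d) (loss z)%:E <= Ls%:E)%E.
  have mA : measurable (annulus r d : set T) by exact: measurable_annulus.
  have k0 (bt : R) (z : T) : annulus r d z -> (0 <= (enorm (z : 'rV[R]_n) `^ bt)%:E)%E.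
    by move=> _; rewrite lee_fin powR_ge0.
  have mE (bt : R) : measurable_fun (annulus r d : set T) (fun z : T => (enorm (z : 'rV[R]_n) `^ bt)%:E).
    exact: measurable_enorm_powR.
  have -> : (\int[mu]_(z in annulus r d) (loss z)%:E = \int[mu]_(z in annulus r d)
     ((Lam * Cl)%:E * ((t `^ (kappa * q / 2))%:E * (enorm (z : 'rV[R]_n) `^ (beta1 - n%:R))%:E +
        (enorm (z : 'rV[R]_n) `^ (beta2 - n%:R))%:E)))%E.
    by apply: eq_integral => z _.
  rewrite (ge0_integralZl_EFin mu mA); first last.
  - by rewrite mulr_ge0 ?(ltW Lam0) ?(ltW Cl0).
  - by apply: emeasurable_funD; [apply: measurable_funeM; exact: mE|exact: mE].
  - move=> z zA; apply: adde_ge0; last exact: k0.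
    by apply: mule_ge0; [rewrite lee_fin powR_ge0|exact: k0].
  rewrite (ge0_integralD mu mA); first last.
  - exact: mE.
  - by move=> z; exact: k0.
  - by apply: measurable_funeM; exact: mE.
  - by move=> z zA; apply: mule_ge0; [rewrite lee_fin powR_ge0|exact: k0].
  rewrite (ge0_integralZl_EFin mu mA (k0 _) (mE _) (powR_ge0 _ _)).
  rewrite [leRHS]EFinM; apply: lee_wpmul2l.
    by rewrite lee_fin mulr_ge0 ?(ltW Lam0) ?(ltW Cl0).
  rewrite EFinD; apply: leeD; last exact: HI2.
  by rewrite EFinM; apply: lee_wpmul2l; [rewrite lee_fin powR_ge0|exact: HI1].
have xb1 : enorm xb <= rho1 by move: xd d0; lra.
have yb1 : enorm yb <= rho1 by move: yd d0; lra.
have g0l : 0 <= g0 * (lam * (2 * t) `^ (- nps)).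
  by rewrite !mulr_ge0 ?powR_ge0 ?(ltW cJ0) ?(ltW lam0).
have grt : 0 <= gr * t `^ (1 + th) by rewrite mulr_ge0 ?powR_ge0 ?(ltW gr0).
have loss0 (z : T) : annulus r d z -> 0 <= loss z.
  by move=> _; rewrite mulr_ge0 ?addr_ge0 ?mulr_ge0 ?powR_ge0 ?(ltW Lam0) ?(ltW Cl0).
have := doubled_integral_le r0 rd (iv xb) (iv yb) (measurable_eball _ _) G_sub g0l
  (Hcn a grt) mloss loss0 hLs (HF xb1) (HF yb1) mid_le gain_le bound_x bound_y.
rewrite -powR_mulrn// (gain_value p s n%:R gam th Q cJ cn lam t0 L0 c0 gr0) -/N -/E => main.
apply: le_trans main _.
have tE (x : R) : E <= x -> t `^ x <= t `^ E by move=> h; exact: tle.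
have rE (bt : R) : r `^ bt = ce `^ bt * t `^ ((1 + th2) * bt).
  by rewrite /r powRM ?(ltW ce0) ?powR_ge0// powRrM.
have L1' : t `^ (kappa * q / 2) * (I1 * r `^ (Num.min beta1 0)) <= I1 * ce `^ (Num.min beta1 0) * t `^ E.
  rewrite rE [leLHS]mulrCA -[leRHS]mulrA ler_wpM2l ?(ltW I10)//.
  rewrite [leLHS]mulrCA ler_wpM2l ?powR_ge0//.
  by rewrite -powRD_pos//; exact: tE.
have L2' : I2 * r `^ (Num.min beta2 0) <= I2 * ce `^ (Num.min beta2 0) * t `^ E.
  rewrite rE -[leRHS]mulrA ler_wpM2l ?(ltW I20)// ler_wpM2l ?powR_ge0//.
  exact: tE.
have LsE : Ls <= Lam * Cl * (I1 * ce `^ (Num.min beta1 0) + I2 * ce `^ (Num.min beta2 0)) * t `^ E.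
  rewrite /Ls -[leRHS]mulrA ler_wpM2l ?mulr_ge0 ?(ltW Lam0) ?(ltW Cl0)//.
  by rewrite mulrDl; exact: lerD.
by rewrite /M; lra.
Qed.

End at_maximum.
End step.
End doubling_argument.

Lemma powR_invK (R : realType) (a x : R) : 0 < a -> 0 <= x -> (x `^ a^-1) `^ a = x.
Proof. by move=> a0 x0; rewrite -powRrM mulVf ?gt_eqF// powRr1. Qed.

Local Notation min1 p := (Num.min 1 (p - 1)).
Local Notation max1 p := (Num.max 1 (p - 1)).

(** Uniform interior estimates on balls of every radius below 2, so that an
    estimate can be used on a ball larger than that of the next one. *)
Definition holder_bound (R : realType) (n : nat) (p s lam Lam C0 kappa : R) : Prop :=
  forall rho : R, 0 < rho < 2 -> exists2 A, 0 < A &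
    forall K v : 'rV[R]_n -> R, admissible_kernel p s lam Lam K ->
      normalized p s C0 K v ->
      forall x y, enorm x < rho -> enorm y < rho ->
        v x - v y <= A * enorm (x - y) `^ kappa.

(** At the maximum the doubled function is positive and |v| <= 1, so that
    L phi(|xb - yb|) and m |xb - x0|^2 are at most 2; large L and m then bring yb
    close to xb and xb close to x0, which keeps both away from the boundary. *)
Lemma doubling_localizes (R : realType) (n : nat) (v : 'rV[R]_n -> R) (gam th c : R) (phi dphi : R -> R)
    (rho D m L : R) (x0 y0 : 'rV[R]_n) :
  0 < gam -> 0 < c -> profile gam th c phi dphi ->
  0 < rho -> 0 < D -> rho + D < 2 -> 0 < m -> m * D ^+ 2 = 12 -> 0 < L ->
  2 <= L * (c * (D / 16) `^ gam) ->
  (forall x, enorm x <= rho + D -> {for x, continuous v}) ->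
  (forall x, enorm x <= rho + D -> `|v x| <= 1) ->
  enorm x0 < rho -> enorm y0 < rho ->
  L * enorm (x0 - y0) `^ gam < v x0 - v y0 ->
  exists xb yb, [/\ enorm xb + D / 4 <= rho + D /\ enorm yb + D / 4 <= rho + D,
    xb - yb != 0, 4 * enorm (xb - yb) <= D / 4,
    enorm (xb - x0) <= D / 2 /\ m * enorm (xb - x0) ^+ 2 <= v xb - v yb &
    forall x y, enorm x <= rho + D -> enorm y <= rho + D ->
      doubling v phi L m x0 x y <= doubling v phi L m x0 xb yb].
Proof.
move=> gam0 c0 pr rho0 D0 rho12 m0 mD L0 L4 cont v1 hx0 hy0 bad.
have rr : rho <= rho + D by rewrite lerDl ltW.
have rho1_ge0 : 0 <= rho + D by rewrite addr_ge0// ltW.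
have [xb [yb [xb1 yb1 maxb]]] := doubling_max L m x0 rho1_ge0 cont (prf_cont pr).
exists xb, yb.
have dist4 (x y : 'rV[R]_n) : enorm x <= rho + D -> enorm y <= rho + D -> 0 <= enorm (x - y) <= 4.
  move=> h1 h2; rewrite enorm_ge0/=; apply: le_trans (enormB _ _) _.
  by move: rho12 h1 h2; clear; lra.
have hx0' : enorm x0 <= rho + D by apply: le_trans (ltW hx0) rr.
have hy0' : enorm y0 <= rho + D by apply: le_trans (ltW hy0) rr.
have pos : 0 < doubling v phi L m x0 xb yb.
  apply: lt_le_trans (maxb x0 y0 hx0' hy0').
  rewrite /doubling subrr (enorm0 R n) expr0n mulr0 subr0 subr_gt0.
  apply: le_lt_trans bad; rewrite ler_wpM2l ?(ltW L0)//.
  exact: (prf_le pr (dist4 _ _ hx0' hy0')).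
pose t := enorm (xb - yb); pose X := enorm (xb - x0).
have t04 : 0 <= t <= 4 by exact: dist4.
have phit : c * t `^ gam <= phi t by exact: (prf_ge pr).
have Lphi : L * (c * t `^ gam) <= L * phi t by rewrite ler_wpM2l ?(ltW L0).
have mX0 : 0 <= m * X ^+ 2 by rewrite mulr_ge0 ?(ltW m0)// exprn_ge0 ?enorm_ge0.
have ct0 : 0 <= L * (c * t `^ gam) by rewrite mulr_ge0 ?(ltW L0)// mulr_ge0 ?powR_ge0 ?(ltW c0).
have diff : L * phi t + m * X ^+ 2 < v xb - v yb.
  by move: pos; rewrite /doubling -/t -/X; clear; lra.
have diff2 : v xb - v yb <= 2.
  have := v1 _ xb1; have := v1 _ yb1; rewrite !ler_norml => /andP[h1 _] /andP[_ h2].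
  by move: h1 h2; clear; lra.
have a0 : xb - yb != 0.
  apply/eqP => e; move: diff; have -> : v xb = v yb by congr v; exact: subr0_eq.
  by move: mX0 ct0 Lphi; rewrite subrr; clear; lra.
have t_small : t < D / 16.
  rewrite ltNge; apply/negP => dt.
  have h : (D / 16) `^ gam <= t `^ gam.
    by apply: powR_le_pos; rewrite ?(ltW gam0)// divr_ge0// ltW.
  have h2 : L * (c * (D / 16) `^ gam) <= L * (c * t `^ gam).
    by rewrite ler_wpM2l ?(ltW L0)// ler_wpM2l ?(ltW c0).
  by move: L4 h2 Lphi diff diff2 mX0; clear; lra.
have mXd : m * X ^+ 2 <= v xb - v yb by move: diff Lphi ct0; clear; lra.
have X_small : X <= D / 2.
  have D20' : 0 <= D / 2 by rewrite divr_ge0// ltW.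
  rewrite -(@ler_pXn2r _ 2)// ?nnegrE ?enorm_ge0//.
  rewrite -(ler_pM2l m0); have -> : m * (D / 2) ^+ 2 = 3.
    by rewrite expr_div_n mulrA mD; clear; lra.
  by move: mXd diff2; clear; lra.
have xbx : enorm xb <= enorm x0 + X.
  by rewrite -{1}(subrK x0 xb) addrC enormD.
have ybx : enorm yb <= enorm xb + t.
  by rewrite -{1}(subKr xb yb) enormB.
split => //.
- split; first by move: xbx X_small hx0 D0; clear; lra.
  by move: ybx xbx X_small hx0 t_small D0; clear; lra.
- by move: t_small; rewrite -/t; clear; lra.
Qed.

(** L is chosen last, after the constants of all the estimates and after ce, which
    makes the near field at most half of the gain.  The conditions on E say that
    no loss is of larger order in t than the gain. *)
Lemma doubling_step (R : realType) (n : nat) (p s lam Lam C0 kappa gam th c beta1 beta2 : R)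
    (phi dphi : R -> R) (q := min1 p) (N := n%:R + max1 p)
    (E := gam * (p - 1) - p * s + th * N) (th2 := th * N / (p - p * s)) :
  (0 < n)%N -> 1 < p -> 0 < s -> s < 1 -> 0 < lam -> 0 < Lam -> 0 < C0 ->
  0 <= kappa <= 1 -> 0 < gam <= 1 -> 0 <= th -> th * gam = th ->
  gam + th <= 1 + kappa / 2 -> 0 < c <= 1 -> profile gam th c phi dphi ->
  beta1 != 0 -> beta1 <= q + kappa * (p - 1 - q) - p * s ->
  beta2 != 0 -> beta2 <= q + kappa * (p - 1 - q) - p * s + q ->
  E <= 0 -> E <= kappa * q / 2 + (1 + th2) * Num.min beta1 0 ->
  E <= (1 + th2) * Num.min beta2 0 ->
  holder_bound n p s lam Lam C0 kappa -> holder_bound n p s lam Lam C0 gam.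
Proof.
move=> n0 p1 s0 s1 lam0 Lam0 C00 k01 gam01 th0 thg gth c01 pr b1n b1 b2n b2 E0 E1 E2 Hk rho /andP[rho0 rho2].
have /andP[c0 c1] := c01; have /andP[gam0 gam1] := gam01.
have p0 : 0 < p - 1 by rewrite subr_gt0.
have ps0 : 0 < p - p * s := kernel_gap_gt0 p1 s1.
(* The maximum is sought in the ball of radius rho1, halfway from rho to 2. *)
pose D := (2 - rho) / 2; have D0 : 0 < D by rewrite divr_gt0// subr_gt0.
have D1 : D <= 1 by move: rho0; rewrite /D; clear; lra.
pose rho1 := rho + D.
have rho12 : rho1 < 2 by move: rho2; rewrite /rho1 /D; clear; lra.
have rho10 : 0 < rho1 < 2 by rewrite rho12 andbT addr_gt0.
pose d := D / 4; have d0 : 0 < d by rewrite divr_gt0.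
have d01 : 0 < d <= 1 by rewrite d0/= /d; move: D1; clear; lra.
have [A A0 HA] := Hk rho1 rho10.
have D20 : 0 < D ^+ 2 by rewrite exprn_gt0.
have [m m0 mD] : exists2 m, 0 < m & m * D ^+ 2 = 12.
  by exists (12 / D ^+ 2); [rewrite divr_gt0|rewrite divfK// gt_eqF].
pose CX := Num.sqrt (A / m).
have CX0 : 0 <= CX by exact: sqrtr_ge0.
have CX2 : m * CX ^+ 2 = A.
  rewrite /CX sqr_sqrtr; last exact: divr_ge0 (ltW A0) (ltW m0).
  by rewrite mulrC divfK// gt_eqF.
have [F F0 HF] := far_field n lam p1 s0 Lam0 rho12 d0.
have [cJ cJ0 HcJ] := J_add_ge p1.
have [cn cn0 Hcn] := lebesgue_eball_ge R n0.
have [Cl Cl0 HCl] := penalty_loss p1 k01 (ltW A0) m0 CX0.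
have [I1 I10 HI1] := integral_annulus_powR n b1n.
have [I2 I20 HI2] := integral_annulus_powR n b2n.
pose gr := gap_radius gam c.
have gr0 : 0 < gr by exact: gap_radius_gt0.
pose c2 := cJ * (c / 4) `^ max1 p * lam * 2 `^ (- (n%:R + p * s)) * cn * gr `^ n%:R.
have c20 : 0 < c2 by rewrite !mulr_gt0 ?powR_gt0// divr_gt0.
pose Cg : R := 2 `^ (p - 2) + (c / 2) `^ (p - 2).
have Cg0 : 0 < Cg by rewrite addr_gt0 ?powR_gt0// divr_gt0.
(* With ce <= ce0 the two near fields cost at most half of the gain. *)
pose ce0 := (c2 / (4 * C0 * Cg)) `^ (p - p * s)^-1.
have q40 : 0 < c2 / (4 * C0 * Cg) by rewrite divr_gt0// !mulr_gt0.
pose ce := Num.min (c / 4) ce0.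
have ce_gt0 : 0 < ce by rewrite lt_min divr_gt0//= powR_gt0.
have ce_c : ce <= c / 4 by rewrite ge_min lexx.
have ce_small : 2 * (C0 * (Cg * ce `^ (p - p * s))) <= c2 / 2.
  have : ce `^ (p - p * s) <= c2 / (4 * C0 * Cg).
    rewrite -(powR_invK ps0 (ltW q40)).
    by apply: powR_le_pos; rewrite ?(ltW ps0) ?(ltW ce_gt0)// ge_min lexx orbT.
  rewrite ler_pdivlMr ?mulr_gt0//.
  by move: (ce `^ _) => w; clear; lra.
pose Cs := Lam * Cl * (I1 * ce `^ (Num.min beta1 0) + I2 * ce `^ (Num.min beta2 0)).
have Cs0 : 0 < Cs by rewrite mulr_gt0 ?mulr_gt0// addr_gt0// mulr_gt0 ?powR_gt0.
pose P := 2 + 2 * F + Cs.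
have P0 : 0 < P by rewrite !addr_gt0// mulr_gt0.
have delta0 : 0 < D / 16 by rewrite divr_gt0.
pose l1 := 4 * m / c; pose l3 := 16 * m * (CX + 1) / c.
pose l4 := 2 / (c * (D / 16) `^ gam); pose l5 := (2 * P / c2 + 1) `^ (p - 1)^-1.
have l10 : 0 < l1 by rewrite divr_gt0// mulr_gt0.
have l30 : 0 < l3 by rewrite divr_gt0// !mulr_gt0// ltr_wpDl.
have l40 : 0 < l4 by rewrite divr_gt0// mulr_gt0// powR_gt0.
have P20 : 0 < 2 * P / c2 + 1 by rewrite addr_gt0// divr_gt0// mulr_gt0.
have l50 : 0 < l5 by rewrite powR_gt0.
have m20 : 0 < 2 * m by rewrite mulr_gt0.
have [L [L0 L1 L2 [L3 L4 L5]]] : exists L, [/\ 0 < L, 4 * m <= c * L, 2 * m <= L &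
    [/\ 16 * m * (CX + 1) <= c * L, 2 <= L * (c * (D / 16) `^ gam) &
        2 * P / c2 + 1 <= L `^ (p - 1)]].
  have e1 : 4 * m = c * l1 by rewrite /l1; field; rewrite gt_eqF.
  have e3 : 16 * m * (CX + 1) = c * l3 by rewrite /l3; field; rewrite gt_eqF.
  have e5 : 2 * P / c2 + 1 = l5 `^ (p - 1) by rewrite /l5 powR_invK ?(ltW P20).
  have e4 : 2 = l4 * (c * (D / 16) `^ gam) by rewrite /l4 divfK// gt_eqF// mulr_gt0// powR_gt0.
  move: (l1) (l3) (l4) (l5) l10 l30 l40 l50 e1 e3 e4 e5 => k1 k3 k4 k5 k10 k30 k40 k50 e1 e3 e4 e5.
  exists (k1 + 2 * m + k3 + k4 + k5).
  rewrite e1 e3 e5 !ler_pM2l//; split.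
  - by move: k10 m20 k30 k40 k50; clear; lra.
  - by move: k10 m20 k30 k40 k50; clear; lra.
  - by move: k10 m20 k30 k40 k50; clear; lra.
  - split.
    + by move: k10 m20 k30 k40 k50; clear; lra.
    + rewrite {1}e4 ler_wpM2r ?mulr_ge0 ?powR_ge0 ?(ltW c0)//.
      by move: k10 m20 k30 k40 k50; clear; lra.
    + apply: powR_le_pos; rewrite ?(ltW p0) ?(ltW k50)//.
      by move: k10 m20 k30 k40 k50; clear; lra.
exists L => // K v K_adm vN x0 y0 hx0 hy0.
rewrite leNgt; apply/negP => bad.
have cont x : enorm x <= rho1 -> {for x, continuous v}.
  by move=> h; apply: (nrm_cont vN); apply/eball0P; exact: le_lt_trans rho12.
have v1 x : enorm x <= rho1 -> `|v x| <= 1.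
  by move=> h; apply: (nrm_le1 vN); apply/eball0P; exact: le_lt_trans rho12.
have [xb [yb [[xd yd] a0 td [X_small mX] maxb]]] := doubling_localizes gam0 c0 pr rho0 D0 rho12
  m0 mD L0 L4 cont v1 hx0 hy0 bad.
pose t := enorm (xb - yb); pose X := enorm (xb - x0).
have X1 : X <= 1 by move: X_small D1; rewrite -/X; clear; lra.
have hA x y : enorm x < rho1 -> enorm y < rho1 -> v x - v y <= A * enorm (x - y) `^ kappa.
  exact: (HA K v K_adm vN).
have xlt : enorm xb < rho1 by move: xd d0; rewrite /rho1 /d; clear; lra.
have ylt : enorm yb < rho1 by move: yd d0; rewrite /rho1 /d; clear; lra.
have XC : X <= CX * t `^ (kappa / 2).
  rewrite -(@ler_pXn2r _ 2)// ?nnegrE ?enorm_ge0 ?mulr_ge0 ?powR_ge0//.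
  rewrite -(ler_pM2l m0) exprMn [leRHS]mulrA CX2.
  have -> : (t `^ (kappa / 2)) ^+ 2 = t `^ kappa.
    by rewrite -powR_mulrn ?powR_ge0// -powRrM; congr (_ `^ _); clear; lra.
  exact: le_trans mX (hA _ _ xlt ylt).
have vA z : enorm z < d -> `|v yb - v (yb + z)| <= A * enorm z `^ kappa.
  move=> zd; have zlt : enorm (yb + z) < rho1.
    by have := enormD yb z; move: yd zd; rewrite /rho1 /d; clear; lra.
  have h1 := hA _ _ ylt zlt; have h2 := hA _ _ zlt ylt.
  rewrite (_ : yb - (yb + z) = - z) ?enormN in h1; last by rewrite opprD addrA subrr add0r.
  rewrite (_ : yb + z - yb = z) in h2; last by rewrite addrAC subrr add0r.
  by move: h1 h2; rewrite ler_norml; clear => h1 h2; apply/andP; split; lra.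
have := maximum_inequality p1 s0 s1 lam0 Lam0 C00 k01 gam01 th0 thg gth c01 pr b1 b2
  E1 E2 K_adm vN d01 xd yd rho12 maxb a0 td X1 XC CX0 m0 L0 L1 L2 L3 ce_gt0 ce_c vA
  I10 I20 cJ0 HcJ Hcn Cl0 HCl HI1 HI2 (fun x hx => HF C0 K v x K_adm vN hx).
rewrite -/gr -/c2 -/Cg -/Cs -/t.
rewrite -/q -/N -/E; set tE := t `^ E.
have t0 : 0 < t by rewrite /t enorm_gt0.
have tE1 : 1 <= tE.
  rewrite -(powRr0 t); apply: ger_powR => //; rewrite t0/=.
  by move: td D1; rewrite -/t; clear; lra.
move: (L `^ (p - 1)) L5 => W hW main.
have k1 : (2 * P / c2 + 1) * tE <= W * tE by rewrite ler_wpM2r// (le_trans ler01).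
have k2 : c2 * ((2 * P / c2 + 1) * tE) <= c2 * (W * tE) by rewrite ler_pM2l.
have k3 : c2 * ((2 * P / c2 + 1) * tE) = 2 * (P * tE) + c2 * tE.
  by field; rewrite gt_eqF.
have k4 : 2 * (C0 * (Cg * ce `^ (p - p * s))) * (W * tE) <= c2 / 2 * (W * tE).
  apply: ler_wpM2r => //; apply: mulr_ge0; last exact: le_trans ler01 tE1.
  exact: le_trans (ltW P20) hW.
have k5 : (2 + 2 * F) * 1 <= (2 + 2 * F) * tE.
  by rewrite ler_wpM2l// addr_ge0// mulr_ge0// ltW.
have k6 : 0 < c2 * tE by rewrite mulr_gt0// (lt_le_trans ltr01).
have k7 : P * tE = (2 + 2 * F) * tE + Cs * tE by rewrite /P mulrDl.
have k8 : 2 * (C0 * (Cg * ce `^ (p - p * s) * (W * tE))) =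
  2 * (C0 * (Cg * ce `^ (p - p * s))) * (W * tE) by ring.
move: main k1 k2 k3 k4 k5 k6 k7; rewrite k8; clear; lra.
Qed.

(** * From a bounded solution to the optimal exponent *)

Lemma min1_gt0 (R : realType) (p : R) : 1 < p -> 0 < min1 p.
Proof. by move=> p1; rewrite lt_min ltr01 subr_gt0. Qed.

Lemma holder_bound0 (R : realType) (n : nat) (p s lam Lam C0 : R) :
  holder_bound n p s lam Lam C0 0.
Proof.
move=> rho /andP[_ rho2]; exists 2 => // K v _ vN x y hx hy; rewrite powRr0 mulr1.
have bd z : enorm z < rho -> `|v z| <= 1.
  by move=> hz; apply: (nrm_le1 vN); apply/eball0P; exact: lt_trans rho2.
move: (bd x hx) (bd y hy); rewrite !ler_norml; clear => /andP[h1 h2] /andP[h3 h4].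
by move: h2 h3; clear; lra.
Qed.

(** The loss near z = 0 is of order |z|^(kappa (p-1) + q (1-kappa) - ps) t^(kappa q/2);
    comparing with t^E shows that gam may exceed kappa by q / (2 (p-1)).  At the
    critical exponent E = 0 the loss is compared with |z|^(beta1 - n) for
    beta1 = - kappa q / 2, which must not be 0, hence kappa > 0. *)
Lemma holder_bound_improve (R : realType) (n : nat) (p s lam Lam C0 gam kappa : R) :
  (0 < n)%N -> 1 < p -> 0 < s -> s < 1 -> 0 < lam -> 0 < Lam -> 0 < C0 ->
  0 < gam < 1 -> 0 <= kappa <= gam -> (gam - kappa) * (p - 1) <= min1 p / 2 ->
  gam * (p - 1) <= p * s -> 0 < kappa \/ gam * (p - 1) < p * s ->
  holder_bound n p s lam Lam C0 kappa -> holder_bound n p s lam Lam C0 gam.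
Proof.
move=> n0 p1 s0 s1 lam0 Lam0 C00 gam01 /andP[k0 kg] hk Ele Ealt Hk.
have /andP[g0 g1] := gam01.
have [c c01 pr] := profile_power gam01.
have q0 := min1_gt0 p1.
set q := min1 p in hk q0 *.
pose E := gam * (p - 1) - p * s.
pose beta1 := E - kappa * q / 2.
have kq0 : 0 <= kappa * q by rewrite mulr_ge0// ltW.
have kq1 : kappa * q <= q by rewrite ler_piMl ?(ltW q0)// (le_trans kg (ltW g1)).
have b1 : beta1 < 0.
  rewrite /beta1 /E; case: Ealt => h.
    have : 0 < kappa * q by rewrite mulr_gt0.
    by move: Ele; clear; lra.
  by move: kq0 h; clear; lra.
have b1a : beta1 <= q + kappa * (p - 1 - q) - p * s.
  by rewrite /beta1 /E; move: hk kq1 q0; clear; lra.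
have [beta2 [b2n b2 Eb2]] : exists beta2, [/\ beta2 != 0,
    beta2 <= q + kappa * (p - 1 - q) - p * s + q & E <= Num.min beta2 0].
  have : E <= 0 by rewrite /E subr_le0.
  rewrite le_eqVlt => /orP[/eqP E0|E0].
    have a0 : 0 < q + kappa * (p - 1 - q) - p * s + q.
      by move: b1a; rewrite /beta1 E0; move: kq1 q0; clear; lra.
    exists (q + kappa * (p - 1 - q) - p * s + q); split; rewrite ?lt0r_neq0//.
    by rewrite E0 le_min lexx ltW.
  exists E; split; rewrite ?(ltr0_neq0 E0)//.
    by move: b1a; rewrite /beta1; move: kq1 q0; clear; lra.
  by rewrite le_min lexx ltW.
apply: (doubling_step (kappa := kappa) (th := 0) (c := c) (beta1 := beta1) (beta2 := beta2)
  n0 p1 s0 s1 lam0 Lam0 C00 _ _ _ _ _ c01 pr) => //.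
- by rewrite k0 (le_trans kg (ltW g1)).
- by rewrite g0 ltW.
- by rewrite mul0r.
- by move: g1 k0; clear; lra.
- exact: ltr0_neq0.
- by rewrite mul0r addr0 subr_le0.
- rewrite !mul0r !addr0 mul1r (min_idPl (ltW b1)) -/q /beta1 /E.
  by clear; lra.
- by rewrite !mul0r !addr0 mul1r.
Qed.

Lemma holder_bound_lt (R : realType) (n : nat) (p s lam Lam C0 gam : R) :
  (0 < n)%N -> 1 < p -> 0 < s -> s < 1 -> 0 < lam -> 0 < Lam -> 0 < C0 ->
  0 < gam < 1 -> gam * (p - 1) < p * s -> holder_bound n p s lam Lam C0 gam.
Proof.
move=> n0 p1 s0 s1 lam0 Lam0 C00.
have p0 : 0 < p - 1 by rewrite subr_gt0.
pose h := min1 p / 2 / (p - 1).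
have h0 : 0 < h by rewrite !divr_gt0// min1_gt0.
have hp : h * (p - 1) = min1 p / 2 by rewrite /h divfK// gt_eqF.
suff H k : forall gam, 0 < gam < 1 -> gam * (p - 1) < p * s -> gam <= k%:R * h ->
    holder_bound n p s lam Lam C0 gam.
  move=> gam01 gp; apply: (H (Num.bound (gam / h))) => //.
  rewrite -ler_pdivrMr//; apply/ltW/archi_boundP.
  by case/andP: gam01 => g0 _; rewrite divr_ge0// ltW.
elim: k => [|k IH] {}gam /andP[g0 g1] gp.
  by rewrite mul0r leNgt g0.
rewrite -natr1 mulrDl mul1r -lerBlDr => gk.
have [gh|hg] := leP gam h.
  apply: (@holder_bound_improve R n p s lam Lam C0 gam 0) => //.
  - by rewrite g0.
  - by rewrite lexx ltW.
  - by rewrite subr0 -hp ler_wpM2r// ltW.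
  - exact: ltW.
  - by right.
  - exact: holder_bound0.
apply: (@holder_bound_improve R n p s lam Lam C0 gam (gam - h)) => //.
- by rewrite g0.
- by rewrite subr_ge0 (ltW hg) lerBlDr lerDl ltW.
- by rewrite subKr -hp.
- exact: ltW.
- by right.
- apply: IH => //.
  + by rewrite subr_gt0 hg ltrBlDr; apply: lt_trans g1 _; rewrite ltrDl.
  + by apply: le_lt_trans gp; rewrite ler_wpM2r ?(ltW p0)// lerBlDr lerDl ltW.
Qed.

(** A positive kappa within one step of gam is subcritical, so that the previous
    lemma provides it. *)
Lemma holder_bound_critical (R : realType) (n : nat) (p s lam Lam C0 gam : R) :
  (0 < n)%N -> 1 < p -> 0 < s -> s < 1 -> 0 < lam -> 0 < Lam -> 0 < C0 ->
  0 < gam < 1 -> gam * (p - 1) = p * s -> holder_bound n p s lam Lam C0 gam.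
Proof.
move=> n0 p1 s0 s1 lam0 Lam0 C00 /andP[g0 g1] gp.
have p0 : 0 < p - 1 by rewrite subr_gt0.
pose h := min1 p / 2 / (p - 1).
have h0 : 0 < h by rewrite !divr_gt0// min1_gt0.
have hp : h * (p - 1) = min1 p / 2 by rewrite /h divfK// gt_eqF.
pose kappa := Num.max (gam / 2) (gam - h).
have k0 : 0 < kappa by rewrite lt_max divr_gt0.
have kg : kappa < gam.
  by rewrite gt_max (ltrBlDr gam) ltrDl h0 andbT; move: g0; clear; lra.
have kh : gam - kappa <= h.
  by rewrite lerBlDr -lerBlDl le_max lexx orbT.
apply: (@holder_bound_improve R n p s lam Lam C0 gam kappa) => //.
- by rewrite g0.
- by rewrite !ltW.
- by rewrite -hp ler_wpM2r// ltW.
- by rewrite gp.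
- by left.
- apply: holder_bound_lt => //; first by rewrite k0 (lt_trans kg).
  by rewrite -gp ltr_pM2r.
Qed.

(** Above the threshold the gain is of strictly negative order already for the
    exponent 1, and this room pays for the correction t^(1 + th) of the profile
    and for starting from kappa < 1. *)
Lemma holder_bound_lipschitz (R : realType) (n : nat) (p s lam Lam C0 : R) :
  (0 < n)%N -> 1 < p -> 0 < s -> s < 1 -> 0 < lam -> 0 < Lam -> 0 < C0 ->
  p - 1 < p * s -> holder_bound n p s lam Lam C0 1.
Proof.
move=> n0 p1 s0 s1 lam0 Lam0 C00 ps.
have p0 : 0 < p - 1 by rewrite subr_gt0.
have G0 : 0 < p - p * s := kernel_gap_gt0 p1 s1.
have q0 := min1_gt0 p1.
have q1 : min1 p <= 1 by rewrite ge_min lexx.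
have qp : min1 p <= p - 1 by rewrite ge_min lexx orbT.
have N0 : 0 < n%:R + max1 p by rewrite ltr_wpDr// ?ltr0n// le_max ler01.
pose q := min1 p; pose N := n%:R + max1 p; pose G := p - p * s.
pose d := p * s - (p - 1); have d0 : 0 < d by rewrite subr_gt0.
(* w bounds th2: the first entry is what the condition on beta1 allows, the
   second keeps th N below d / 2. *)
pose w := Num.min (q / 8) (d / (2 * G)).
have w0 : 0 < w by rewrite lt_min !divr_gt0// mulr_gt0.
pose th := Num.min (1 / 4) (w * G / N).
have th0 : 0 < th by rewrite lt_min !divr_gt0// mulr_gt0.
have th1 : th <= 1 / 4 by rewrite ge_min lexx.
have thN : th * N <= w * G by rewrite -ler_pdivlMr// ge_min lexx orbT.
pose th2 := th * N / G.
have th20 : 0 <= th2 by rewrite divr_ge0 ?(ltW G0)// mulr_ge0 ?(ltW th0)// ltW.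
have th2w : th2 <= w by rewrite ler_pdivrMr.
have th2q : th2 <= q / 8 by apply: le_trans th2w _; rewrite ge_min lexx.
have thd : th * N <= d / 2.
  apply: le_trans thN _; have : w <= d / (2 * G) by rewrite ge_min lexx orbT.
  by rewrite ler_pdivlMr ?mulr_gt0//; clear; lra.
have thG : th * N = th2 * G by rewrite /th2 divfK// gt_eqF.
pose eta := q / (8 * p).
have p00 : 0 < p by exact: lt_trans ltr01 p1.
have eta0 : 0 < eta by rewrite divr_gt0// mulr_gt0.
have etap : 8 * (eta * p) = q by rewrite /eta; field; rewrite gt_eqF.
have eta8 : eta <= 1 / 8.
  have : eta * 1 <= eta * p by rewrite ler_pM2l// ltW.
  by rewrite mulr1; move: q1 etap; rewrite -/q; clear; lra.
pose kappa := 1 - eta.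
have k1 : kappa < 1 by rewrite /kappa ltrBlDr ltrDl.
have k78 : 7 / 8 <= kappa by rewrite /kappa; move: eta8; clear; lra.
have k0 : 0 < kappa by move: k78; clear; lra.
pose E := 1 * (p - 1) - p * s + th * N.
have E0 : E < 0 by rewrite /E; move: thd d0; rewrite /d; clear; lra.
have eq0 : 0 <= eta * q by rewrite mulr_ge0 ?(ltW eta0)// ltW.
have kq0 : 0 < kappa * q by rewrite mulr_gt0.
have t21 : 0 < 1 + th2 by rewrite ltr_wpDr.
pose alpha := q + kappa * (p - 1 - q) - p * s.
have key : E - kappa * q / 2 <= (1 + th2) * alpha.
  have ep0 : 0 <= eta * (p - 1 - q) by rewrite mulr_ge0 ?(ltW eta0)// subr_ge0.
  have z1 : th2 * (eta * (p - 1 - q)) <= 1 * (eta * (p - 1 - q)).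
    by rewrite ler_wpM2r//; move: th2q q1; rewrite -/q; clear; lra.
  have aE : alpha = - d - eta * (p - 1 - q) by rewrite /alpha /kappa /d; ring.
  have GE : G = 1 - d by rewrite /G /d; ring.
  rewrite aE /E thG GE; move: q0 (etap) z1 th2q eta0 eq0.
  rewrite -/q /d /kappa; clear; lra.
have th01 : 0 < th <= 1 by rewrite th0; move: th1; clear; lra.
have [c c01 pr] := profile_lipschitz th01.
(* beta1 and beta2 turn the last two conditions into equalities. *)
have b1 : (E - kappa * q / 2) / (1 + th2) < 0.
  by rewrite ltr_pdivrMr// mul0r; move: E0 kq0; clear; lra.
have b2 : E / (1 + th2) < 0 by rewrite ltr_pdivrMr// mul0r.
apply: (doubling_step (kappa := kappa) (th := th) (c := c)
  (beta1 := (E - kappa * q / 2) / (1 + th2)) (beta2 := E / (1 + th2))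
  n0 p1 s0 s1 lam0 Lam0 C00 _ _ _ _ _ c01 pr) => //.
- by rewrite !ltW.
- by rewrite ltr01 lexx.
- exact: ltW.
- by rewrite mulr1.
- by move: th1 k78; clear; lra.
- exact: ltr0_neq0.
- by rewrite ler_pdivrMr// [leRHS]mulrC.
- exact: ltr0_neq0.
- rewrite ler_pdivrMr// [leRHS]mulrC -/q -/alpha.
  have z : 0 <= th2 * q by rewrite mulr_ge0// ltW.
  have kq1 : kappa * q <= 1 * q by rewrite ler_pM2r// ltW.
  by move: q0 key z kq1; rewrite -/q; clear; lra.
- exact: ltW.
- rewrite (min_idPl (ltW b1)) -/N -/G -/th2 mulrCA divff ?gt_eqF// -/q -/E.
  by clear; lra.
- by rewrite (min_idPl (ltW b2)) -/N -/G -/th2 mulrCA divff ?gt_eqF// mulr1.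
- by apply: holder_bound_lt => //; [rewrite k0|apply: lt_trans ps; rewrite gtr_pMl].
Qed.

(** * Scaling and conclusion *)

Section scaling.
Variables (R : realType) (n : nat) (p s lam Lam : R).
Hypotheses (p1 : 1 < p) (s0 : 0 < s) (s1 : s < 1) (Lam0 : 0 < Lam).
Implicit Types (x y z g : 'rV[R]_n) (u v K : 'rV[R]_n -> R).

Local Notation mu := (@lebesgue_rV R n).
Local Notation T := (lebesgue_rV_type R n).
Local Notation nps := (n%:R + p * s).

Lemma LspZ (a : R) u : Lsp p s u -> Lsp p s (fun x => a * u x).
Proof.
move=> [mu_ loc fin].
have np z : `|a * u z| `^ (p - 1) = `|a| `^ (p - 1) * `|u z| `^ (p - 1).
  by rewrite normrM powRM.
have mf : measurable_fun setT (fun z : T => (`|u z| `^ (p - 1))%:E).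
  by apply/measurable_EFinP; exact: measurable_normp.
split.
- exact: measurable_funM (measurable_cst _) mu_.
- move=> A cA.
  have mA : measurable (A : set T).
    rewrite -(setCK A); apply: measurableC; apply: measurable_open.
    by apply: closed_openC; apply: compact_closed => //; exact: Rhausdorff.
  have -> : (\int[mu]_(z in A) (`|a * u z| `^ (p - 1))%:E =
      \int[mu]_(z in A) ((`|a| `^ (p - 1))%:E * (`|u z| `^ (p - 1))%:E))%E.
    by apply: eq_integral => z _; rewrite np EFinM.
  rewrite (ge0_integralZl_EFin mu mA).
  + by apply: lte_mul_pinfty; rewrite ?lee_fin ?powR_ge0// loc.
  + by move=> z _; rewrite lee_fin powR_ge0.
  + exact: measurable_funS mf.
  + exact: powR_ge0.
- have -> : (\int[mu]_z (`|a * u z| `^ (p - 1) / (1 + enorm z) `^ (n%:R + s * p))%:E =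
      \int[mu]_z ((`|a| `^ (p - 1))%:E *
        (`|u z| `^ (p - 1) / (1 + enorm (z : 'rV[R]_n)) `^ (n%:R + s * p))%R%:E))%E.
    by apply: eq_integral => z _; rewrite np -EFinM mulrA.
  rewrite (ge0_integralZl_EFin mu measurableT).
  + by apply: lte_mul_pinfty; rewrite ?lee_fin ?powR_ge0// fin.
  + by move=> z _; rewrite lee_fin divr_ge0// powR_ge0.
  + exact: measurable_tail_density.
  + exact: powR_ge0.
Qed.

(** The operator and |g|^(p-2) H are homogeneous of degree p - 1 in the function,
    and C is absorbed by M^(p-1). *)
Lemma paraboloid_sub_scale : exists2 C0, 0 < C0 & forall K C (M : R) u v,
  admissible_kernel p s lam Lam K -> 0 < M -> C <= M `^ (p - 1) ->
  Lsp p s v -> (forall x, u x = M * v x) ->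
  viscosity_sub p s K (fun=> C) (eball 0 2) u -> paraboloid_sub p s C0 K v.
Proof.
have [C0 C00 HC0] := @viscosity_paraboloid R n p s lam Lam p1 s0 s1 Lam0.
exists C0 => // K C M u v K_adm M0 CM vL uv visc x g H r r0 H0 gH sub touch.
have uL : Lsp p s u by rewrite (_ : u = fun x => M * v x); [exact: LspZ|exact/funext].
have Mg : enorm (M *: g) = M * enorm g by rewrite enormZ gtr0_norm.
have W0 : 0 < M `^ (p - 1) by rewrite powR_gt0.
have h := HC0 K _ C u x (M *: g) (M * H) r K_adm uL visc r0 (mulr_gt0 M0 H0) _ sub _.
have {h} := h _ _; rewrite Mg => h.
have {h} : \int[mu]_(z in ~` eball 0 r) increment p K u x z <=
    C + C0 * ((M * enorm g) `^ (p - 2) * (M * H) * r `^ (p - p * s)).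
  apply: h => [|z hz].
    by rewrite [leLHS](_ : _ = M * (2 * H * r)); [rewrite ler_pM2l|ring].
  rewrite !uv dotZl -!mulrA -!mulrDr ler_pM2l//; exact: touch.
have -> : \int[mu]_(z in ~` eball 0 r) increment p K u x z =
    M `^ (p - 1) * \int[mu]_(z in ~` eball 0 r) increment p K v x z.
  rewrite -(RintegralZl _ (measurable_eballC _ _)).
    apply: eq_Rintegral => z _.
    by rewrite /increment !uv -mulrBr JZ ?(ltW M0)// mulrA.
  exact: (integrable_increment p1 s0 K_adm x r0 vL).
have -> : C0 * ((M * enorm g) `^ (p - 2) * (M * H) * r `^ (p - p * s)) =
    M `^ (p - 1) * (C0 * (enorm g `^ (p - 2) * H * r `^ (p - p * s))).
  have -> : M `^ (p - 1) = M `^ (p - 2) * M.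
    rewrite -{3}(powRr1 (ltW M0)) -powRD; first by congr (_ `^ _); ring.
    by rewrite (gt_eqF M0) implybT.
  by rewrite powRM ?enorm_ge0 ?(ltW M0)//; ring.
by move=> h; rewrite -(ler_pM2l W0) mulrDr mulr1; apply: le_trans h _; rewrite lerD2r.
Qed.

(** The factor 2^(sp) in the tail is at least 1 and can be dropped. *)
Lemma Tail_fin u : Lsp p s u -> exists2 t : R, 0 <= t & Tail p s u 0 2 = t%:E /\
  (\int[mu]_(z in ~` eball 0 2) (`|u z| `^ (p - 1) * enorm (z : 'rV[R]_n) `^ (- nps))%:E <=
    (t `^ (p - 1))%:E)%E.
Proof.
move=> uL; have mu_ : lebesgue_measurable u by case: uL.
have p0 : 0 < p - 1 by rewrite subr_gt0.
set I := (\int[mu]_(z in _) _)%E.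
have I_fin : (I < +oo)%E.
  have -> : I = (\int[mu]_(z in ~` eball 0 2)
      (`|u (0 + z)| `^ (p - 1) * enorm (z : 'rV[R]_n) `^ (- nps))%:E)%E.
    by apply: eq_integral => z _; rewrite add0r.
  exact: (shifted_tail_fin p1 s0 0 (ltr0n R 2) uL).
have I0 : (0 <= I)%E.
  by apply: integral_ge0 => z _; rewrite lee_fin mulr_ge0 ?powR_ge0.
have [i iE] : exists i, I = i%:E.
  by exists (fine I); rewrite fineK// ge0_fin_numE.
have i0 : 0 <= i by rewrite -lee_fin -iE.
have sp1 : 1 <= 2 `^ (s * p).
  apply: powR_ge1 => //; last by rewrite ler1n.
  by rewrite mulr_ge0 ?(ltW s0)// (le_trans ler01 (ltW p1)).
have Si0 : 0 <= 2 `^ (s * p) * i by rewrite mulr_ge0// powR_ge0.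
exists ((2 `^ (s * p) * i) `^ (p - 1)^-1); first exact: powR_ge0.
split.
  rewrite /Tail; set I' := (\int[mu]_(z in _) _)%E.
  have -> : I' = i%:E.
    rewrite -iE; apply: eq_integral => z _.
    by rewrite subr0 powRN [in s * p]mulrC.
  by rewrite -EFinM poweR_EFin.
rewrite iE lee_fin powR_invK//.
by rewrite ler_peMl.
Qed.

End scaling.

Lemma sup_norm_fin (R : realType) (n : nat) (u : 'rV[R]_n -> R) :
  {within closure (eball 0 2 : set 'rV[R]_n), continuous u} ->
  exists2 S : R, 0 <= S & sup_norm (eball 0 2) u = S%:E /\
    forall x, eball 0 2 x -> `|u x| <= S.
Proof.
move=> cont.
have sub : closure (eball 0 2 : set 'rV[R]_n) `<=` cball 0 2.
  rewrite [X in _ `<=` X]((closure_id _).1 (@closed_cball R n 0 2)).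
  by apply: closure_subset => x; rewrite /eball/cball /= => /ltW.
have cB : compact (closure (eball 0 2 : set 'rV[R]_n)).
  exact: (@subclosed_compact _ _ (cball 0 2) (@closed_closure _ _) (@compact_cball R n 0 2) sub).
have [M [_ HM]] := compact_bounded (continuous_compact cont cB).
have bd x : eball 0 2 x -> `|u x| <= `|M| + 1.
  move=> x2; apply: (HM (`|M| + 1)).
    by apply: le_lt_trans (ler_norm _) _; rewrite ltrDl.
  by exists x => //; exact: subset_closure.
have le_sup x : eball 0 2 x -> (`|u x|%:E <= sup_norm (eball 0 2) u)%E.
  by move=> x2; apply: ereal_sup_ubound; exists x.
have z2 : eball 0 2 (0 : 'rV[R]_n) by apply/eball0P; rewrite enorm0.
have sup_le : (sup_norm (eball 0 2) u <= (`|M| + 1)%:E)%E.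
  by apply: ge_ereal_sup => _ [x x2 <-]; rewrite lee_fin bd.
have sup0 : (0 <= sup_norm (eball 0 2) u)%E.
  by apply: le_trans (le_sup _ z2); rewrite lee_fin.
have supE : sup_norm (eball 0 2) u = (fine (sup_norm (eball 0 2) u))%:E.
  by rewrite fineK// ge0_fin_numE// (le_lt_trans sup_le)// ltry.
exists (fine (sup_norm (eball 0 2) u)); first by rewrite -lee_fin -supE.
by split => // x x2; rewrite -lee_fin -supE; exact: le_sup.
Qed.

Theorem theorem2p1 (R : realType) (n : nat) (p s lam Lam : R)
  (n_ge1 : (1 <= n)%N) (p_gt1 : 1 < p) (s_gt0 : 0 < s) (s_lt1 : s < 1)
  (lam_gt0 : 0 < lam) (le_lam_Lam : lam <= Lam) :
  let gamma0 := Num.min 1 (s * p / (p - 1)) in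
  let B1 : set 'rV[R]_n := eball 0 1 in
  let B2 : set 'rV[R]_n := eball 0 2 in
  let solution (K : 'rV[R]_n -> R) (C : R) (u : 'rV[R]_n -> R) :=
    [/\ {within closure B2, continuous u}, Lsp p s u,
        viscosity_sub p s K (fun=> C) B2 u &
        viscosity_super p s K (fun=> - C) B2 u] in
  let estimate (gam C1 : R) :=
    forall (K : 'rV[R]_n -> R) (C : R) (u : 'rV[R]_n -> R),
      admissible_kernel p s lam Lam K -> 0 <= C -> solution K C u ->
      holder gam B1 u /\
      (holder_norm gam B1 u <=
        C1%:E * (sup_norm B2 u + Tail p s u 0%R 2%R + (C `^ (p - 1)^-1)%:E))%E in
  (forall gam, 0 < gam < gamma0 -> exists C1, estimate gam C1) /\
  (s * p / (p - 1) != 1 -> exists C2, estimate gamma0 C2).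
Proof.
move=> gamma0 B1 B2 solution estimate.
have Lam_gt0 : 0 < Lam by exact: lt_le_trans le_lam_Lam.
have p0 : 0 < p - 1 by rewrite subr_gt0.
have [C0 C00 HC0] := @paraboloid_sub_scale R n p s lam Lam p_gt1 s_gt0 s_lt1 Lam_gt0.
(* C0 depends on n, p, s, lam and Lam only, and so does the constant for gam. *)
have est gam : holder_bound n p s lam Lam C0 gam -> exists C1, estimate gam C1.
  move=> Hg; have [A A0 HA] := Hg 1 (introT andP (conj ltr01 (ltr1n R 2))).
  exists (A + 1) => K C u K_adm C_ge0 [cont uL usub usuper].
  have [S S0 [SE uS]] := sup_norm_fin cont.
  have [t t0 [tE tI]] := Tail_fin p_gt1 s_gt0 uL.
  pose Cp := C `^ (p - 1)^-1; have Cp0 : 0 <= Cp by exact: powR_ge0.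
  pose M := S + t + Cp.
  have M0 : 0 <= M by rewrite !addr_ge0.
  have SM : S <= M by rewrite /M; move: t0 Cp0; clear; lra.
  have tM : t <= M by rewrite /M; move: S0 Cp0; clear; lra.
  have CM : C <= M `^ (p - 1).
    rewrite -[leLHS](powR_invK p0 C_ge0) powR_le_pos ?(ltW p0)//.
    by rewrite -/Cp /M; move: S0 t0; clear; lra.
  have B12 (x : 'rV[R]_n) : enorm x < 1 -> eball 0 2 x.
    by move=> x1; apply/eball0P; apply: lt_trans x1 _; rewrite ltr1n.
  have incr (x y : 'rV[R]_n) : enorm x < 1 -> enorm y < 1 ->
      u x - u y <= A * M * enorm (x - y) `^ gam.
    (* If M = 0 then u vanishes on B_2, and dividing by M is not possible. *)
    move: M0; rewrite le_eqVlt => /orP[/eqP M0|M0] x1 y1.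
      have z (w : 'rV[R]_n) : enorm w < 1 -> u w = 0.
        by move=> w1; have := le_trans (uS _ (B12 _ w1)) SM; rewrite -M0 normr_le0 => /eqP.
      by rewrite !z// subrr -M0 mulr0 mul0r.
    pose v w := M^-1 * u w.
    have uv w : u w = M * v w by rewrite /v mulVKf// gt_eqF.
    have vL : Lsp p s v by exact: LspZ.
    have vN : normalized p s C0 K v.
      split => //.
      - move=> w w2; have : {within B2, continuous u}.
          by apply: continuous_subspaceW cont; exact: subset_closure.
        rewrite continuous_open_subspace; last exact: open_eball.
        move=> /(_ w (mem_set w2)) cu.
        by apply: (@continuousM R _ (cst M^-1) u w) => //; exact: cst_continuous.
      - move=> w w2; rewrite /v normrM gtr0_norm ?invr_gt0// mulrC ler_pdivrMr// mul1r.
        exact: le_trans (uS _ w2) SM.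
      - have -> : (\int[lebesgue_rV R n]_(z in ~` eball 0 2)
            (`|v z| `^ (p - 1) * enorm (z : 'rV[R]_n) `^ (- (n%:R + p * s)))%:E =
          \int[lebesgue_rV R n]_(z in ~` eball 0 2) ((M^-1 `^ (p - 1))%:E *
            (`|u z| `^ (p - 1) * enorm (z : 'rV[R]_n) `^ (- (n%:R + p * s)))%R%:E))%E.
          apply: eq_integral => z _; rewrite -EFinM mulrA -powRM ?invr_ge0 ?(ltW M0)//.
          by rewrite /v normrM (gtr0_norm (_ : 0 < M^-1)) ?invr_gt0.
        rewrite (ge0_integralZl_EFin _ (measurable_eballC _ _)).
        + apply: (@le_trans _ _ ((M^-1 `^ (p - 1))%:E * (t `^ (p - 1))%:E)%E).
            by apply: lee_wpmul2l => //; rewrite lee_fin powR_ge0.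
          rewrite -EFinM lee_fin -powRM ?invr_ge0 ?(ltW M0)//.
          apply: powR_le1; first exact: ltW.
          rewrite mulr_ge0 ?invr_ge0 ?(ltW M0)//= mulrC ler_pdivrMr// mul1r.
          exact: tM.
        + by move=> z _; rewrite lee_fin mulr_ge0 ?powR_ge0.
        + apply/measurable_EFinP; apply: measurable_funM.
            apply: measurable_funS (measurable_normp p (_ : lebesgue_measurable u)) => //.
            by case: uL.
          by apply/measurable_EFinP; apply: measurable_enorm_powR; exact: measurable_eballC.
        + exact: powR_ge0.
      - exact: (HC0 K C M u v K_adm M0 CM vL uv usub).
      - have CM' : - - C <= M `^ (p - 1) by rewrite opprK.
        have vL' : Lsp p s (fun w => - v w).
          rewrite (_ : (fun w => - v w) = fun w => -1 * v w); first exact: LspZ.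
          by apply/funext => w; rewrite mulN1r.
        have uv' w : - u w = M * (- v w) by rewrite uv mulrN.
        exact: (HC0 K (- - C) M (fun w => - u w) (fun w => - v w) K_adm M0 CM' vL' uv' usuper).
    rewrite !uv -mulrBr [A * M]mulrC -mulrA ler_pM2l//.
    exact: (HA K v K_adm vN).
  have seminorm : (holder_seminorm gam B1 u <= (A * M)%:E)%E.
    apply: ge_ereal_sup => _ [[x y] /= [/eball0P x1 /eball0P y1 xy] <-].
    rewrite lee_fin ler_pdivrMr ?powR_gt0 ?enorm_gt0 ?subr_eq0//.
    rewrite ler_norml lerNl opprB {1}enormBC !incr//.
  have sup : (sup_norm B1 u <= M%:E)%E.
    apply: ge_ereal_sup => _ [x /eball0P x1 <-]; rewrite lee_fin.
    exact: le_trans (uS _ (B12 _ x1)) SM.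
  have main : (holder_norm gam B1 u <= ((A + 1) * M)%:E)%E.
    by rewrite mulrDl mul1r addrC EFinD; apply: leeD.
  split; first by apply: le_lt_trans main _; exact: ltry.
  by rewrite SE tE -!EFinD -EFinM.
split=> [gam|crit].
  rewrite lt_min => /andP[g0 /andP[g1]]; rewrite ltr_pdivlMr// => gp.
  apply: est; apply: holder_bound_lt => //; first by rewrite g0.
  by rewrite [p * s]mulrC.
apply: est; rewrite /gamma0; have [h|h] := ltP 1 (s * p / (p - 1)).
  apply: holder_bound_lipschitz => //.
  by move: h; rewrite ltr_pdivlMr// mul1r [p * s]mulrC.
apply: holder_bound_critical => //.
  by rewrite divr_gt0 ?mulr_gt0 ?(lt_trans ltr01 p_gt1)//= lt_neqAle crit.
by rewrite divfK ?gt_eqF// mulrC.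
Qed.
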